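(* Let $R\subseteq\mathbb N$ be a congruence-periodic sparse predicate. If $(F_n)$ holds for every $n\in\mathbb N^+$, then $(\mathbb Z,<,+,R)$ is distal.
   Context: Let $R\subseteq\mathbb N$ be infinite, enumerated increasingly as $(r_n)$; $\sigma:R\to R$ is the successor map, $\sigma^k$ its iterate. An operator on $R$ is a function $z\mapsto\sum_{i=0}^ma_i\sigma^i(z)$, $a_i\in\mathbb Z$. $A=_R0$: $Az=0$ for all $z\in R$; $A>_R0$ (resp. $<_R0$): $Az>0$ (resp. $<0$) for cofinitely many $z$. $R$ sparse: every operator satisfies (S1) $A=_R0$ or $A>_R0$ or $A<_R0$, and (S2) if $A>_R0$ there is $\Delta$ with $A(\sigma^\Delta z)>z$ for all $z$. Congruence-periodic: $(r_n\bmod m)$ eventually periodic for each $m\ge1$. Formulas are evaluated in $\mathcal M=(\mathbb Z,<,+,R)$ and may use $\{<,+,R\}$-definable sets/functions. A strong honest definition for $\phi(x;y)$ is a formula $\psi(x;y^{(1)},\dots,y^{(k)})$ such that for every $a$ and finite $B\subseteq\mathbb Z^{|y|}$, $|B|\ge2$, there is $c\in B^k$ with $\mathcal M\models\psi(a;c)$ and for all $a'\models\psi(x;c)$, $b\in B$: $\phi(a;b)\leftrightarrow\phi(a';b)$; $\mathcal M$ is distal if every partitioned formula has one. $\tilde R\subseteq^dR$: $\tilde R=\{r_{N+dt}:t\in\mathbb N\}$ for some $N$. $\mathbf A\cdot z=\sum A_iz_i$, $\mathbf A\cdot S=\{\mathbf A\cdot z:z\in S\}$. $\tilde R^n_\Delta=\{z\in\tilde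 R^n:z_i\ge\sigma^\Delta z_{i+1}\ (1\le i\le n)\}$, $z_{n+1}:=\min\tilde R$. For $\mathbf A$ with entries $\neq_R0$ and $\Delta$ large enough that $z\mapsto\mathbf A\cdot z$ is injective on $R^n_\Delta$, $P_\Delta(x;\mathbf A,\tilde R)$ is the $z\in\tilde R^n_\Delta$ with largest $\mathbf A\cdot z$ subject to $\mathbf A\cdot z<x$ if $x>\inf\mathbf A\cdot\tilde R^n_\Delta$, and otherwise the $z\in\tilde R^n_\Delta$ minimising $\mathbf A\cdot z$. $\mathbf F^i$ is the $n$-tuple with the identity operator in position $i$ and $0$ elsewhere. $(F_n)$: for all $d\ge1$, $\tilde R\subseteq^dR$, $n$-tuple $\mathbf A$ of operators all $\neq_R0$, $n$-tuple $\mathbf B$ of operators, $\square\in\{<,>\}$, and $E\in\{0,1\}$ with $E=1$ unless $\mathbf B=\mathbf F^i$ for some $i$, there is $\Delta_0$ such that for all $\Delta\in d\mathbb N$ with $\Delta\ge\Delta_0$ the formula $Ex-y_2\ \square\ \mathbf B\cdot P_\Delta(x-y_1;\mathbf A,\tilde R)$, partitioned as $(x;y_1,y_2)$ with $|x|=1$, has a strong honest definition. *)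

(* Defs.v *)
From HB Require Import structures.
From mathcomp Require Import all_boot all_order all_algebra.
From Stdlib Require Import ClassicalEpsilon.
Set Implicit Arguments. Unset Strict Implicit. Unset Printing Implicit Defensive.
Import Order.TTheory GRing.Theory Num.Theory.
Local Open Scope ring_scope.

(* R is given by its strictly increasing enumeration r : nat -> nat;   *)
(* as a subset of Z, z \in R  <->  z = r n for some n.                 *)
Definition inR (r : nat -> nat) (z : int) : Prop := exists n, z = (r n)%:Z.

(* Integer constants are included: every integer is 0-definable in     *)
(* (Z,<,+) (0 : x+x=x, 1 : least positive element), so this does not   *)
(* change the definable sets.                                           *)
Inductive term : Type :=
| Tvar : nat -> term
| Tconst : int -> term
| Tadd : term -> term -> term.

Inductive formula : Type :=
| Flt : term -> term -> formula
| Feq : term -> term -> formula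
| FR : term -> formula
| Fnot : formula -> formula
| Fand : formula -> formula -> formula
| For : formula -> formula -> formula
| Fex : nat -> formula -> formula
| Fall : nat -> formula -> formula.

Fixpoint eval_term (e : nat -> int) (t : term) : int :=
  match t with
  | Tvar v => e v
  | Tconst c => c
  | Tadd t1 t2 => eval_term e t1 + eval_term e t2
  end.

Definition upd (e : nat -> int) (v : nat) (z : int) : nat -> int :=
  fun w => if w == v then z else e w.

Fixpoint holds (r : nat -> nat) (e : nat -> int) (f : formula) : Prop :=
  match f with
  | Flt t1 t2 => eval_term e t1 < eval_term e t2
  | Feq t1 t2 => eval_term e t1 = eval_term e t2
  | FR t => inR r (eval_term e t)
  | Fnot g => ~ holds r e g
  | Fand g h => holds r e g /\ holds r e h
  | For g h => holds r e g \/ holds r e h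
  | Fex v g => exists z, holds r (upd e v z) g
  | Fall v g => forall z, holds r (upd e v z) g
  end.

Definition definable2 (r : nat -> nat) (p q : nat)
  (phi : p.-tuple int -> q.-tuple int -> Prop) : Prop :=
  exists f : formula, forall e : nat -> int,
    holds r e f <-> phi [tuple e i | i < p] [tuple e (p + j)%N | j < q].

Definition definableK (r : nat -> nat) (p q k : nat)
  (psi : p.-tuple int -> k.-tuple (q.-tuple int) -> Prop) : Prop :=
  exists f : formula, forall e : nat -> int,
    holds r e f <-> psi [tuple e i | i < p]
                        [tuple [tuple e (p + l * q + j)%N | j < q] | l < k].

Definition strong_honest_def (p q k : nat)
  (phi : p.-tuple int -> q.-tuple int -> Prop)
  (psi : p.-tuple int -> k.-tuple (q.-tuple int) -> Prop) : Prop :=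
  forall (a : p.-tuple int) (B : seq (q.-tuple int)),
    (1 < size (undup B))%N ->
    exists c : k.-tuple (q.-tuple int),
      (forall l, tnth c l \in B) /\ psi a c /\
      forall a' : p.-tuple int, psi a' c ->
        forall b, b \in B -> (phi a b <-> phi a' b).

Definition has_SHD (r : nat -> nat) (p q : nat)
  (phi : p.-tuple int -> q.-tuple int -> Prop) : Prop :=
  exists (k : nat) (psi : p.-tuple int -> k.-tuple (q.-tuple int) -> Prop),
    definableK r psi /\ strong_honest_def phi psi.

Definition distal (r : nat -> nat) : Prop :=
  forall (p q : nat) (phi : p.-tuple int -> q.-tuple int -> Prop),
    definable2 r phi -> has_SHD r phi.

(* An operator is its coefficient list [a_0; ...; a_m]; its value at    *)
(* z = r m (the m-th element of R) is sum_i a_i sigma^i(z)              *)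
(*   = sum_i a_i r (m + i).                                             *)
Definition opv (r : nat -> nat) (A : seq int) (m : nat) : int :=
  \sum_(i < size A) A`_i * (r (m + i)%N)%:Z.

Definition op_zero (r : nat -> nat) (A : seq int) : Prop :=
  forall m, opv r A m = 0.
Definition op_pos (r : nat -> nat) (A : seq int) : Prop :=
  exists M, forall m, (M <= m)%N -> 0 < opv r A m.
Definition op_neg (r : nat -> nat) (A : seq int) : Prop :=
  exists M, forall m, (M <= m)%N -> opv r A m < 0.

Definition sparse (r : nat -> nat) : Prop :=
  forall A : seq int,
    (op_zero r A \/ op_pos r A \/ op_neg r A) /\
    (op_pos r A -> exists D : nat, forall m, (r m)%:Z < opv r A (m + D)%N).

Definition congruence_periodic (r : nat -> nat) : Prop :=
  forall M : nat, (0 < M)%N ->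
    exists N0 per : nat, (0 < per)%N /\
      forall m, (N0 <= m)%N -> (r (m + per) %% M = r m %% M)%N.

Definition op_eq (r : nat -> nat) (A B : seq int) : Prop :=
  forall m, opv r A m = opv r B m.

(* elements of R^n are represented by their index vectors u             *)
(* (z_i = r (u_i)); A . z = sum_i A_i z_i                               *)
Definition dotop (r : nat -> nat) (n : nat) (A : n.-tuple (seq int))
  (u : n.-tuple nat) : int :=
  \sum_(i < n) opv r (tnth A i) (tnth u i).

(* ~R = { r_(N + d t) : t in N } ; u_i index of an element of ~R        *)
Definition in_tilde (N d u : nat) : Prop := exists t, u = (N + d * t)%N.

(* ~R^n_Delta : z_i >= sigma^Delta z_(i+1) (1 <= i <= n), with         *)
(* z_(n+1) := min ~R = r N                                              *)
Definition RtD (r : nat -> nat) (N d D n : nat) (u : n.-tuple nat) : Prop :=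
  (forall i : 'I_n, in_tilde N d (tnth u i)) /\
  (forall i : 'I_n, (r (nth N u i.+1 + D)%N <= r (tnth u i))%N).

Definition P_spec (r : nat -> nat) (N d D n : nat) (A : n.-tuple (seq int))
  (x : int) (u : n.-tuple nat) : Prop :=
  RtD r N d D u /\
  ((exists u', RtD r N d D u' /\ dotop r A u' < x) ->
     dotop r A u < x /\
     forall u', RtD r N d D u' -> dotop r A u' < x -> dotop r A u' <= dotop r A u) /\
  (~ (exists u', RtD r N d D u' /\ dotop r A u' < x) ->
     forall u', RtD r N d D u' -> dotop r A u <= dotop r A u').

Definition P_Delta (r : nat -> nat) (N d D n : nat) (A : n.-tuple (seq int))
  (x : int) : n.-tuple nat :=
  epsilon (inhabits (nseq_tuple n 0%N)) (P_spec r N d D A x).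

Definition F_op (n : nat) (i : 'I_n) : n.-tuple (seq int) :=
  [tuple (if j == i then [:: 1] else [::]) | j < n].

Definition is_F (r : nat -> nat) (n : nat) (B : n.-tuple (seq int)) : Prop :=
  exists i : 'I_n, forall j : 'I_n, op_eq r (tnth B j) (tnth (F_op i) j).

Definition phiF (r : nat -> nat) (N d D n : nat) (A B : n.-tuple (seq int))
  (lt E : bool) : 1.-tuple int -> 2.-tuple int -> Prop :=
  fun x y =>
    let x0 := tnth x ord0 in
    let y1 := tnth y ord0 in
    let y2 := tnth y ord_max in
    let lhs := (if E then x0 else 0) - y2 in
    let rhs := dotop r B (P_Delta r N d D A (x0 - y1)) in
    if lt then lhs < rhs else rhs < lhs.

Definition F_prop (r : nat -> nat) (n : nat) : Prop :=
  forall (d N : nat) (A B : n.-tuple (seq int)) (lt E : bool),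
    (0 < d)%N ->
    (forall i : 'I_n, ~ op_zero r (tnth A i)) ->
    (E = false -> is_F r B) ->
    exists D0 : nat, forall D : nat, (D0 <= D)%N -> (d %| D)%N ->
      has_SHD r (phiF r N d D A B lt E).

(* Main.v *)
Require Import Defs.
From mathcomp Require Import all_boot all_order all_algebra.
From mathcomp Require Import zify ring.
From Stdlib Require Import Classical FunctionalExtensionality ClassicalEpsilon.
Set Implicit Arguments. Unset Strict Implicit. Unset Printing Implicit Defensive.
Import Order.TTheory GRing.Theory Num.Theory.
Local Open Scope ring_scope.


(** Strong honest definitions for several object variables reduce to one object variable.

    Quantifiers are eliminated in the language with [+], [<], congruences and the functions
    [u |-> sigma^k (lambda u)], where [lambda u] is the largest element of R below [u]
    (Semenov).  A bound variable [w] is removed by naming every [lambda]-term in [w] by a new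
    variable in R and eliminating [w] as in Presburger arithmetic.  Sparseness implies that
    [lambda (A z + t)] is within boundedly many steps of [z] or of [lambda t], unless [z]
    itself is within boundedly many steps of [lambda (+-t)]; so a bound variable [z] in R only
    has to be tested at boundedly many places around such terms.

    For one object variable [x] over parameters [y], terms are evaluated along expansions
    [c x = g y + A_0 z_0 + ... + A_(n-1) z_(n-1) + rho] with [z_0 >> z_1 >> ... >> z_n] in R
    and [z_n] of the size of [rho].  If [lambda] is applied to [a x + f y + sum_i B_i z_i], the
    value is within boundedly many steps of some [z_i] or of [lambda] of a definable function
    of [y], or else the argument is much smaller than [z_n] and is the remainder of a longer
    expansion.  An expansion with large gaps is the lexicographically maximal tuple below its
    target, that is, [z = P_Delta (c x - g y)], so that all conditions which arise are instances
    of (F_n).  The gap needed by an expansion depends on the conditions met later on; this is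
    why the case analysis is written in continuation-passing style ([step], [tame]). *)

(** * Definable sets and functions *)

(** Two features of (F_n) shape the argument. It speaks of one tuple P_Delta and not of arbitrary
    chains, so the coordinates of an expansion must be determined by the target; their uniqueness is
    also what lets the quantifier over coordinates commute with negation and conjunction. And when
    [x] does not occur outside P_Delta, it only allows comparisons with single coordinates, so an
    inequality between a parameter term and a sum of operators has to be reduced to its leading
    coordinate by hand. Congruences dictate the choice of [~R]: all moduli of the quantifier-free
    formula divide one number [M], and [d] is a period of [r] modulo [M]. On one class of indices
    modulo [d] every operator is eventually constant modulo each divisor of [M]. A remainder whose
    size has another class is handled by the offset of the expansion, at the price of [d] versions
    of each expansion. Sparseness enters only through operators: (S1) gives signs, (S2) gives lower
    bounds, and (S2) for the operator [sigma z - z] gives exponential growth, which makes large gaps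
    decisive. *)

Definition env := nat -> int.
Definition scons (z : int) (e : env) : env := fun i => if i is j.+1 then e j else z.
Definition shift (e : env) : env := fun i => e i.+1.

Lemma sconsK z e : shift (scons z e) = e. Proof. by []. Qed.
Fixpoint tbound (t : term) : nat :=
  match t with
  | Tvar v => v.+1 | Tconst _ => 0%N | Tadd t1 t2 => maxn (tbound t1) (tbound t2)
  end.

Fixpoint fbound (f : formula) : nat :=
  match f with
  | Flt t1 t2 | Feq t1 t2 => maxn (tbound t1) (tbound t2)
  | FR t => tbound t
  | Fnot g => fbound g
  | Fand g h | For g h => maxn (fbound g) (fbound h)
  | Fex v g | Fall v g => maxn v.+1 (fbound g)
  end.

Fixpoint trename (p : nat -> nat) (t : term) : term :=
  match t with
  | Tvar v => Tvar (p v) | Tconst c => Tconst c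
  | Tadd t1 t2 => Tadd (trename p t1) (trename p t2)
  end.

Fixpoint frename (p : nat -> nat) (f : formula) : formula :=
  match f with
  | Flt t1 t2 => Flt (trename p t1) (trename p t2)
  | Feq t1 t2 => Feq (trename p t1) (trename p t2)
  | FR t => FR (trename p t)
  | Fnot g => Fnot (frename p g)
  | Fand g h => Fand (frename p g) (frename p h)
  | For g h => For (frename p g) (frename p h)
  | Fex v g => Fex (p v) (frename p g)
  | Fall v g => Fall (p v) (frename p g)
  end.

Section Definability.
Variable r : nat -> nat.

Lemma eval_term_bound t (e e' : env) :
  (forall i, (i < tbound t)%N -> e i = e' i) -> eval_term e t = eval_term e' t.
Proof.
elim: t => [v|c|t1 IH1 t2 IH2] //= H; first exact: H.
by rewrite IH1 ?IH2 // => i Hi; apply: H; rewrite leq_max Hi ?orbT.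
Qed.

Lemma holds_bound f : forall e e' : env,
  (forall i, (i < fbound f)%N -> e i = e' i) -> holds r e f <-> holds r e' f.
Proof.
have up (v : nat) (g : formula) (z : int) (e e' : env) :
    (forall i, (i < maxn v.+1 (fbound g))%N -> e i = e' i) ->
    forall i, (i < fbound g)%N -> upd e v z i = upd e' v z i.
  by move=> H i Hi; rewrite /upd; case: eqP => // _; apply: H; rewrite leq_max Hi orbT.
elim: f => [t1 t2|t1 t2|t|g IH|g IHg h IHh|g IHg h IHh|v g IH|v g IH] e e' /= H.
- by rewrite !(@eval_term_bound _ e e') // => i Hi; apply: H; rewrite leq_max Hi ?orbT.
- by rewrite !(@eval_term_bound _ e e') // => i Hi; apply: H; rewrite leq_max Hi ?orbT.
- by rewrite !(@eval_term_bound _ e e').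
- by rewrite (IH e e').
- by rewrite (IHg e e') ?(IHh e e') // => i Hi; apply: H; rewrite leq_max Hi ?orbT.
- by rewrite (IHg e e') ?(IHh e e') // => i Hi; apply: H; rewrite leq_max Hi ?orbT.
- by split=> -[z Hz]; exists z; apply/(IH _ _ (up v g z e e' H)).
- by split=> Hz z; apply/(IH _ _ (up v g z e e' H)).
Qed.

Lemma eval_trename p t (e : env) : eval_term e (trename p t) = eval_term (e \o p) t.
Proof. by elim: t => [v|c|t1 IH1 t2 IH2] //=; rewrite IH1 IH2. Qed.

Lemma holds_frename p f : injective p ->
  forall e : env, holds r e (frename p f) <-> holds r (e \o p) f.
Proof.
move=> pI.
have up (v : nat) (z : int) (e : env) : upd e (p v) z \o p = upd (e \o p) v z.
  by apply: functional_extensionality => i; rewrite /upd /= (inj_eq pI).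
elim: f => [t1 t2|t1 t2|t|g IH|g IHg h IHh|g IHg h IHh|v g IH|v g IH] e /=;
  rewrite ?eval_trename ?IH ?IHg ?IHh //.
- by split=> -[z Hz]; exists z; move: Hz; rewrite IH up.
- by split=> Hz z; move: (Hz z); rewrite IH up.
Qed.

Definition Def (P : env -> Prop) : Prop := exists f, forall e, holds r e f <-> P e.
Definition DefFun (g : env -> int) : Prop := Def (fun e => e 0%N = g (shift e)).

Lemma Def_iff P P' : Def P -> (forall e, P e <-> P' e) -> Def P'.
Proof. by move=> [f Hf] H; exists f => e; rewrite Hf. Qed.

Lemma Def_not P : Def P -> Def (fun e => ~ P e).
Proof. by move=> [f Hf]; exists (Fnot f) => e /=; rewrite Hf. Qed.

Lemma Def_and P P' : Def P -> Def P' -> Def (fun e => P e /\ P' e).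
Proof. by move=> [f Hf] [g Hg]; exists (Fand f g) => e /=; rewrite Hf Hg. Qed.

Lemma Def_or P P' : Def P -> Def P' -> Def (fun e => P e \/ P' e).
Proof. by move=> [f Hf] [g Hg]; exists (For f g) => e /=; rewrite Hf Hg. Qed.

Lemma Def_True (Q : Prop) : Def (fun=> Q).
Proof.
have T : holds r (fun=> 0) (Feq (Tconst 0) (Tconst 0)) by [].
case: (classic Q) => HQ; first by exists (Feq (Tconst 0) (Tconst 0)).
by exists (Feq (Tconst 0) (Tconst 1)).
Qed.

Lemma Def_imp P P' : Def P -> Def P' -> Def (fun e => P e -> P' e).
Proof.
move=> dP dP'; apply: (Def_iff (Def_or (Def_not dP) dP')) => e.
by split=> [[]//|H]; case: (classic (P e)) => [/H|]; [right|left].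
Qed.

Lemma Def_fin (I : finType) (P : I -> env -> Prop) :
  (forall i, Def (P i)) -> Def (fun e => exists i, P i e).
Proof.
move=> dP.
suff H (s : seq I) : Def (fun e => exists2 i, i \in s & P i e).
  apply: (Def_iff (H (enum I))) => e; split=> [[i _ Hi]|[i Hi]]; exists i => //.
  by rewrite mem_enum.
elim: s => [|i s IH]; first by apply: (Def_iff (Def_True False)) => e; split=> // -[].
apply: (Def_iff (Def_or (dP i) IH)) => e; split.
  by move=> [Hi|[j Hj Pj]]; [exists i; rewrite ?mem_head|exists j; rewrite // inE Hj orbT].
by move=> [j]; rewrite inE => /orP [/eqP->|Hj] Pj; [left|right; exists j].
Qed.

Lemma Def_supp P : Def P -> exists M, forall e e' : env,
  (forall i, (i < M)%N -> e i = e' i) -> P e <-> P e'.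
Proof. by move=> [f Hf]; exists (fbound f) => e e' H; rewrite -!Hf; apply: holds_bound. Qed.

Lemma Def_ren p P : injective p -> Def P -> Def (fun e => P (e \o p)).
Proof. by move=> pI [f Hf]; exists (frename p f) => e; rewrite holds_frename. Qed.

Lemma Def_ex P : Def P -> Def (fun e => exists z, P (scons z e)).
Proof.
move=> [f Hf]; pose M := fbound f.
(* The map [p] gives variable 0 the name [M], which does not occur in [f], and lowers the other
   variables of [f] by one; it is the identity beyond [M], which keeps it injective. *)
pose p i := if i == 0%N then M else if (i <= M)%N then i.-1 else i.
have pI : injective p by move=> i j; rewrite /p; do !case: ifP; lia.
exists (Fex M (frename p f)) => e /=.
have E z : holds r (upd e M z) (frename p f) <-> P (scons z e).
  rewrite holds_frename // -Hf; apply: holds_bound => -[|i] /= Hi; rewrite /upd /p /=.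
    by rewrite eqxx.
  have -> : (i < M)%N by rewrite /M; lia.
  by case: eqP => // E; move: Hi; rewrite -/M E; lia.
by split=> -[z Hz]; exists z; apply/E.
Qed.

Lemma Def_all P : Def P -> Def (fun e => forall z, P (scons z e)).
Proof.
move=> dP; apply: (Def_iff (Def_not (Def_ex (Def_not dP)))) => e; split.
  by move=> H z; apply: NNPP => Hz; apply: H; exists z.
by move=> H [z]; apply.
Qed.

Lemma DefFun_shift g : DefFun g -> DefFun (fun e => g (shift e)).
Proof.
move=> dg; pose p i := if i is j.+1 then j.+2 else 0%N.
have pI : injective p by case=> [|i] [|j] //= [->].
by apply: (Def_iff (Def_ren pI dg)).
Qed.

(** Only finitely many variables of [P] matter. Each of them is bound by a quantifier
    [exists z, z = F i e], so definable functions can be substituted although the language has no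
    symbols for them. *)
Lemma Def_subst P (F : nat -> env -> int) :
  Def P -> (forall i, DefFun (F i)) -> Def (fun e => P (fun i => F i e)).
Proof.
move=> dP dF; have [M HM] := Def_supp dP.
pose cat m (z e : env) : env := fun i => if (i < m)%N then z i else e (i - m)%N.
suff H m : forall F : nat -> env -> int, (forall i, DefFun (F i)) ->
    Def (fun e => P (cat m (fun i => F i e) e)).
  by apply: (Def_iff (H M F dF)) => e; apply: HM => i Hi; rewrite /cat Hi.
elim: m {F dF} => [|m IH] F dF.
  apply: (Def_iff dP) => e; suff -> : cat 0%N (fun i => F i e) e = e by [].
  by apply: functional_extensionality => i; rewrite /cat subn0.
have := Def_ex (Def_and (dF m) (IH (fun i e => F i (shift e)) (fun i => DefFun_shift (dF i)))).
move/Def_iff; apply=> e.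
have E : cat m.+1 (fun i => F i e) e = cat m (fun i => F i e) (scons (F m e) e).
  apply: functional_extensionality => i; rewrite /cat ltnS; case: ltngtP => //.
    by case: i => // i Hi; rewrite subSS subSn.
  by move=> ->; rewrite subnn.
by rewrite E; split=> [[z /= [-> ]]|H] //; exists (F m e).
Qed.

Lemma DefFun_iff g g' : DefFun g -> (forall e, g e = g' e) -> DefFun g'.
Proof. by move=> dg H; apply: (Def_iff dg) => e; rewrite H. Qed.

Lemma DefFun_var i : DefFun (fun e => e i).
Proof. by exists (Feq (Tvar 0) (Tvar i.+1)). Qed.

Lemma DefFun_const c : DefFun (fun=> c).
Proof. by exists (Feq (Tvar 0) (Tconst c)). Qed.

Lemma DefFun_comp g (F : nat -> env -> int) :
  DefFun g -> (forall i, DefFun (F i)) -> DefFun (fun e => g (fun i => F i e)).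
Proof.
move=> dg dF.
pose F' i : env -> int := if i is j.+1 then fun e => F j (shift e) else fun e => e 0%N.
have dF' i : DefFun (F' i).
  by case: i => [|i]; [exact: DefFun_var | exact: DefFun_shift].
exact: (Def_subst dg dF').
Qed.

Lemma DefFun_add g h : DefFun g -> DefFun h -> DefFun (fun e => g e + h e).
Proof.
move=> dg dh; have dA : DefFun (fun e => e 0%N + e 1%N).
  by exists (Feq (Tvar 0) (Tadd (Tvar 1) (Tvar 2))).
pose F i := if i is 0%N then g else h.
by apply: (@DefFun_comp _ F dA); case.
Qed.

Lemma DefFun_opp g : DefFun g -> DefFun (fun e => - g e).
Proof.
move=> dg; have dA : DefFun (fun e => - e 0%N).
  exists (Feq (Tadd (Tvar 0) (Tvar 1)) (Tconst 0)) => e /=; rewrite /shift.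
  by split=> [/eqP|->]; rewrite ?addNr // addr_eq0 => /eqP.
by apply: (@DefFun_comp _ (fun=> g) dA).
Qed.

Lemma DefFun_comp1 (h : int -> int) g :
  DefFun (fun e => h (e 0%N)) -> DefFun g -> DefFun (fun e => h (g e)).
Proof. by move=> dh dg; apply: (@DefFun_comp _ (fun=> g) dh). Qed.

Lemma Def_eq g h : DefFun g -> DefFun h -> Def (fun e => g e = h e).
Proof.
move=> dg dh; have d : Def (fun e => e 0%N = e 1%N) by exists (Feq (Tvar 0) (Tvar 1)).
by apply: (@Def_subst _ (fun i => if i is 0%N then g else h) d); case.
Qed.

End Definability.


(** * Arithmetic of sparse sequences *)

Lemma fin_bound (I : finType) (P : I -> nat -> Prop) :
  (forall i, exists K, forall n, (K <= n)%N -> P i n) ->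
  exists K, forall n, (K <= n)%N -> forall i, P i n.
Proof.
move=> H; pose K i := proj1_sig (constructive_indefinite_description _ (H i)).
have HK i n : (K i <= n)%N -> P i n.
  by rewrite /K; case: constructive_indefinite_description => /= k; apply.
exists (\max_i K i) => n Hn i; apply: HK; apply: leq_trans Hn; exact: leq_bigmax.
Qed.

Section Arith.
Variable r : nat -> nat.
Hypothesis r_inc : forall m, (r m < r m.+1)%N.

Lemma leq_r : {mono r : m n / (m <= n)%N}.
Proof. exact/leq_mono/(homo_ltn ltn_trans). Qed.

Lemma ltn_r : {mono r : m n / (m < n)%N}.
Proof. exact: leqW_mono leq_r. Qed.

Lemma r_inj : injective r.
Proof. exact: incn_inj leq_r. Qed.

Lemma ler_r m n : ((r m)%:Z <= (r n)%:Z) = (m <= n)%N.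
Proof. by rewrite lez_nat leq_r. Qed.

Lemma ltr_r m n : ((r m)%:Z < (r n)%:Z) = (m < n)%N.
Proof. by rewrite ltz_nat ltn_r. Qed.

Lemma r_ge n : (n <= r n)%N.
Proof. by elim: n => // n IH; apply: leq_ltn_trans IH (r_inc n). Qed.

(* The index of the largest element of R below [u]; it is 0 if there is none. *)
Definition idx (u : int) : nat := \max_(n < `|u|.+1 | (r n)%:Z <= u) n.

Lemma idx_ge (u : int) n : (r n)%:Z <= u -> (n <= idx u)%N.
Proof.
move=> Hn; have lt : (n < `|u|.+1)%N by have := r_ge n; lia.
exact: (@leq_bigmax_cond _ (fun i : 'I_ _ => (r i)%:Z <= u) (fun i => nat_of_ord i) (Ordinal lt)).
Qed.

Lemma idx_lt (u : int) : u < (r (idx u).+1)%:Z.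
Proof. by rewrite ltNge; apply/negP => /idx_ge; rewrite ltnn. Qed.

Lemma idx_le (u : int) : (r 0%N)%:Z <= u -> (r (idx u))%:Z <= u.
Proof.
move=> H0; rewrite /idx; elim/big_ind: _ => // m n; rewrite /maxn; by case: ifP.
Qed.

Lemma idx_eq0 (u : int) : u < (r 1)%:Z -> idx u = 0%N.
Proof.
move=> H; case E: (idx u) => [//|n]; have := idx_ge (u := u).
case: (lerP (r 0%N)%:Z u) => [/idx_le|/ltW H0].
  by rewrite E => H2; have := le_lt_trans H2 H; rewrite ltr_r.
move: E; rewrite /idx big1 // => i Hi; have := le_trans Hi (ltW (idx_lt u)).
case: i Hi => /= -[|i] // _ Hi; have := lt_le_trans H (le_trans _ H0).
by have := ler_r 1 i.+1; have := ler_r 0 1; lia.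
Qed.

(** The disjunct [r q <= r 0] expresses [q = 0] by comparing elements of R, so that an equation
    between indices becomes a Boolean combination of inequalities between terms. *)
Lemma idxP (u : int) q :
  idx u = q <-> u < (r q.+1)%:Z /\ ((r q)%:Z <= u \/ (r q)%:Z <= (r 0%N)%:Z).
Proof.
split=> [<-|[H1]].
  split; first exact: idx_lt.
  case: (lerP (r 0%N)%:Z u) => [/idx_le|H]; first by left.
  by right; rewrite idx_eq0 //; apply: lt_trans H _; rewrite ltr_r.
case=> [H2|]; last by rewrite ler_r leqn0 => /eqP q0; rewrite q0 in H1 *; exact: idx_eq0.
apply/eqP; rewrite eqn_leq (idx_ge H2) andbT -ltnS -ltr_r.
by apply: le_lt_trans H1; apply: idx_le; apply: le_trans H2; rewrite ler_r.
Qed.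

Lemma idx_r n : idx (r n)%:Z = n.
Proof. by apply/idxP; rewrite ltr_r ltnSn; split=> //; left. Qed.

Lemma idx_mono u v : u <= v -> (idx u <= idx v)%N.
Proof.
move=> H; case: (lerP (r 0%N)%:Z u) => [/idx_le H0|H0].
  by apply: idx_ge; apply: le_trans H.
by rewrite (idx_eq0 (lt_trans H0 _)) // ltr_r.
Qed.

Definition mag (u : int) : nat := idx `|u|.

Lemma mag_lt u : `|u| < (r (mag u).+1)%:Z. Proof. exact: idx_lt. Qed.

Lemma mag_le u : (0 < mag u)%N -> (r (mag u))%:Z <= `|u|.
Proof.
have [_ [//|]] := (idxP `|u| (mag u)).1 erefl.
by rewrite ler_r leqn0 => /eqP->.
Qed.

Lemma mag_mono u v : `|u| <= `|v| -> (mag u <= mag v)%N. Proof. exact: idx_mono. Qed.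

Lemma mag_ge u n : (r n)%:Z <= `|u| -> (n <= mag u)%N. Proof. exact: idx_ge. Qed.

Lemma mag_leP u n : `|u| < (r n.+1)%:Z -> (mag u <= n)%N.
Proof.
by move=> H; case E: (mag u) => [//|m]; rewrite -E -ltnS -ltr_r;
   apply: le_lt_trans H; apply: mag_le; rewrite E.
Qed.

Lemma mag_idx u : mag u = idx u \/ mag u = idx (- u).
Proof. by rewrite /mag; case: (ger0P u) => H; [left|right]. Qed.

Lemma idx_mag u : idx u = 0%N \/ (0 < u /\ idx u = mag u).
Proof.
case: (lerP u 0) => H; last by right; rewrite /mag gtr0_norm.
by left; apply: idx_eq0; apply: le_lt_trans H _; have := r_inc 0; lia.
Qed.

(* Operators as functions of the index. Dropping finitely many values admits
   negative shifts such as [fun n => r (n - k)]. *)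
Definition evop (g : nat -> int) : Prop :=
  exists D A, forall n, g (n + D)%N = opv r A n.

Lemma opv_widen A M m : (size A <= M)%N ->
  opv r A m = \sum_(i < M) A`_i * (r (m + i)%N)%:Z.
Proof.
move=> H; rewrite /opv (big_ord_widen _ (fun i => A`_i * (r (m + i)%N)%:Z) H) big_mkcond /=.
by apply: eq_bigr => i _; case: ltnP => // Hi; rewrite nth_default // mul0r.
Qed.

Lemma opv_shift A k : exists B, forall m, opv r A (m + k)%N = opv r B m.
Proof.
exists (nseq k 0 ++ A) => m; rewrite /opv size_cat size_nseq big_split_ord /= [X in _ = X + _]big1 ?add0r.
  apply: eq_bigr => i _; rewrite nth_cat size_nseq ltnNge leq_addr /= addKn.
  by rewrite -addnA.
by move=> i _; rewrite nth_cat size_nseq ltn_ord nth_nseq ltn_ord mul0r.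
Qed.

Lemma evop_ev g : evop g -> exists D0, forall D, (D0 <= D)%N ->
  exists A, forall n, g (n + D)%N = opv r A n.
Proof.
move=> [D [A H]]; exists D => D' le; have [B HB] := opv_shift A (D' - D).
by exists B => n; rewrite -HB -H; congr g; lia.
Qed.

Lemma evop_eq g g' K : (forall n, (K <= n)%N -> g n = g' n) -> evop g -> evop g'.
Proof.
move=> H /evop_ev [D HD]; have [A HA] := HD (maxn D K) (leq_maxl _ _).
by exists (maxn D K), A => n; rewrite -HA H //; lia.
Qed.

Lemma evop0 : evop (fun=> 0).
Proof. by exists 0%N, [::] => n; rewrite /opv big_ord0. Qed.

Lemma evop_r k l : evop (fun n => (r (n + k - l)%N)%:Z).
Proof.
exists l, (rcons (nseq k 0) 1) => n; rewrite /opv size_rcons size_nseq big_ord_recr /=.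
rewrite nth_rcons size_nseq ltnn eqxx mul1r big1 ?add0r.
  by congr (r _)%:Z; lia.
by move=> i _; rewrite nth_rcons size_nseq ltn_ord nth_nseq ltn_ord mul0r.
Qed.

Lemma evopD g h : evop g -> evop h -> evop (fun n => g n + h n).
Proof.
move=> /evop_ev [D HD] /evop_ev [E HE].
have [A HA] := HD (maxn D E) (leq_maxl _ _); have [B HB] := HE (maxn D E) (leq_maxr _ _).
pose M := maxn (size A) (size B); exists (maxn D E), (mkseq (fun i => A`_i + B`_i) M) => n.
rewrite HA HB (@opv_widen A M) ?leq_maxl // (@opv_widen B M) ?leq_maxr // -big_split /=.
rewrite /opv size_mkseq; apply: eq_bigr => i _.
by rewrite nth_mkseq // mulrDl.
Qed.

Lemma evopZ c g : evop g -> evop (fun n => c * g n).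
Proof.
move=> [D [A H]]; exists D, (map ( *%R c) A) => n; rewrite H /opv size_map mulr_sumr.
by apply: eq_bigr => i _; rewrite (nth_map 0) // mulrA.
Qed.

Lemma evopN g : evop g -> evop (fun n => - g n).
Proof. by move/(evopZ (-1)); apply: (evop_eq (K := 0)) => n _; rewrite mulN1r. Qed.

Lemma evop_shift g k : evop g -> evop (fun n => g (n + k)%N).
Proof.
move=> /evop_ev [D HD]; have [A HA] := HD (D + k)%N (leq_addr _ _).
by exists D, A => n; rewrite -HA addnA.
Qed.

Lemma evop_shiftN g k : evop g -> evop (fun n => g (n - k)%N).
Proof.
move=> [D [A HA]]; exists (D + k)%N, A => n; rewrite -HA; congr g; lia.
Qed.

Hypothesis r_sparse : sparse r.

Definition evzero (g : nat -> int) := exists K, forall n, (K <= n)%N -> g n = 0.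

(** (S1) gives the trichotomy. (S2), applied to the operator or to its negative, strengthens the
    sign to a lower bound by a bounded shift of [r]. *)
Lemma evop_sign g : evop g ->
  evzero g \/ exists (s : bool) K, forall n, (K <= n)%N -> (r (n - K)%N)%:Z < (-1) ^+ s * g n.
Proof.
move=> [D [A HA]]; have P h B : (forall n, h (n + D)%N = opv r B n) -> op_pos r B ->
    exists K, forall n, (K <= n)%N -> (r (n - K)%N)%:Z < h n.
  move=> hB pB; have [_ /(_ pB) [E HE]] := r_sparse B.
  exists (D + E)%N => n Hn; have := HE (n - (D + E))%N.
  by rewrite -hB; congr (_ < h _); lia.
have [[H0|[H|H]] _] := r_sparse A.
- left; exists D => n Hn; rewrite -(subnK Hn) HA; exact: H0.
- by right; exists false; have [K HK] := P _ _ HA H; exists K => n /HK; rewrite mul1r.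
- right; exists true.
  have HB n : - g (n + D)%N = opv r (map -%R A) n.
    rewrite HA /opv size_map -sumrN; apply: eq_bigr => i _.
    by rewrite (nth_map 0) // mulNr.
  have pB : op_pos r (map -%R A).
    have [M HM] := H; exists M => m /HM; rewrite -HB HA; lia.
  have [K HK] := P (fun n => - g n) _ HB pB.
  by exists K => n /HK; rewrite expr1 mulN1r.
Qed.

(** (S2) for the operator [sigma z - z] gives [r m < r (m + D + 1) - r (m + D)], and the subtracted
    term is at least [r m]. *)
Lemma doubling : exists G, forall m, 2 * (r m)%:Z <= (r (m + G)%N)%:Z.
Proof.
have opv2 m : opv r [:: -1; 1] m = (r m.+1)%:Z - (r m)%:Z.
  by rewrite /opv big_ord_recl big_ord1 /= addn0 addn1 mulN1r mul1r addrC.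
have pos : op_pos r [:: -1; 1].
  exists 0%N => m _; rewrite opv2; have := ltr_r m m.+1; lia.
have [_ /(_ pos) [D HD]] := r_sparse [:: -1; 1].
exists D.+1 => m; have := HD m; rewrite opv2 -addnS.
have := ler_r m (m + D); rewrite leq_addr; lia.
Qed.

Lemma mul_bound C : exists G, forall m, C%:Z * (r m)%:Z <= (r (m + G)%N)%:Z.
Proof.
have [G HG] := doubling; elim: C => [|C [K HK]].
  by exists 0%N => m; rewrite mul0r.
exists (K + G)%N => m; have := HK m; have := HG (m + K)%N.
have := ler_r m (m + K); rewrite leq_addr -addnA => H0 H1 H2.
have -> : C.+1%:Z * (r m)%:Z = C%:Z * (r m)%:Z + (r m)%:Z by rewrite -addn1 PoszD; ring.
lia.
Qed.

Lemma mul_boundP C : exists G, forall m n, (n + G <= m)%N -> C%:Z * (r n)%:Z <= (r m)%:Z.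
Proof.
have [G HG] := mul_bound C; exists G => m n H; apply: le_trans (HG n) _.
by rewrite ler_r.
Qed.

Lemma evop_ub g : evop g -> exists K, forall n, (K <= n)%N -> `|g n| <= (r (n + K)%N)%:Z.
Proof.
move=> [D [A HA]]; pose C := (\sum_(i < size A) absz (nth (0 : int) A i))%N.
have [G HG] := mul_bound C; exists (D + size A + G)%N => n Hn.
have Hn' : (D <= n)%N by lia.
rewrite -{1}(subnK Hn') HA /opv; apply: (@le_trans _ _ (C%:Z * (r (n + size A)%N)%:Z)).
  apply: le_trans (ler_norm_sum _ _ _) _; rewrite /C (big_morph Posz PoszD (erefl _)) mulr_suml.
  apply: ler_sum => i _; rewrite normrM abszE; apply: ler_wpM2l => //.
  by rewrite ger0_norm // ler_r; have := ltn_ord i; lia.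
by apply: le_trans (HG _) _; rewrite ler_r; lia.
Qed.

(** The signed increments form an operator again. They cannot be eventually zero or negative,
    because the signed values of [g] are unbounded above. Hence they are eventually positive with
    the lower bound of [evop_sign], and in the telescoping sum the last increment alone suffices. *)
Lemma evop_incr g (s : bool) K : evop g ->
  (forall n, (K <= n)%N -> (r (n - K)%N)%:Z < (-1) ^+ s * g n) ->
  exists K', forall m n, (K' <= m)%N -> (m < n)%N ->
    (r (n - K')%N)%:Z < (-1) ^+ s * (g n - g m).
Proof.
move=> eg HK; pose h n := (-1) ^+ s * (g n.+1 - g n).
have eh : evop h.
  apply: evopZ; apply: evopD (evopN eg).
  by apply: (evop_eq (K := 0)) (evop_shift 1 eg) => n _; rewrite addn1.
have tele m k : \sum_(i < k) h (m + i)%N = (-1) ^+ s * (g (m + k)%N - g m).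
  elim: k => [|k IH]; first by rewrite big_ord0 addn0 subrr mulr0.
  by rewrite big_ord_recr /= IH /h addnS; ring.
have unb M : ~ (forall n, (M <= n)%N -> h n <= 0).
  move=> H; have H2 k : (-1) ^+ s * g (M + k)%N <= (-1) ^+ s * g M.
    rewrite -subr_le0 -mulrBr -tele; apply: sumr_le0 => i _; apply: H; lia.
  pose k := (K + `|((-1) ^+ s * g M)%R|)%N.
  have := H2 k; have := HK (M + k)%N; have := r_ge (M + k - K); rewrite /k; lia.
case: (evop_sign eh) => [[M HM]|[s' [M HM]]].
  by case: (unb M) => n /HM->.
case: s' HM => HM.
  case: (unb M) => n /HM; rewrite expr1; lia.
exists M.+1 => m n Hm Hmn; have -> : n = (m + (n - m))%N by lia.
rewrite -tele; have -> : (n - m = (n - m).-1.+1)%N by lia.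
rewrite big_ord_recr /=; apply: (@lt_le_trans _ _ (h (m + (n - m).-1)%N)).
  have := HM (m + (n - m).-1)%N; rewrite expr0 mul1r.
  have -> : (m + (n - m).-1.+1 - M.+1 = m + (n - m).-1 - M)%N by lia.
  by apply; lia.
rewrite lerDr; apply: sumr_ge0 => i _.
have := HM (m + i)%N; rewrite expr0 mul1r; lia.
Qed.

Lemma norm_sg (s : bool) (x : int) : `|(-1) ^+ s * x| = `|x|.
Proof. by rewrite normrM normrX normrN1 expr1n mul1r. Qed.

(* [s] is the sign of [g] and of its increments. *)
Lemma evop_main g : evop g -> ~ evzero g -> exists (s : bool) K0, forall K, (K0 <= K)%N ->
  (forall n, (K <= n)%N -> [/\ 0 < (-1) ^+ s * g n, (r (n - K)%N)%:Z <= `|g n|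
                            & `|g n| <= (r (n + K)%N)%:Z]) /\
  (forall m n, (K <= m)%N -> (m < n)%N -> (r (n - K)%N)%:Z <= (-1) ^+ s * (g n - g m)).
Proof.
move=> eg nz; case: (evop_sign eg) => [//|[s [K1 H1]]]; exists s.
have [K2 H2] := evop_ub eg; have [K3 H3] := evop_incr eg H1.
exists (maxn K1 (maxn K2 K3)) => K HK; split.
  move=> n Hn; have a1 := H1 n ltac:(lia); have a2 := H2 n ltac:(lia).
  have : (r (n - K)%N)%:Z <= (r (n - K1)%N)%:Z by rewrite ler_r; lia.
  have : (r (n + K2)%N)%:Z <= (r (n + K)%N)%:Z by rewrite ler_r; lia.
  by rewrite -(norm_sg s) in a2 *; split; lia.
move=> m n Hm Hn; apply: le_trans (ltW (H3 m n _ Hn)); last by lia.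
by rewrite ler_r; lia.
Qed.

Definition near (K a b : nat) := (a <= b + K)%N /\ (b <= a + K)%N.

(** Beyond the doubling gap one summand is more than twice the other, so it alone decides the sign
    and, up to boundedly many steps, the size. *)
Lemma near_sum : exists G, forall a b, (mag b + G <= mag a)%N ->
  near G (mag (a + b)) (mag a) /\ (0 < a + b) = (0 < a).
Proof.
have [G HG] := doubling; exists G.+1 => a b H.
have Ha := mag_le (u := a) ltac:(lia); have Ha' := mag_lt a; have Hb := mag_lt b.
have H1 : 2 * `|b| < `|a|.
  have := HG (mag b).+1; have := ler_r ((mag b).+1 + G) (mag a); lia.
split; last by lia.
split.
  apply: mag_leP; have := HG (mag a).+1; have -> : ((mag a).+1 + G = (mag a + G).+1)%N by lia.
  have := ler_r (mag a + G).+1 (mag a + G.+1).+1; lia.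
suff : (mag a - G <= mag (a + b))%N by lia.
have := HG (mag a - G)%N; have -> : (mag a - G + G = mag a)%N by lia.
move=> H2; apply: mag_ge; lia.
Qed.

Lemma near_mul c : c != 0 -> exists G, forall a, near G (mag (c * a)) (mag a).
Proof.
move=> c0; have [G HG] := mul_bound `|c|; exists G => a; split.
  apply: mag_leP; have := HG (mag a).+1; rewrite addSn normrM abszE => H.
  by apply: lt_le_trans H; rewrite ltr_pM2l ?normr_gt0 //; exact: mag_lt.
have : (mag a <= mag (c * a))%N; last by lia.
apply: mag_mono; rewrite normrM; apply: ler_peMl => //; lia.
Qed.

Lemma near_evop g : evop g -> ~ evzero g ->
  exists K, forall n, (K <= n)%N -> near K (mag (g n)) n.
Proof.
move=> eg nz; have [s [K H]] := evop_main eg nz; have [{}H _] := H K (leqnn _).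
exists K.+1 => n Hn; have [_ Hl Hu] := H n ltac:(lia); split.
  apply: mag_leP; apply: le_lt_trans Hu _; rewrite ltr_r; lia.
have := mag_ge Hl; lia.
Qed.

Lemma near_trans K L a b c : near K a b -> near L b c -> near (K + L) a c.
Proof. by rewrite /near; lia. Qed.

Lemma near_sym K a b : near K a b -> near K b a.
Proof. by rewrite /near; lia. Qed.

Lemma nearW K L a b : (K <= L)%N -> near K a b -> near L a b.
Proof. by rewrite /near; lia. Qed.

(** A bounded distance becomes finitely many equations. Adding [k] and then subtracting [k'] with
    truncation is the form of shift that the terms [Tm_L] provide. *)
Lemma nearP K a b : near K a b -> exists k k' : 'I_K.+1, a = (b + k - k')%N.
Proof.
move=> [H1 H2]; case: (leqP a b) => H.
  have lt : (b - a < K.+1)%N by lia.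
  by exists ord0, (Ordinal lt) => /=; lia.
have lt : (a - b < K.+1)%N by lia.
by exists (Ordinal lt), ord0 => /=; lia.
Qed.

End Arith.


(** * Quantifier elimination *)

(** Conditions are handled as predicates, without syntax: closure under pointwise equivalence takes
    the place of rewriting formulas. *)
Inductive BoolCl (X : Type) (A : (X -> Prop) -> Prop) : (X -> Prop) -> Prop :=
| BC_base p : A p -> BoolCl A p
| BC_const (Q : Prop) : BoolCl A (fun=> Q)
| BC_not p : BoolCl A p -> BoolCl A (fun x => ~ p x)
| BC_and p q : BoolCl A p -> BoolCl A q -> BoolCl A (fun x => p x /\ q x)
| BC_iff p q : BoolCl A p -> (forall x, p x <-> q x) -> BoolCl A q.

Section BoolClosure.
Variables (X : Type) (A : (X -> Prop) -> Prop).

Lemma BC_or p q : BoolCl A p -> BoolCl A q -> BoolCl A (fun x => p x \/ q x).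
Proof.
move=> dp dq; apply: (BC_iff (BC_not (BC_and (BC_not dp) (BC_not dq)))) => x.
by split=> H; [apply: NNPP | ]; tauto.
Qed.

Lemma BC_fin (I : finType) (p : I -> X -> Prop) :
  (forall i, BoolCl A (p i)) -> BoolCl A (fun x => exists i, p i x).
Proof.
move=> dP; suff H (s : seq I) : BoolCl A (fun x => exists2 i, i \in s & p i x).
  apply: (BC_iff (H (enum I))) => x; split=> [[i _ Hi]|[i Hi]]; exists i => //.
  by rewrite mem_enum.
elim: s => [|i s IH]; first by apply: (BC_iff (BC_const _ False)) => x; split=> // -[].
apply: (BC_iff (BC_or (dP i) IH)) => x; split.
  by move=> [Hi|[j Hj Pj]]; [exists i; rewrite ?mem_head|exists j; rewrite // inE Hj orbT].
by move=> [j]; rewrite inE => /orP [/eqP->|Hj] Pj; [left|right; exists j].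
Qed.

Lemma BC_map (Y : Type) (A' : (Y -> Prop) -> Prop) (f : Y -> X) p :
  (forall p, A p -> BoolCl A' (fun y => p (f y))) ->
  BoolCl A p -> BoolCl A' (fun y => p (f y)).
Proof.
move=> H; elim=> {p} [p /H//|Q|p _ IH|p q _ IHp _ IHq|p q _ IH E].
- exact: BC_const.
- exact: BC_not.
- exact: BC_and.
- by apply: BC_iff IH _ => y.
Qed.

End BoolClosure.

Section QE.
Variable r : nat -> nat.
Hypothesis r_inc : forall m, (r m < r m.+1)%N.
Hypothesis r_sparse : sparse r.
Hypothesis r_cong : congruence_periodic r.

Local Notation idx := (idx r).
Local Notation mag := (mag r).
Local Notation evop := (evop r).

Lemma evop_mod_period m N0 d g :
  (forall k, (N0 <= k)%N -> (r (k + d) = r k %[mod m])%N) -> evop g ->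
  exists K, forall n n', (K <= n)%N -> (K <= n')%N -> (n = n' %[mod d])%N -> (m %| g n - g n')%Z.
Proof.
move=> H [D [A HA]]; exists (D + N0)%N => n n' Hn Hn' E.
wlog le : n n' Hn Hn' E / (n <= n')%N.
  move=> W; case: (leqP n n') => [|/ltnW] le; first exact: W.
  by rewrite -rpredN opprB; apply: W.
have [q Hq] : exists q, n' = (n + q * d)%N.
  have /dvdnP [q Eq] : (d %| n' - n)%N by rewrite -eqn_mod_dvd //; apply/eqP.
  by exists q; lia.
have Hr k : (N0 <= k)%N -> (r (k + q * d) = r k %[mod m])%N.
  move=> Hk; elim: q {Hq} => [|q IH]; first by rewrite mul0n addn0.
  by rewrite mulSn addnCA addnC H // (leq_trans Hk) ?leq_addr.
rewrite -(subnK (n := n) (m := D)); last by lia.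
rewrite -(subnK (n := n') (m := D)); last by lia.
rewrite !HA /opv -sumrB; apply: rpred_sum => i _.
rewrite -mulrBr dvdz_mull //.
have -> : (n' - D + i = n - D + i + q * d)%N by lia.
by rewrite -eqz_mod_dvd !modz_nat Hr //; lia.
Qed.

Lemma evop_mod m g : (0 < m)%N -> evop g -> exists K d, (0 < d)%N /\
  forall n n', (K <= n)%N -> (K <= n')%N -> (n = n' %[mod d])%N -> (m %| g n - g n')%Z.
Proof.
move=> m0 dg; have [N0 [d [d0 H]]] := r_cong m0.
by have [K HK] := evop_mod_period H dg; exists K, d.
Qed.

Inductive Tm : (env -> int) -> Prop :=
| Tm_var i : Tm (fun e => e i)
| Tm_cst c : Tm (fun=> c)
| Tm_add t u : Tm t -> Tm u -> Tm (fun e => t e + u e)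
| Tm_opp t : Tm t -> Tm (fun e => - t e)
| Tm_L i j t : Tm t -> Tm (fun e => (r (idx (t e) + i - j)%N)%:Z).

Lemma Tm_ext t t' : Tm t -> (forall e, t e = t' e) -> Tm t'.
Proof. by move=> dt /functional_extensionality <-. Qed.

Lemma Tm_scale c t : Tm t -> Tm (fun e => c * t e).
Proof.
move=> dt; have H n : Tm (fun e => n%:Z * t e).
  elim: n => [|n IH]; first by apply: Tm_ext (Tm_cst 0) _ => e; rewrite mul0r.
  by apply: Tm_ext (Tm_add IH dt) _ => e; rewrite -addn1 PoszD mulrDl mul1r.
case: c => n; first exact: H.
by apply: Tm_ext (Tm_opp (H n.+1)) _ => e; rewrite NegzE mulNr.
Qed.

Lemma Tm_sum n (a : 'I_n -> int) (t : 'I_n -> env -> int) :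
  (forall i, Tm (t i)) -> Tm (fun e => \sum_(i < n) a i * t i e).
Proof.
elim: n a t => [|n IH] a t H; first by apply: Tm_ext (Tm_cst 0) _ => e; rewrite big_ord0.
apply: Tm_ext (Tm_add (IH (fun i => a (widen_ord (leqnSn n) i)) _
  (fun i => H (widen_ord (leqnSn n) i))) (Tm_scale (a ord_max) (H ord_max))) _ => e.
by rewrite big_ord_recr.
Qed.

Lemma Tm_subst t (F : nat -> env -> int) :
  Tm t -> (forall i, Tm (F i)) -> Tm (fun e => t (fun i => F i e)).
Proof.
move=> dt dF; elim: dt => {t} [i|c|t u _ IHt _ IHu|t _ IH|i j t _ IH].
- exact: dF.
- exact: Tm_cst.
- exact: (Tm_add IHt IHu).
- exact: (Tm_opp IH).
- exact: (Tm_L i j IH).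
Qed.

(** An [evop] is an operator only from some index [D] on, whence the side condition. The shifted
    index is first turned into an element of R and read off again, so that the further shift by
    [i - D] is applied after the truncation in [k - k']. *)
Lemma Tm_idx_evop g : evop g -> exists D, forall k k' t, Tm t -> exists t', Tm t' /\
  forall e, (D <= idx (t e) + k - k')%N -> t' e = g (idx (t e) + k - k')%N.
Proof.
move=> [D [A HA]]; exists D => k k' t dt.
exists (fun e => \sum_(i < size A) A`_i * (r (idx (r (idx (t e) + k - k')%N)%:Z + i - D)%N)%:Z).
split; first by apply: Tm_sum => i; apply: Tm_L; apply: Tm_L.
move=> e He; rewrite -(subnK He) HA /opv; apply: eq_bigr => i _.
by rewrite idx_r //; congr (_ * (r _)%:Z); lia.
Qed.

Lemma evop_comp g k k' : evop g -> evop (fun n => g (n + k - k')%N).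
Proof. by move=> H; exact: (evop_shift k (evop_shiftN k' H)). Qed.

Lemma evopr : evop (fun n => (r n)%:Z).
Proof. by apply: (evop_eq (K := 0)) (evop_r r 0 0) => n _; rewrite addn0 subn0. Qed.

Lemma evopr1 : evop (fun n => (r n.+1)%:Z).
Proof. by apply: (evop_eq (K := 0)) (evop_r r 1 0) => n _; rewrite addn1 subn0. Qed.

Inductive atomQ : (env -> Prop) -> Prop :=
| aQ_pos t : Tm t -> atomQ (fun e => 0 < t e)
| aQ_dvd m t : (0 < m)%N -> Tm t -> atomQ (fun e => (m %| t e)%Z).

Definition QF := BoolCl atomQ.

Lemma QF_subst p (F : nat -> env -> int) :
  QF p -> (forall i, Tm (F i)) -> QF (fun e => p (fun i => F i e)).
Proof.
move=> dp dF; apply: (BC_map (f := fun e i => F i e)) dp => {}p [t dt|m t m0 dt].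
  by apply: BC_base; apply: (aQ_pos (t := fun e => t (fun i => F i e))); apply: Tm_subst.
by apply: BC_base; apply: (aQ_dvd (t := fun e => t (fun i => F i e))) => //; apply: Tm_subst.
Qed.

Inductive atomR : (nat * env -> Prop) -> Prop :=
| aR_pos g t : evop g -> Tm t -> atomR (fun x => 0 < g x.1 + t x.2)
| aR_dvd m g t : (0 < m)%N -> evop g -> Tm t -> atomR (fun x => (m %| (g x.1 + t x.2)%R)%Z).

Definition RCond := BoolCl atomR.

(** The first component is the index of a bound variable in R. Up to a case distinction, every term
    separates into an operator in that index and a term in the parameters. *)
Inductive Piecewise : (nat * env -> int) -> Prop :=
| piecewise_base g t : evop g -> Tm t -> Piecewise (fun x => g x.1 + t x.2)
| piecewise_case p F1 F2 F : RCond p -> Piecewise F1 -> Piecewise F2 ->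
    (forall x, p x -> F x = F1 x) -> (forall x, ~ p x -> F x = F2 x) -> Piecewise F.

Lemma piecewise_ext F F' : Piecewise F -> (forall x, F x = F' x) -> Piecewise F'.
Proof. by move=> dF /functional_extensionality <-. Qed.

Lemma piecewise_tm t : Tm t -> Piecewise (fun x => t x.2).
Proof. by move=> dt; apply: piecewise_ext (piecewise_base (evop0 r) dt) _ => x; rewrite add0r. Qed.

Lemma piecewise_ev g : evop g -> Piecewise (fun x => g x.1).
Proof. by move=> dg; apply: piecewise_ext (piecewise_base dg (Tm_cst 0)) _ => x; rewrite addr0. Qed.

Lemma piecewise_opp F : Piecewise F -> Piecewise (fun x => - F x).
Proof.
elim=> {F} [g t dg dt|p F1 F2 F dp _ IH1 _ IH2 E1 E2].
  by apply: piecewise_ext (piecewise_base (evopN dg) (Tm_opp dt)) _ => x; rewrite opprD.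
by apply: piecewise_case dp IH1 IH2 _ _ => x px; [rewrite E1 | rewrite E2].
Qed.

Lemma piecewise_add F F' : Piecewise F -> Piecewise F' -> Piecewise (fun x => F x + F' x).
Proof.
move=> dF dF'; elim: dF => {F} [g t dg dt|p F1 F2 F dp _ IH1 _ IH2 E1 E2].
  elim: dF' => {F'} [g' t' dg' dt'|p F1 F2 F dp _ IH1 _ IH2 E1 E2].
    apply: piecewise_ext (piecewise_base (evopD dg dg') (Tm_add dt dt')) _ => x; by rewrite addrACA.
  by apply: piecewise_case dp IH1 IH2 _ _ => x px; [rewrite E1 | rewrite E2].
by apply: piecewise_case dp IH1 IH2 _ _ => x px; [rewrite E1 | rewrite E2].
Qed.

Lemma piecewise_pos F : Piecewise F -> RCond (fun x => 0 < F x).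
Proof.
elim=> {F} [g t dg dt|p F1 F2 F dp _ IH1 _ IH2 E1 E2]; first by apply: BC_base; constructor.
apply: (BC_iff (BC_or (BC_and dp IH1) (BC_and (BC_not dp) IH2))) => x.
by case: (classic (p x)) => px; [rewrite E1 | rewrite E2] => //; tauto.
Qed.

Lemma piecewise_dvd m F : (0 < m)%N -> Piecewise F -> RCond (fun x => (m %| F x)%Z).
Proof.
move=> m0; elim=> {F} [g t dg dt|p F1 F2 F dp _ IH1 _ IH2 E1 E2].
  by apply: BC_base; constructor.
apply: (BC_iff (BC_or (BC_and dp IH1) (BC_and (BC_not dp) IH2))) => x.
by case: (classic (p x)) => px; [rewrite E1 | rewrite E2] => //; tauto.
Qed.

Lemma RCond_lt F F' : Piecewise F -> Piecewise F' -> RCond (fun x => F x < F' x).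
Proof.
move=> dF dF'; apply: (BC_iff (piecewise_pos (piecewise_add dF' (piecewise_opp dF)))) => x.
by rewrite subr_gt0.
Qed.

Lemma RCond_le F F' : Piecewise F -> Piecewise F' -> RCond (fun x => F x <= F' x).
Proof.
move=> dF dF'; apply: (BC_iff (BC_not (RCond_lt dF' dF))) => x.
by rewrite leNgt; split=> /negP.
Qed.

Lemma RCond_eq F F' : Piecewise F -> Piecewise F' -> RCond (fun x => F x = F' x).
Proof.
move=> dF dF'; apply: (BC_iff (BC_and (RCond_le dF dF') (RCond_le dF' dF))) => x.
by split=> [[a b]|->]; [apply/eqP; rewrite eq_le a b|].
Qed.

Lemma RCond_idx F (q : nat * env -> nat) : Piecewise F -> Piecewise (fun x => (r (q x))%:Z) ->
  Piecewise (fun x => (r (q x).+1)%:Z) -> RCond (fun x => idx (F x) = q x).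
Proof.
move=> dF dq dq1; have d0 : Piecewise (fun=> (r 0%N)%:Z) := piecewise_tm (Tm_cst _).
have := BC_and (RCond_lt dF dq1) (BC_or (RCond_le dq dF) (RCond_le dq d0)).
by move/BC_iff; apply=> x; rewrite idxP.
Qed.

Lemma piecewise_fin (I : finType) (p : I -> nat * env -> Prop) (F : I -> nat * env -> int) G :
  (forall i, RCond (p i)) -> (forall i, Piecewise (F i)) -> (forall x, exists i, p i x) ->
  (forall i x, p i x -> G x = F i x) -> Piecewise G.
Proof.
move=> dp dF cov HG; have [H [dH EH]] : exists H, Piecewise H /\
    forall x i, i \in enum I -> p i x -> H x = G x.
  elim: (enum I) => [|i s [H [dH EH]]].
    by exists (fun=> 0); split=> //; apply: piecewise_tm (Tm_cst 0).
  exists (fun x => if excluded_middle_informative (p i x) then F i x else H x); split.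
    by apply: piecewise_case (dp i) (dF i) dH _ _ => x px; case: excluded_middle_informative.
  move=> x j; rewrite inE => /orP; case: excluded_middle_informative => px.
    by rewrite (HG i).
  by case=> [/eqP->//|]; exact: EH.
by apply: piecewise_ext dH _ => x; have [i Hi] := cov x; apply: EH Hi; rewrite mem_enum.
Qed.

(** If one of [g n] and [T] dominates, the index of a positive sum is near [n] or near that of [T].
    If neither does, [n] itself is near the size of [T], which is [idx T] or [idx (- T)]. A sum that
    is not positive has index 0. *)
Lemma idx_add_evop g : evop g -> exists K0, forall K, (K0 <= K)%N -> forall n T,
  (n < K)%N \/ idx (g n + T) = 0%N \/ exists k k' : 'I_K.+1,
  [\/ n = (idx T + k - k')%N, n = (idx (- T) + k - k')%N,
      idx (g n + T) = (n + k - k')%N | idx (g n + T) = (idx T + k - k')%N].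
Proof.
move=> dg; case: (classic (evzero g)) => [[K0 HK]|nz].
  exists K0 => K le n T; case: (ltnP n K) => Hn; [by left|right; right].
  by exists ord0, ord0; apply: Or44; rewrite HK ?add0r /= ?addn0 ?subn0 //; lia.
have [K1 H1] := near_evop r_inc r_sparse dg nz; have [G HG] := near_sum r_inc r_sparse.
exists (K1 + G)%N => K le n T; case: (ltnP n K) => Hn; [by left|right].
have {}H1 := H1 n ltac:(lia).
case: (idx_mag r_inc (g n + T)) => [->|[pos ->]]; [by left|right].
case: (leqP (mag T + G) (mag (g n))) => [/HG [HN _]|Hlt].
  have [k [k' E]] := nearP (nearW le (near_sym (near_trans (near_sym H1) (near_sym HN)))).
  by exists k, k'; apply: Or43.
case: (leqP (mag (g n) + G) (mag T)) => [/HG [HN S]|Hlt'].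
  have [k [k' E]] := nearP (nearW (leq_trans (leq_addl _ _) le) HN).
  exists k, k'; apply: Or44; rewrite addrC E; congr (_ + _ - _)%N.
  by rewrite addrC in pos; rewrite /mag gtr0_norm // -S.
have HN : near K n (mag T) by move: H1; rewrite /near; lia.
have [k [k' E]] := nearP HN; exists k, k'.
by case: (mag_idx r T) => <-; [apply: Or41|apply: Or42].
Qed.

Lemma piecewise_L i j F : Piecewise F -> Piecewise (fun x => (r (idx (F x) + i - j)%N)%:Z).
Proof.
elim=> {F} [g t dg dt|p F1 F2 F dp _ IH1 _ IH2 E1 E2]; last first.
  by apply: piecewise_case dp IH1 IH2 _ _ => x px; [rewrite E1 | rewrite E2].
have [K0 HK0] := idx_add_evop dg; have dtN := Tm_opp dt.
have [D HD] := Tm_idx_evop dg; pose K := maxn K0 D.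
have {}HK0 := HK0 K (leq_maxl _ _).
pose tt k k' (b : bool) := proj1_sig (constructive_indefinite_description _
  (HD k k' (if b then t else fun e => - t e) ltac:(case: b; assumption))).
have ttP k k' b : Tm (tt k k' b) /\ forall e, (D <= idx ((if b then t else fun e => - t e) e) + k - k')%N ->
    tt k k' b e = g (idx ((if b then t else fun e => - t e) e) + k - k')%N.
  by rewrite /tt; case: constructive_indefinite_description.
pose I : finType := ('I_6 * 'I_K.+1 * 'I_K.+1)%type.
(* Cases 0, 2 and 3 determine [n], as a constant or from the parameters, so that [g n] becomes a
   term [tt]. Cases 1, 4 and 5 determine the index that is to be computed. *)
pose p (x : I) (y : nat * env) := let: (c, k, k') := x in match val c with
  | 0 => y.1 = k :> nat
  | 1 => idx (g y.1 + t y.2) = 0%N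
  | 2 => ~ (y.1 < K)%N /\ y.1 = (idx (t y.2) + k - k')%N
  | 3 => ~ (y.1 < K)%N /\ y.1 = (idx (- t y.2) + k - k')%N
  | 4 => idx (g y.1 + t y.2) = (y.1 + k - k')%N
  | _ => idx (g y.1 + t y.2) = (idx (t y.2) + k - k')%N end.
pose F (x : I) (y : nat * env) : int := let: (c, k, k') := x in match val c with
  | 0 => (r (idx (g k + t y.2) + i - j)%N)%:Z
  | 1 => (r (0 + i - j)%N)%:Z
  | 2 => (r (idx (tt k k' true y.2 + t y.2) + i - j)%N)%:Z
  | 3 => (r (idx (tt k k' false y.2 + t y.2) + i - j)%N)%:Z
  | 4 => (r (y.1 + k - k' + i - j)%N)%:Z
  | _ => (r (idx (t y.2) + k - k' + i - j)%N)%:Z end.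
have dF : Piecewise (fun x => g x.1 + t x.2) by exact: piecewise_base.
have dn : Piecewise (fun x => (r x.1)%:Z) := piecewise_ev evopr.
have dL k k' t' : Tm t' -> Piecewise (fun x => (r (idx (t' x.2) + k - k')%N)%:Z).
  by move=> dt'; exact: (piecewise_tm (Tm_L k k' dt')).
have RK : RCond (fun x => ~ (x.1 < K)%N).
  by apply: (BC_iff (BC_not (RCond_lt dn (piecewise_tm (Tm_cst (r K)%:Z))))) => x; rewrite ltr_r.
have Rn k k' t' : Tm t' -> RCond (fun x => x.1 = (idx (t' x.2) + k - k')%N).
  move=> dt'; apply: (BC_iff (RCond_eq dn (dL k k' t' dt'))) => x.
  by split=> [[/(r_inj r_inc)]|->].
apply: (@piecewise_fin I p F).
- move=> [[[[|[|[|[|[|[|c]]]]]] Hc] k] k'] //=.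
  + apply: (BC_iff (RCond_eq dn (piecewise_tm (Tm_cst (r k)%:Z)))) => x.
    by split=> [[/(r_inj r_inc)]|->].
  + by apply: RCond_idx => //; exact: (piecewise_tm (Tm_cst _)).
  + by apply: BC_and => //; exact: Rn.
  + by apply: BC_and => //; exact: (Rn _ _ _ dtN).
  + apply: RCond_idx => //; first exact: (piecewise_ev (evop_comp k k' evopr)).
    exact: (piecewise_ev (evop_comp k k' evopr1)).
  + apply: RCond_idx => //; first exact: dL.
    apply: piecewise_ext (piecewise_tm (Tm_L 1 0 (Tm_L k k' dt))) _ => x.
    by rewrite idx_r // addn1 subn0.
- move=> [[[[|[|[|[|[|[|c]]]]]] Hc] k] k'] //=.
  + exact: (piecewise_tm (Tm_L i j (Tm_add (Tm_cst (g k)) dt))).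
  + exact: (piecewise_tm (Tm_cst _)).
  + exact: (piecewise_tm (Tm_L i j (Tm_add (ttP k k' true).1 dt))).
  + exact: (piecewise_tm (Tm_L i j (Tm_add (ttP k k' false).1 dt))).
  + exact: piecewise_ev (evop_comp k k' (evop_comp i j evopr)).
  + apply: piecewise_ext (piecewise_tm (Tm_L i j (Tm_L k k' dt))) _ => x.
    by rewrite idx_r.
- move=> [n e]; case: (ltnP n K) => Hn.
    by exists (inord 0, inord n, ord0); rewrite /p [val _]inordK //= inordK // ltnW.
  case: (HK0 n (t e)) => [|[H|[k [k' H]]]]; first by rewrite ltnNge Hn.
    by exists (inord 1, ord0, ord0); rewrite /p [val _]inordK.
  have Hn' : ~ (n < K)%N by apply/negP; rewrite -leqNgt.
  case: H => H; [exists (inord 2, k, k')|exists (inord 3, k, k')|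
                 exists (inord 4, k, k')|exists (inord 5, k, k')]; by rewrite /p [val _]inordK.
- have KD : (D <= K)%N by rewrite leq_maxr.
  move=> [[[[|[|[|[|[|[|c]]]]]] Hc] k] k'] [n e] //=.
  + by move=> ->.
  + by move=> ->.
  + move=> [Hn E]; have [_ ->] := ttP k k' true; last by lia.
    by rewrite -E.
  + move=> [Hn E]; have [_ ->] := ttP k k' false; last by lia.
    by rewrite -E.
  + by move=> ->.
  + by move=> ->.
Qed.

Lemma piecewise_Tm t : Tm t -> Piecewise (fun x => t (scons (r x.1)%:Z x.2)).
Proof.
elim=> {t} [[|i]|c|t u _ IHt _ IHu|t _ IH|i j t _ IH].
- exact: (piecewise_ev evopr).
- exact: (piecewise_tm (Tm_var i)).
- exact: (piecewise_tm (Tm_cst c)).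
- exact: piecewise_add IHt IHu.
- exact: piecewise_opp IH.
- exact: (piecewise_L i j IH).
Qed.

Lemma RCond_QF p : QF p -> RCond (fun x => p (scons (r x.1)%:Z x.2)).
Proof.
apply: (BC_map (f := fun x : nat * env => scons (r x.1)%:Z x.2)) => {}p [t dt|m t m0 dt].
  exact: (piecewise_pos (piecewise_Tm dt)).
exact: (piecewise_dvd m0 (piecewise_Tm dt)).
Qed.

(* Possible thresholds for an index variable: all of [r (th e)], [r (th e + 1)], ... are terms. *)
Definition good (th : env -> nat) :=
  exists t i j, Tm t /\ forall e, th e = (idx (t e) + i - j)%N.

Lemma good_const k : good (fun=> k).
Proof.
by exists (fun=> (r k)%:Z), 0%N, 0%N; split=> [|e]; [exact: Tm_cst|rewrite idx_r // addn0 subn0].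
Qed.

(** The truth value at [n] depends only on [n] modulo [d] and on which thresholds lie at or below
    [n]. *)
Definition cutdet (p : nat * env -> Prop) : Prop :=
  exists (d : nat) (I : finType) (th : I -> env -> nat), [/\ (0 < d)%N, forall i, good (th i) &
    forall e n n', (n = n' %[mod d])%N -> (forall i, (th i e <= n)%N = (th i e <= n')%N) ->
      p (n, e) <-> p (n', e)].

Lemma cut_eq (th : nat) n n' : n = th -> (th <= n)%N = (th <= n')%N ->
  (th.+1 <= n)%N = (th.+1 <= n')%N -> n' = n.
Proof. lia. Qed.

(** Away from the size of [t e], the sign of [g n + t e] is that of [g] above it and that of [t e]
    below it. Near that size, and for small [n], consecutive thresholds pin down [n] by [cut_eq].
    The size is [idx (t e)] or [idx (- t e)], so both supply thresholds. For congruences,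
    periodicity gives [d]. *)
Lemma RCond_cutdet p : RCond p -> cutdet p.
Proof.
elim=> {p} [p [g t dg dt|m g t m0 dg dt]|Q|p _ IH|p q _ IHp _ IHq|p q _ IH E].
- case: (classic (evzero g)) => [[K HK]|nz].
    exists 1%N, 'I_K.+1, (fun (k : 'I_K.+1) _ => k : nat); split=> // [i|e n n' _ H]; first exact: good_const.
    have H' i : (i <= K)%N -> (i <= n)%N = (i <= n')%N.
      by move=> Hi; have := H (Ordinal (m := i) (n := K.+1) Hi).
    case: (ltnP n K) => Hn; last by rewrite /= !HK // -H'.
    suff -> : n' = n by [].
    by apply: (@cut_eq n) => //; apply: H' => //; exact: ltnW.
  have [K1 H1] := near_evop r_inc r_sparse dg nz; have [G HG] := near_sum r_inc r_sparse.
  have [s [K0 Hs]] := evop_main r_inc r_sparse dg nz.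
  pose K := (maxn K0 K1 + G)%N; have [{}Hs _] := Hs K ltac:(lia).
  (* Offsets run beyond [K], so that with each threshold in use its successor is available too. *)
  pose I : finType := ('I_3 * 'I_K.+3 * 'I_K.+3)%type.
  pose th (x : I) e := let: (c, k, k') := x in match val c with
    | 0 => k : nat | 1 => (idx (t e) + k - k')%N | _ => (idx (- t e) + k - k')%N end.
  exists 1%N, I, th; split=> //.
    move=> [[[[|[|[|c]]] Hc] k] k'] //=; first exact: good_const.
      by exists t, (k : nat), (k' : nat).
    by exists (fun e => - t e), (k : nat), (k' : nat); split=> //; exact: Tm_opp.
  move=> e n n' _ H; have Hc i : (i < K.+3)%N -> (i <= n)%N = (i <= n')%N.
    by move=> Hi; have := H (inord 0, inord i, ord0); rewrite /th [val _]inordK // ?inordK.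
  have Hm k k' : (k < K.+3)%N -> (k' < K.+3)%N ->
      (mag (t e) + k - k' <= n)%N = (mag (t e) + k - k' <= n')%N.
    move=> lt lt'; case: (mag_idx r (t e)) => ->.
      by have := H (inord 1, inord k, inord k'); rewrite /th [val _]inordK // ?inordK.
    by have := H (inord 2, inord k, inord k'); rewrite /th [val _]inordK // ?inordK.
  case: (ltnP n K) => Hn.
    suff -> : n' = n by [].
    by apply: (@cut_eq n) => //; apply: Hc; lia.
  have Hn' : (K <= n')%N by rewrite -Hc //; lia.
  case: (classic (near K n (mag (t e)))) => HN.
    suff -> : n' = n by [].
    have [k [k' E]] := nearP HN; have lk := ltn_ord k; have lk' := ltn_ord k'.
    case: (posnP n) => [n0|npos].
      by apply: (@cut_eq n) => //; apply: Hc; lia.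
    apply: (@cut_eq (mag (t e) + k - k')%N) => //; first by apply: Hm; lia.
    have -> : (mag (t e) + k - k').+1 = (mag (t e) + k.+1 - k')%N by lia.
    by apply: Hm; lia.
  have dich m : (K <= m)%N -> ~ near K m (mag (t e)) ->
      (0 < g m + t e) = if (mag (t e) < m)%N then ~~ s else 0 < t e.
    move=> Hm1 Hm2; have HN1 := H1 m ltac:(lia); case: ltnP => Hlt.
      have [_ ->] := HG (g m) (t e) ltac:(move: HN1 Hm2; rewrite /near; lia).
      have [] := Hs m ltac:(lia); case: (s) => /=; rewrite ?expr0 ?expr1; lia.
    have le : (mag (g m) + G <= mag (t e))%N by move: HN1 Hm2; rewrite /near; lia.
    by rewrite addrC; have [_ ->] := HG _ _ le.
  have A1 := Hm K.+1 0%N ltac:(lia) ltac:(lia).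
  have A2 := Hm 0%N K ltac:(lia) ltac:(lia).
  have HN' : ~ near K n' (mag (t e)).
    by move=> HN'; apply: HN; move: HN' A1 A2; rewrite /near; lia.
  rewrite /= !dich //.
  by have -> : (mag (t e) < n')%N = (mag (t e) < n)%N by move: HN HN' A1 A2; rewrite /near; lia.
- have [K [d [d0 H]]] := evop_mod m0 dg.
  exists d, 'I_K.+1, (fun (k : 'I_K.+1) _ => k : nat); split=> // [i|e n n' E Hi]; first exact: good_const.
  have H' i : (i <= K)%N -> (i <= n)%N = (i <= n')%N.
    by move=> Hi'; have := Hi (Ordinal (m := i) (n := K.+1) Hi').
  case: (ltnP n K) => Hn.
    suff -> : n' = n by [].
    by apply: (@cut_eq n) => //; apply: H' => //; exact: ltnW.
  have := H n n' Hn ltac:(by rewrite -H') E.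
  move=> /= Em; have -> : g n + t e = g n' + t e + (g n - g n') by ring.
  by rewrite rpredDr.
- by exists 1%N, void, (fun i _ => 0%N); split=> // -[].
- have [d [I [th [d0 Hth H]]]] := IH; exists d, I, th; split=> // e n n' Ed /(H _ _ _ Ed) ->; tauto.
- have [d [I [th [d0 Hth H]]]] := IHp; have [d' [I' [th' [d0' Hth' H']]]] := IHq.
  exists (d * d')%N, (I + I')%type, (fun i => match i with inl i => th i | inr i => th' i end).
  split; [by rewrite muln_gt0 d0|by case|move=> e n n' Ed Hi].
  have Ed1 : (n = n' %[mod d])%N by rewrite -(modn_dvdm n (dvdn_mulr d' (dvdnn d))) Ed modn_dvdm // dvdn_mulr.
  have Ed2 : (n = n' %[mod d'])%N by rewrite -(modn_dvdm n (dvdn_mull d (dvdnn d'))) Ed modn_dvdm // dvdn_mull.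
  rewrite (H e n n' Ed1 (fun i => Hi (inl i))) (H' e n n' Ed2 (fun i => Hi (inr i))); tauto.
- have [d [I [th [d0 Hth H]]]] := IH; exists d, I, th; split=> // e n n' Ed Hi.
  by rewrite -!E; apply: H.
Qed.

(** A witness [n] can be lowered to [m + (n - m) %% d], where [m] is the largest threshold at or
    below [n]; neither the class nor any threshold comparison changes. The extra threshold 0 makes
    [m] exist. *)
Lemma QF_exR p : QF p -> QF (fun e => exists n, p (scons (r n)%:Z e)).
Proof.
move=> dp; have [d [I [th [d0 Hth H]]]] := RCond_cutdet (RCond_QF dp).
pose th' (i : option I) e := if i is Some i then th i e else 0%N.
have Hth' i : good (th' i) by case: i => [i|]; [exact: Hth|exact: (good_const 0)].
have dQ (x : option I * 'I_d) : QF (fun e => p (scons (r (th' x.1 e + x.2)%N)%:Z e)).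
  have [t [i [j [dt E]]]] := Hth' x.1.
  pose F n : env -> int := if n is m.+1 then fun e => e m
    else fun e => (r (idx (r (idx (t e) + i - j)%N)%:Z + x.2 - 0)%N)%:Z.
  have dF n : Tm (F n) by case: n => [|n]; [do 2!apply: Tm_L|exact: Tm_var].
  apply: (BC_iff (QF_subst dp dF)) => e.
  suff -> : (fun i => F i e) = scons (r (th' x.1 e + x.2)%N)%:Z e by [].
  by apply: functional_extensionality => -[|n] //=; rewrite idx_r // subn0 E.
apply: (BC_iff (BC_fin dQ)) => e; split=> [[x Hx]|[n Hn]]; first by eexists; exact: Hx.
pose m := \max_(i | (th' i e <= n)%N) th' i e.
have [i0 [Hi0 Em]] : exists i0, (th' i0 e <= n)%N /\ m = th' i0 e.
  rewrite /m; have Pn : (th' None e <= n)%N by [].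
  by have [i Hi ->] := eq_bigmax_cond (A := [pred i | (th' i e <= n)%N]) (fun i => th' i e)
    ltac:(by apply/card_gt0P; exists None); exists i.
have lt : ((n - m) %% d < d)%N by rewrite ltn_mod.
exists (i0, Ordinal lt) => /=; rewrite -Em.
refine (proj1 (H e n (m + (n - m) %% d)%N _ _) Hn).
- by rewrite modnDmr subnKC // Em.
- move=> i; apply/idP/idP => Hi.
    by apply: leq_trans (leq_addr _ _); apply: (leq_bigmax_cond (Some i) (F := fun i => th' i e)).
  apply: leq_trans Hi _; have := leq_mod (n - m) d; have : (m <= n)%N by rewrite Em.
  lia.
Qed.

End QE.


(** * Elimination of integer variables and definability of the terms *)

Section QE2.
Variable r : nat -> nat.
Hypothesis r_inc : forall m, (r m < r m.+1)%N.
Hypothesis r_sparse : sparse r.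
Hypothesis r_cong : congruence_periodic r.

Local Notation idx := (idx r).
Local Notation Tm := (Tm r).
Local Notation QF := (QF r).

Inductive atomL : (int * env -> Prop) -> Prop :=
| aL_pos c t : Tm t -> atomL (fun x => 0 < c * x.1 + t x.2)
| aL_dvd m c t : (0 < m)%N -> Tm t -> atomL (fun x => (m %| (c * x.1 + t x.2)%R)%Z).

Definition LinCond := BoolCl atomL.

(* Scaling [w] by a common multiple [C] of its coefficients avoids division. *)
Definition cutdetZ (p : int * env -> Prop) : Prop :=
  exists (C d : nat) (I : finType) (th : I -> env -> int),
    [/\ (0 < C)%N, (0 < d)%N, forall i, Tm (th i) &
    forall e w w', (d %| w - w')%Z -> (forall i, (th i e < C%:Z * w) = (th i e < C%:Z * w')) ->
      p (w, e) <-> p (w', e)].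

Lemma LinCond_cutdet p : LinCond p -> cutdetZ p.
Proof.
elim=> {p} [p [c t dt|m c t m0 dt]|Q|p _ IH|p q _ IHp _ IHq|p q _ IH E].
- case: (ltrgt0P c) => [c0|c0|->].
  + exists `|c|%N, 1%N, unit, (fun _ e => - t e); split=> //; [lia|by move=> _; exact: Tm_opp|].
    move=> e w w' _ /(_ tt) /=; rewrite gez0_abs ?ltW //.
    have E (z : int) : (0 < c * z + t e) = (- t e < c * z) by lia.
    rewrite !E => H; by rewrite H.
  (* For negative [c] the atom says [|c| w < t], which over the integers is the negation of
     [t - 1 < |c| w]. *)
  + exists `|c|%N, 1%N, unit, (fun _ e => t e - 1); split=> //; first lia.
      by move=> _; apply: Tm_add dt _; exact: Tm_cst.
    move=> e w w' _ /(_ tt) /=; rewrite ltz0_abs // !mulNr; lia.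
  + exists 1%N, 1%N, void, (fun _ _ => 0); split=> // e w w' _ _ /=.
    by rewrite !mul0r.
- exists 1%N, m, void, (fun _ _ => 0); split=> // e w w' H _ /=.
  have -> : c * w + t e = c * w' + t e + c * (w - w') by ring.
  by rewrite rpredDr // dvdz_mull.
- by exists 1%N, 1%N, void, (fun _ _ => 0).
- have [C [d [I [th [C0 d0 dth H]]]]] := IH.
  exists C, d, I, th; split=> // e w w' Hd Hi; have := H e w w' Hd Hi; tauto.
- have [C [d [I [th [C0 d0 dth H]]]]] := IHp; have [C' [d' [I' [th' [C0' d0' dth' H']]]]] := IHq.
  exists (C * C')%N, (d * d')%N, (I + I')%type,
    (fun i => match i with inl i => fun e => C'%:Z * th i e | inr i => fun e => C%:Z * th' i e end).
  split; [by rewrite muln_gt0 C0|by rewrite muln_gt0 d0|by case=> i; exact: Tm_scale|].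
  move=> e w w' Hd Hi.
  have d1 : (d %| w - w')%Z by apply: dvdz_trans Hd; rewrite PoszM dvdz_mulr.
  have d2 : (d' %| w - w')%Z by apply: dvdz_trans Hd; rewrite PoszM dvdz_mull.
  have h1 i : (th i e < C%:Z * w) = (th i e < C%:Z * w').
    have := Hi (inl i); rewrite PoszM [C%:Z * _]mulrC -!mulrA !ltr_pM2l //; lia.
  have h2 i : (th' i e < C'%:Z * w) = (th' i e < C'%:Z * w').
    by have := Hi (inr i); rewrite PoszM -!mulrA !ltr_pM2l //; lia.
  by have := H e w w' d1 h1; have := H' e w w' d2 h2; tauto.
- have [C [d [I [th [C0 d0 dth H]]]]] := IH; exists C, d, I, th; split=> // e w w' Hd Hi.
  by rewrite -!E; exact: H.
Qed.

Lemma LinCond_subst p C t : (0 < C)%N -> Tm t -> LinCond p ->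
  exists2 q, QF q & forall e w, C%:Z * w = t e -> p (w, e) <-> q e.
Proof.
move=> C0 dt; have C0' : C%:Z != 0 by lia.
elim=> {p} [p [c u du|m c u m0 du]|Q|p _ [q dq H]|p p' _ [q dq H] _ [q' dq' H']|p p' _ [q dq H] E].
- exists (fun e => 0 < c * t e + C%:Z * u e).
    by apply: BC_base; apply: (aQ_pos (t := fun e => c * t e + C%:Z * u e)); apply: Tm_add; exact: Tm_scale.
  move=> e w <- /=; have -> : c * (C%:Z * w) + C%:Z * u e = C%:Z * (c * w + u e) by ring.
  by rewrite pmulr_rgt0.
- exists (fun e => ((C * m)%N %| (c * t e + C%:Z * u e)%R)%Z).
    apply: BC_base; apply: (aQ_dvd (t := fun e => c * t e + C%:Z * u e)); first by rewrite muln_gt0 C0.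
    by apply: Tm_add; exact: Tm_scale.
  move=> e w <- /=; have -> : c * (C%:Z * w) + C%:Z * u e = C%:Z * (c * w + u e) by ring.
  by rewrite PoszM dvdz_mul2l.
- by exists (fun=> Q) => //; exact: BC_const.
- by exists (fun e => ~ q e) => [|e w /H ->]; first exact: BC_not.
- by exists (fun e => q e /\ q' e) => [|e w Ew]; [exact: BC_and|rewrite H // H'].
- by exists q => // e w /H <-; rewrite E.
Qed.

(** As in Cooper's procedure, a witness can be moved by multiples of [d] until [C w] is within [C d]
    of a threshold. These finitely many positions are tested, and divisibility by [C] says that such
    a [w] exists. *)
Lemma QF_exW p : LinCond p -> QF (fun e => exists w, p (w, e)).
Proof.
move=> dp; have [C [d [I [th [C0 d0 dth H]]]]] := LinCond_cutdet dp.
pose th' (i : option I) e := if i is Some i then th i e else 0.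
have dth' i : Tm (th' i) by case: i => [i|]; [exact: dth|exact: Tm_cst].
pose N := (C * d).+1; have CZ : 0 < C%:Z by lia.
pose tt (x : option I * 'I_N * 'I_N) e := th' x.1.1 e + (x.1.2%:Z - x.2%:Z).
have dtt x : Tm (tt x) by apply: Tm_add (dth' _) _; exact: Tm_cst.
have dQ x : QF (fun e => exists2 w, C%:Z * w = tt x e & p (w, e)).
  have [q dq Hq] := LinCond_subst C0 (dtt x) dp.
  have dd : QF (fun e => (C %| tt x e)%Z) by apply: BC_base; exact: aQ_dvd.
  apply: (BC_iff (BC_and dd dq)) => e; split.
    move=> [/dvdzP [w Ew] qe]; exists w; first by rewrite Ew mulrC.
    by apply/(Hq e w) => //; rewrite Ew mulrC.
  move=> [w Ew pw]; split; last by rewrite -Hq; eauto.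
  by rewrite -Ew dvdz_mulr.
apply: (BC_iff (BC_fin dQ)) => e; split=> [[x [w _ pw]]|[w pw]]; first by exists w.
have wit i w' (z : int) : C%:Z * w' = th' i e + z -> `|z| <= (C * d)%N%:Z -> p (w', e) ->
    exists x, exists2 w, C%:Z * w = tt x e & p (w, e).
  move=> Ew le pw'; case: (lerP 0 z) => Hz.
    have lt : (`|z| < N)%N by lia.
    exists (i, Ordinal lt, ord0); exists w' => //; rewrite /tt /= Ew; lia.
  have lt : (`|z| < N)%N by lia.
  exists (i, ord0, Ordinal lt); exists w' => //; rewrite /tt /= Ew; lia.
(* If some threshold lies below [C w], then [w] is lowered until [C w] is just above the largest of
   them. *)
case: (classic (exists i, th' i e < C%:Z * w)) => [[i1 Hi1]|no].
  have [i Hi max] : exists2 i, th' i e < C%:Z * w & forall j, th' j e < C%:Z * w -> th' j e <= th' i e.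
    have [i Hi max] := @arg_maxP _ _ _ i1 (fun j => th' j e < C%:Z * w) (fun j => th' j e) Hi1.
    by exists i.
  pose q := ((C%:Z * w - th' i e - 1) %/ (C * d)%N)%Z.
  pose z := ((C%:Z * w - th' i e - 1) %% (C * d)%N)%Z.
  have Eq : C%:Z * w - th' i e - 1 = q * (C * d)%N%:Z + z := divz_eq _ _.
  have Cd0 : (C * d)%N%:Z != 0 by lia.
  have z0 : 0 <= z := modz_ge0 _ Cd0.
  have zl : z < (C * d)%N%:Z by apply: ltz_pmod; lia.
  have Ew : C%:Z * (w - q * d%:Z) = th' i e + (z + 1).
    have Em : C%:Z * (q * d%:Z) = q * (C * d)%N%:Z by rewrite PoszM; ring.
    by rewrite mulrBr Em; lia.
  apply: (wit i _ _ Ew); first lia.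
  refine (proj1 (H e w (w - q * d%:Z) _ _) pw); first by rewrite opprB addrC subrK dvdz_mull.
  move=> j; have := max (Some j); rewrite Ew /= => mj.
  have q0 : 0 <= q * (C * d)%N%:Z.
    apply: mulr_ge0 => //; rewrite divz_ge0; lia.
  by apply/idP/idP => [/mj|]; lia.
(* If there is none, [w] is raised as long as [C w] does not pass the least threshold. *)
have no' i : C%:Z * w <= th' i e by rewrite leNgt; apply/negP => Hi; apply: no; exists i.
have [i min] : exists i, forall j, th' i e <= th' j e.
  have [i _ min] := @arg_minP _ _ _ (None : option I) xpredT (fun j => th' j e) isT.
  by exists i => j; exact: min.
pose q := ((th' i e - C%:Z * w) %/ (C * d)%N)%Z.
pose z := ((th' i e - C%:Z * w) %% (C * d)%N)%Z.
have Eq : th' i e - C%:Z * w = q * (C * d)%N%:Z + z := divz_eq _ _.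
have Cd0 : (C * d)%N%:Z != 0 by lia.
have z0 : 0 <= z := modz_ge0 _ Cd0.
have zl : z < (C * d)%N%:Z by apply: ltz_pmod; lia.
have Ew : C%:Z * (w + q * d%:Z) = th' i e + (- z).
  have Em : C%:Z * (q * d%:Z) = q * (C * d)%N%:Z by rewrite PoszM; ring.
  by rewrite mulrDr Em; lia.
apply: (wit i _ _ Ew); first lia.
refine (proj1 (H e w (w + q * d%:Z) _ _) pw); first by rewrite opprD addrA subrr sub0r rpredN dvdz_mull.
move=> j; rewrite Ew; have := no' (Some j); have := min (Some j) => /=; lia.
Qed.

Definition drop_env (k : nat) (e : env) : env := fun i => e (i + k)%N.

Lemma drop_drop k l e : drop_env k (drop_env l e) = drop_env (k + l) e.
Proof. by apply: functional_extensionality => i; rewrite /drop_env addnA. Qed.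

Lemma LinCond_drop k p : LinCond p -> LinCond (fun x => p (x.1, drop_env k x.2)).
Proof.
apply: (BC_map (f := fun x : int * env => (x.1, drop_env k x.2))) => {}p.
case=> [c t dt|m c t m0 dt]; apply: BC_base; [apply: (aL_pos c (t := fun e => t (drop_env k e)))
  | apply: (aL_dvd c (t := fun e => t (drop_env k e))) => //]; by apply: (Tm_subst dt) => i; exact: Tm_var.
Qed.

(* [F] can be made linear in [w] at the cost of finitely many new variables in R;
   [s] counts the variables already added in front of the parameters [e]. *)
Definition linearizable (F : int -> env -> int) : Prop :=
  forall (P : int * env -> Prop) s D, LinCond D ->
  (forall k D' c t, LinCond D' -> Tm t ->
    (forall w e, D' (w, e) -> D (w, drop_env k e) /\ F w (drop_env (s + k) e) = c * w + t e) ->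
    QF (fun e => exists w, D' (w, e) /\ P (w, drop_env (s + k) e))) ->
  QF (fun e => exists w, D (w, e) /\ P (w, drop_env s e)).

Lemma drop0 e : drop_env 0 e = e.
Proof. by apply: functional_extensionality => i; rewrite /drop_env addn0. Qed.

Lemma QF_iff p q : QF p -> (forall e, p e <-> q e) -> QF q.
Proof. exact: BC_iff. Qed.

Lemma linearizable_lin c (F : int -> env -> int) :
  (forall s, exists2 t, Tm t & forall w e, F w (drop_env s e) = c * w + t e) ->
  linearizable F.
Proof.
move=> H P s D dD /(_ 0%N D c); have [t dt E] := H s; move/(_ t dD dt).
rewrite addn0; apply=> w e De; rewrite drop0; split=> //; exact: E.
Qed.

Lemma linearizable_Tm t : Tm t -> linearizable (fun w e => t (scons w e)).
Proof.
elim=> {t} [[|i]|c|t u _ IHt _ IHu|t _ IH|i j t _ IH].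
- apply: (linearizable_lin (c := 1)) => s; exists (fun=> 0); first exact: Tm_cst.
  by move=> w e; rewrite mul1r addr0.
- apply: (linearizable_lin (c := 0)) => s; exists (fun e => e (i + s)%N); first exact: Tm_var.
  by move=> w e; rewrite mul0r add0r.
- apply: (linearizable_lin (c := 0)) => s; exists (fun=> c); first exact: Tm_cst.
  by move=> w e; rewrite mul0r add0r.
- move=> P s D dD H; apply: (IHt P s D dD) => k D1 c1 t1 dD1 dt1 H1.
  apply: (IHu P _ D1 dD1) => k' D2 c2 t2 dD2 dt2 H2; rewrite -addnA.
  have dt1' : Tm (fun e => t1 (drop_env k' e)).
    by apply: (Tm_subst dt1) => i; exact: Tm_var.
  apply: (H _ D2 (c1 + c2) _ dD2 (Tm_add dt1' dt2)) => w e /H2 [/H1 [HD E1] E2].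
  rewrite drop_drop in HD; split=> //.
  rewrite drop_drop -addnA in E1; rewrite -addnA in E2; rewrite E1 E2; ring.
- move=> P s D dD H; apply: (IH P s D dD) => k D1 c1 t1 dD1 dt1 H1.
  apply: (H _ D1 (- c1) _ dD1 (Tm_opp dt1)) => w e /H1 [HD ->]; split=> //; ring.
move=> P s D dD H; apply: (IH P s D dD) => k D1 c1 t1 dD1 dt1 H1.
have dv : Tm (fun e => e 0%N) := Tm_var r 0.
have dq a b : Tm (fun e => (r (idx (e 0%N) + a - b)%N)%:Z) := Tm_L a b dv.
have dt1' : Tm (fun e => t1 (drop_env 1 e)).
  by apply: (Tm_subst dt1) => l; exact: Tm_var.
have pos c t2 : Tm t2 -> LinCond (fun x => 0 < c * x.1 + t2 x.2) by move=> ?; apply: BC_base; constructor.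
(* The new variable [e 0] names the value of [lambda]; by [idxP] this constraint is linear in [w],
   and it is added to the conditions [D']. *)
pose E (x : int * env) := idx (c1 * x.1 + t1 (drop_env 1 x.2)) = idx (x.2 0%N).
have dE : LinCond E.
  have a1 := pos (- c1) _ (Tm_add (Tm_opp dt1') (dq 1%N 0%N)).
  have a2 := pos c1 _ (Tm_add dt1' (Tm_add (Tm_opp (dq 0%N 0%N)) (Tm_cst r 1))).
  have a3 := pos 0 _ (Tm_add (Tm_opp (dq 0%N 0%N)) (Tm_cst r ((r 0%N)%:Z + 1))).
  apply: (BC_iff (BC_and a1 (BC_or a2 a3))) => -[w e]; rewrite /E /= idxP // !addn0 !subn0 addn1.
  split=> -[A B]; (split; first by lia); (case: B => B; [left|right]); lia.
have drop1 z e : drop_env 1 (scons z e) = e.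
  by apply: functional_extensionality => l; rewrite /drop_env addn1.
have step := H (k + 1)%N (fun x => D1 (x.1, drop_env 1 x.2) /\ E x) 0 _
  (BC_and (LinCond_drop 1 dD1) dE) (dq i j).
apply: QF_iff (QF_exR r_inc r_sparse r_cong (step _)) _.
  move=> w e [/= /H1 [HD EF] EE]; rewrite !drop_drop -?addnA in HD EF; split; first exact: HD.
  by rewrite EF mul0r add0r -EE.
have dropS m z e : drop_env (s + (m + 1)) (scons z e) = drop_env (s + m) e.
  by rewrite addnA -drop_drop drop1.
move=> e; split=> [[n [w [[HD _] HP]]]|[w [HD HP]]].
  by rewrite /= drop1 in HD; rewrite dropS in HP; exists w.
by exists (idx (c1 * w + t1 e)), w; rewrite /E /= dropS drop1 idx_r.
Qed.

(* Sequentially linearizes the atoms of [p], remembering in [D'] that [p] has become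
   equivalent to a condition linear in [w]. *)
Lemma QF_ex p : QF p -> QF (fun e => exists w, p (scons w e)).
Proof.
move=> dp; suff H : forall (P : int * env -> Prop) s D, LinCond D ->
  (forall k D' E, LinCond D' -> LinCond E ->
    (forall w e, D' (w, e) -> D (w, drop_env k e) /\ (p (scons w (drop_env (s + k) e)) <-> E (w, e))) ->
    QF (fun e => exists w, D' (w, e) /\ P (w, drop_env (s + k) e))) ->
  QF (fun e => exists w, D (w, e) /\ P (w, drop_env s e)).
  apply: (QF_iff (H (fun x => p (scons x.1 x.2)) 0%N (fun=> True) (BC_const _ True) _)).
    move=> k D' E dD' dE HE; apply: QF_iff (QF_exW (BC_and dD' dE)) _ => e.
    by split=> -[w [HD' X]]; exists w; split=> //=; move: (HE w e HD'); tauto.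
  by move=> e; rewrite drop0; split=> [[w [_]]|[w]]; exists w.
elim: dp => {p} [p [t dt|m t m0 dt]|Q|p _ IH|p q _ IHp _ IHq|p q _ IH E] P s D dD H.
- apply: (linearizable_Tm dt dD) => k D' c u dD' du HE.
  apply: (H k D' (fun x => 0 < c * x.1 + u x.2) dD'); first by apply: BC_base; constructor.
  by move=> w e /HE [? ->].
- apply: (linearizable_Tm dt dD) => k D' c u dD' du HE.
  apply: (H k D' (fun x => (m %| (c * x.1 + u x.2)%R)%Z) dD'); first by apply: BC_base; constructor.
  by move=> w e /HE [? ->].
- apply: QF_iff (H 0%N D (fun=> Q) dD (BC_const _ Q) _) _; first by move=> w e; rewrite drop0.
  by move=> e; rewrite addn0.
- apply: (IH P s D dD) => k D' E dD' dE HE; apply: (H k D' (fun x => ~ E x) dD' (BC_not dE)).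
  by move=> w e /HE [? ->].
- apply: (IHp P s D dD) => k D' E dD' dE HE; apply: (IHq P _ D' dD') => k' D2 E2 dD2 dE2 HE2.
  rewrite -addnA; apply: (H _ D2 (fun x => E (x.1, drop_env k' x.2) /\ E2 x) dD2).
    by apply: BC_and => //; exact: LinCond_drop.
  move=> w e /HE2 [/HE [HD1 X1] X2]; rewrite !drop_drop -?addnA in HD1 X1 X2; split=> //=.
  by rewrite X1 X2.
- apply: (IH P s D dD) => k D' E' dD' dE HE; apply: (H k D' E' dD' dE).
  by move=> w e /HE [? X]; split=> //; rewrite -X E.
Qed.

Theorem quantifier_elimination f : QF (holds r ^~ f).
Proof.
have dT t : Tm (fun e => eval_term e t).
  by elim: t => [v|c|t1 IH1 t2 IH2] /=; [exact: Tm_var|exact: Tm_cst|exact: Tm_add].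
have lt t u : Tm t -> Tm u -> QF (fun e => t e < u e).
  move=> dt du; have := aQ_pos (Tm_add du (Tm_opp dt)).
  by move/(@BC_base _ _ _)/QF_iff; apply=> e; rewrite subr_gt0.
have eq t u : Tm t -> Tm u -> QF (fun e => t e = u e).
  move=> dt du; apply: (QF_iff (BC_and (BC_not (lt _ _ dt du)) (BC_not (lt _ _ du dt)))) => e.
  by split=> [[/negP A /negP B]|->]; [apply/eqP; rewrite eq_le !leNgt A B|rewrite ltxx].
have ex v g : QF (holds r ^~ g) -> QF (fun e => exists z, holds r (upd e v z) g).
  move=> dg; pose F i : env -> int := if i == v then fun e => e 0%N else fun e => e i.+1.
  have dF i : Tm (F i) by rewrite /F; case: ifP => _; exact: Tm_var.
  apply: QF_iff (QF_ex (QF_subst dg dF)) _ => e.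
  have E z : (fun i => F i (scons z e)) = upd e v z.
    by apply: functional_extensionality => i; rewrite /F /upd; case: eqP.
  by split=> -[z Hz]; exists z; move: Hz; rewrite E.
elim: f => [t1 t2|t1 t2|t|g IH|g IHg h IHh|g IHg h IHh|v g IH|v g IH] /=.
- exact: lt.
- exact: eq.
- apply: QF_iff (eq _ _ (dT t) (Tm_L 0 0 (dT t))) _ => e; rewrite addn0 subn0.
  split=> [->|[n ->]]; [by eexists|by rewrite idx_r].
- exact: BC_not.
- exact: BC_and.
- exact: BC_or.
- exact: ex.
- apply: QF_iff (BC_not (ex v (Fnot g) (BC_not IH))) _ => e; split=> [H z|H [z]]; last by apply; exact: H.
  by apply: NNPP => Hz; apply: H; exists z.
Qed.

Lemma DefFun_lam : DefFun r (fun e => (r (idx (e 0%N)))%:Z).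
Proof.
pose z := Tvar 0; pose u := Tvar 1; pose w := Tvar 2; pose c := Tconst (r 0%N)%:Z.
exists (For (Fand (FR z) (Fand (Fnot (Flt u z)) (Fall 2 (For (Fnot (FR w)) (For (Flt u w) (Fnot (Flt z w)))))))
            (Fand (Flt u c) (Feq z c))) => e; rewrite /= /upd /shift /=.
split=> [[[[n ->]] [/negP H1 H2]|[H1 ->]]|->].
- rewrite -leNgt in H1; have H0 : (r 0%N)%:Z <= e 1%N by apply: le_trans H1; rewrite ler_r.
  congr (r _)%:Z; apply/eqP; rewrite eqn_leq (idx_ge r_inc H1) /=.
  case: (H2 (r (idx (e 1%N)))%:Z) => [[]|[]]; first by eexists.
    by rewrite ltNge idx_le.
  by move/negP; rewrite -leNgt ler_r.
- by rewrite idx_eq0 //; apply: lt_trans H1 _; rewrite ltr_r.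
case: (lerP (r 0%N)%:Z (e 1%N)) => H0; last first.
  by right; rewrite idx_eq0 //; apply: lt_trans H0 _; rewrite ltr_r.
left; split; [by eexists|split; first by apply/negP; rewrite -leNgt idx_le].
move=> x; case: (classic (inR r x)) => [[n ->]|]; [right|by left].
case: (ltrP (e 1%N) (r n)%:Z) => H; [by left|right].
by apply/negP; rewrite -leNgt ler_r //; exact: idx_ge.
Qed.

Lemma DefFun_next : DefFun r (fun e => (r (idx (e 0%N)).+1)%:Z).
Proof.
pose z := Tvar 0; pose u := Tvar 1; pose w := Tvar 2; pose c := Tconst (r 0%N)%:Z.
exists (For (Fand (Fnot (Flt u c)) (Fand (FR z) (Fand (Flt u z)
             (Fall 2 (For (Fnot (FR w)) (For (Fnot (Flt u w)) (Fnot (Flt w z))))))))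
            (Fand (Flt u c) (Feq z (Tconst (r 1%N)%:Z)))) => e; rewrite /= /upd /shift /=.
split=> [[[/negP H0 [[n ->] [H1 H2]]]|[H1 ->]]|->].
- rewrite -leNgt in H0; congr (r _)%:Z; apply/eqP; rewrite eqn_leq.
  rewrite -(ltr_r r_inc (idx _) n) (le_lt_trans (idx_le H0) H1) andbT.
  case: (H2 (r (idx (e 1%N)).+1)%:Z) => [[]|[]]; first by eexists.
    by case; exact: idx_lt.
  by move/negP; rewrite -leNgt ler_r.
- by rewrite idx_eq0 //; apply: lt_trans H1 _; rewrite ltr_r.
case: (lerP (r 0%N)%:Z (e 1%N)) => H0; last first.
  by right; rewrite idx_eq0 //; apply: lt_trans H0 _; rewrite ltr_r.
left; split; [by []|split; [by eexists|split; first exact: idx_lt]].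
move=> x; case: (classic (inR r x)) => [[n ->]|]; [right|by left].
case: (lerP (r n)%:Z (e 1%N)) => H; [by left|right].
rewrite ltr_r // ltnS => lt; move: H.
by rewrite ltNge (le_trans _ (idx_le H0)) // ler_r.
Qed.

Lemma DefFun_L i j : DefFun r (fun e => (r (idx (e 0%N) + i - j)%N)%:Z).
Proof.
have up : DefFun r (fun e => (r (idx (e 0%N) + i)%N)%:Z).
  elim: i => [|i IH]; first by apply: DefFun_iff DefFun_lam _ => e; rewrite addn0.
  apply: DefFun_iff (DefFun_comp1 (h := fun u => (r (idx u).+1)%:Z) DefFun_next IH) _ => e.
  by rewrite idx_r // addnS.
elim: j => [|j IH]; first by apply: DefFun_iff up _ => e; rewrite subn0.
(* The predecessor in R is [lambda] of the element minus 1. At [r 0] this gives [r 0] again, in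
   agreement with truncated subtraction of indices. *)
have pred := DefFun_comp1 (h := fun u => (r (idx u))%:Z) DefFun_lam
  (DefFun_add IH (DefFun_const r (-1))).
apply: DefFun_iff pred _ => e; congr (r _)%:Z; rewrite subnS.
case: (idx _ + i - j)%N => [|n] /=.
  by apply: idx_eq0 => //; have := ltr_r r_inc 0 1; lia.
have := ltr_r r_inc n n.+1; rewrite ltnSn => lt.
by apply/idxP; [|split; [lia|left; lia]].
Qed.

Lemma DefFun_Tm t : Tm t -> DefFun r t.
Proof.
elim=> {t} [i|c|t u _ IHt _ IHu|t _ IH|i j t _ IH].
- exact: DefFun_var.
- exact: DefFun_const.
- exact: DefFun_add.
- exact: DefFun_opp.
- exact: (DefFun_comp1 (h := fun u => (r (idx u + i - j)%N)%:Z) (DefFun_L i j) IH).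
Qed.

End QE2.


(** * Strong honest definitions *)

(** Object variables sit at even positions and parameters at odd ones, so both are full sequences
    and no arities occur. [pack] codes a sequence of parameter tuples as one tuple. *)
Definition ev_part (e : env) : env := fun i => e i.*2.
Definition od_part (e : env) : env := fun i => e i.*2.+1.
Definition merge (x y : env) : env := fun i => if odd i then y i./2 else x i./2.
Definition pack (Y : nat -> env) : env :=
  fun n => if @unpickle (nat * nat)%type n is Some lj then Y lj.1 lj.2 else 0.
Definition unpack (e : env) : nat -> env := fun l j => e (pickle (l, j)).

Lemma ev_merge x y : ev_part (merge x y) = x.
Proof. by apply: functional_extensionality => i; rewrite /ev_part /merge odd_double doubleK. Qed.

Lemma od_merge x y : od_part (merge x y) = y.
Proof.
by apply: functional_extensionality => i; rewrite /od_part /merge /= odd_double uphalf_double.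
Qed.

Lemma packK Y : unpack (pack Y) = Y.
Proof.
by apply: functional_extensionality => l; apply: functional_extensionality => j;
  rewrite /unpack /pack pickleK.
Qed.

Section SHD.
Variable r : nat -> nat.

Definition Def2 (phi : env -> env -> Prop) := Def r (fun e => phi (ev_part e) (od_part e)).

Definition DefPsi (psi : env -> (nat -> env) -> Prop) := Def2 (fun x y => psi x (unpack y)).

Lemma Def2_sub phi (f g : nat -> env -> int) : Def2 phi ->
  (forall i, DefFun r (f i)) -> (forall i, DefFun r (g i)) ->
  Def r (fun e => phi (fun i => f i e) (fun i => g i e)).
Proof.
move=> dp df dg; pose F n := if odd n then g n./2 else f n./2.
have dF n : DefFun r (F n) by rewrite /F; case: ifP.
apply: (Def_iff (Def_subst dp dF)) => e; rewrite /ev_part /od_part /F.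
have -> : (fun i => (if odd i.*2 then g i.*2./2 else f i.*2./2) e) = (fun i => f i e).
  by apply: functional_extensionality => i; rewrite odd_double doubleK.
have -> // : (fun i => (if odd i.*2.+1 then g i.*2.+1./2 else f i.*2.+1./2) e) = (fun i => g i e).
by apply: functional_extensionality => i; rewrite /= odd_double uphalf_double.
Qed.

Lemma DefPsi_sub psi (f : nat -> env -> int) (g : nat -> nat -> env -> int) : DefPsi psi ->
  (forall i, DefFun r (f i)) -> (forall l j, DefFun r (g l j)) ->
  Def r (fun e => psi (fun i => f i e) (fun l j => g l j e)).
Proof.
move=> dp df dg; pose G n : env -> int :=
  if @unpickle (nat * nat)%type n is Some lj then g lj.1 lj.2 else fun=> 0.
have dG n : DefFun r (G n) by rewrite /G; case: unpickle => [x|]; [|exact: DefFun_const].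
apply: (Def_iff (Def2_sub (phi := fun x y => psi x (unpack y)) dp df dG)) => e.
suff -> : unpack (fun i => G i e) = (fun l j => g l j e) by [].
by apply: functional_extensionality => l; apply: functional_extensionality => j;
  rewrite /unpack /G pickleK.
Qed.

(* Strong honest definitions for a property [S a a' b] of pairs of points, with finitely
   many candidates [psi i] and no lower bound on the number of parameters. *)
Definition honest_rel (S : env -> env -> env -> Prop) : Prop :=
  exists (I : finType) (psi : I -> env -> (nat -> env) -> Prop),
    (forall i, DefPsi (psi i)) /\
    forall (a : env) (n : nat) (B : nat -> env), (0 < n)%N ->
      exists i c, [/\ forall l, (c l < n)%N, psi i a (fun l => B (c l)) &
        forall a', psi i a' (fun l => B (c l)) -> forall b, (b < n)%N -> S a a' (B b)].

Definition honest (phi : env -> env -> Prop) : Prop :=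
  honest_rel (fun a a' b => phi a b <-> phi a' b).

Lemma honest_rel_mono (S S' : env -> env -> env -> Prop) : honest_rel S ->
  (forall a a' b, S a a' b -> S' a a' b) -> honest_rel S'.
Proof.
move=> [I [psi [dpsi H]]] HS; exists I, psi; split=> // a n B n0.
have [i [c [Hc Ha Ha']]] := H a n B n0; exists i, c; split=> // a' /Ha' Hb b /Hb; exact: HS.
Qed.

Lemma honest_relT : honest_rel (fun _ _ _ => True).
Proof.
exists unit, (fun _ _ _ => True); split=> [_|a n B n0]; first exact: Def_True.
by exists tt, (fun=> 0%N).
Qed.

Lemma honest_rel_and S1 S2 : honest_rel S1 -> honest_rel S2 ->
  honest_rel (fun a a' b => S1 a a' b /\ S2 a a' b).
Proof.
move=> [I1 [psi1 [d1 H1]]] [I2 [psi2 [d2 H2]]].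
exists (I1 * I2)%type, (fun i x Y => psi1 i.1 x (fun l => Y l.*2) /\ psi2 i.2 x (fun l => Y l.*2.+1)).
split=> [[i1 i2]|a n B n0].
  apply: Def_and; [apply: (DefPsi_sub (f := fun i e => e i.*2) (g := fun l j e =>
    e (pickle (l.*2, j)).*2.+1) (d1 i1)) | apply: (DefPsi_sub (f := fun i e => e i.*2)
    (g := fun l j e => e (pickle (l.*2.+1, j)).*2.+1) (d2 i2))]; move=> *; exact: DefFun_var.
have [i1 [c1 [Hc1 Ha1 H1']]] := H1 a n B n0; have [i2 [c2 [Hc2 Ha2 H2']]] := H2 a n B n0.
pose c m := if odd m then c2 m./2 else c1 m./2.
have E1 : (fun l => B (c l.*2)) = (fun l => B (c1 l)).
  by apply: functional_extensionality => l; rewrite /c odd_double doubleK.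
have E2 : (fun l => B (c l.*2.+1)) = (fun l => B (c2 l)).
  by apply: functional_extensionality => l; rewrite /c /= odd_double uphalf_double.
exists (i1, i2), c; rewrite /= E1 E2; split=> // [l|a' [h1 h2] b Hb].
  by rewrite /c; case: ifP.
by split; [exact: H1'|exact: H2'].
Qed.

Lemma honest_rel_fin (I : finType) (S : I -> env -> env -> env -> Prop) :
  (forall i, honest_rel (S i)) -> honest_rel (fun a a' b => forall i, S i a a' b).
Proof.
move=> H0; suff H (s : seq I) : honest_rel (fun a a' b => forall i, i \in s -> S i a a' b).
  by apply: (honest_rel_mono (H (enum I))) => a a' b Hi i; apply: Hi; rewrite mem_enum.
elim: s => [|i s IH]; first by apply: honest_rel_mono honest_relT _.
apply: honest_rel_mono (honest_rel_and (H0 i) IH) _ => a a' b [H1 H2] j.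
by rewrite inE => /orP [/eqP->//|]; exact: H2.
Qed.

Lemma honest_iff phi psi : honest phi -> (forall x y, phi x y <-> psi x y) -> honest psi.
Proof. by move=> H E; apply: honest_rel_mono H _ => a a' b; rewrite !E. Qed.

Lemma honest_const (Q : env -> Prop) : honest (fun _ y => Q y).
Proof. exact: honest_rel_mono honest_relT _. Qed.

Lemma honest_not phi : honest phi -> honest (fun x y => ~ phi x y).
Proof. by move=> H; apply: honest_rel_mono H _ => a a' b; tauto. Qed.

Lemma honest_and phi psi : honest phi -> honest psi -> honest (fun x y => phi x y /\ psi x y).
Proof. by move=> H H'; apply: honest_rel_mono (honest_rel_and H H') _ => a a' b; tauto. Qed.

Lemma honest_or phi psi : honest phi -> honest psi -> honest (fun x y => phi x y \/ psi x y).
Proof. by move=> H H'; apply: honest_rel_mono (honest_rel_and H H') _ => a a' b; tauto. Qed.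

Lemma honest_fin (I : finType) (phi : I -> env -> env -> Prop) :
  (forall i, honest (phi i)) -> honest (fun x y => exists i, phi i x y).
Proof.
move=> H; pose S i a a' b := phi i a b <-> phi i a' b.
apply: honest_rel_mono (honest_rel_fin (S := S) H) _ => a a' b E.
by split=> -[i Hi]; exists i; apply/(E i).
Qed.

Lemma honest_param_free (phi : env -> Prop) : Def r phi -> honest (fun x _ => phi x).
Proof.
move=> dp; have dE : Def r (fun e => phi (ev_part e)).
  by apply: (Def_subst (F := fun i e => e i.*2) dp) => i; exact: DefFun_var.
exists bool, (fun b x _ => if b then phi x else ~ phi x); split.
  by case; [exact: dE|exact: Def_not].
move=> a n B n0; exists (if excluded_middle_informative (phi a) then true else false), (fun=> 0%N).
by case: excluded_middle_informative => Ha; split=> // a' Ha' b _; tauto.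
Qed.

Lemma honest_sub phi (f g : nat -> env -> int) : honest phi ->
  (forall i, DefFun r (f i)) -> (forall i, DefFun r (g i)) ->
  honest (fun x y => phi (fun i => f i x) (fun i => g i y)).
Proof.
move=> [I [psi [dpsi H]]] df dg.
exists I, (fun i x Y => psi i (fun k => f k x) (fun l j => g j (Y l))); split=> [i|a n B n0].
  apply: (DefPsi_sub (f := fun k e => f k (ev_part e)) (g := fun l j e => g j (unpack (od_part e) l))
    (dpsi i)) => [k|l j].
    by apply: (DefFun_comp (F := fun i e => e i.*2) (df k)) => m; exact: DefFun_var.
  by apply: (DefFun_comp (F := fun j e => unpack (od_part e) l j) (dg j)) => m; exact: DefFun_var.
have [i [c [Hc Ha Hi]]] := H (fun k => f k a) n (fun b j => g j (B b)) n0.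
by exists i, c; split=> // a' Ha' b Hb; apply: (Hi (fun k => f k a')).
Qed.

(* If only one parameter value b occurs, {b, b + (1, 0, ..., 0)} is used instead; [beta]
   records which of the two is chosen. *)
Lemma honest_of_SHD p q (phi : p.-tuple int -> q.+1.-tuple int -> Prop) :
  has_SHD r phi -> honest (fun x y => phi [tuple x i | i < p] [tuple y j | j < q.+1]).
Proof.
move=> [k [psi [[f Hf] H]]].
pose tp (y : env) : q.+1.-tuple int := [tuple y j | j < q.+1].
pose bump (b : bool) (y : env) : env := fun j => y j + (b && (j == 0%N))%:Z.
pose Psi (beta : {ffun 'I_k -> bool}) (x : env) (Y : nat -> env) :=
  psi [tuple x i | i < p] [tuple tp (bump (beta l) (Y l)) | l < k].
exists {ffun 'I_k -> bool}, Psi; split.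
  move=> beta; pose F n : env -> int := if (n < p)%N then fun e => e n.*2 else
     let m := (n - p)%N in let l := (m %/ q.+1)%N in let j := (m %% q.+1)%N in
     fun e => if insub l is Some l' then bump (beta l') (unpack (od_part e) l) j else 0.
  have dF n : DefFun r (F n).
    rewrite /F; case: ifP => _; first exact: DefFun_var.
    case: insubP => [l' _ _|_]; last exact: DefFun_const.
    by apply: DefFun_add; [exact: DefFun_var|exact: DefFun_const].
  have dh : Def r (holds r ^~ f) by exists f.
  apply: (Def_iff (Def_subst dh dF)) => e; rewrite Hf /Psi.
  have -> : [tuple F i e | i < p] = [tuple ev_part e i | i < p].
    by apply: eq_from_tnth => i; rewrite !tnth_mktuple /F ltn_ord.
  suff -> : [tuple [tuple F (p + l * q.+1 + j)%N e | j < q.+1] | l < k] =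
    [tuple tp (bump (beta l) (unpack (od_part e) l)) | l < k] by [].
  apply: eq_from_tnth => l; apply: eq_from_tnth => j; rewrite !tnth_mktuple /F.
  rewrite ltnNge -addnA leq_addr /= addKn divnMDl // modnMDl modn_small // divn_small // addn0.
  by rewrite insubT //= => lt; congr (bump (beta _) _ _); apply: val_inj.
move=> a n B n0; pose Bt := [seq tp (B b) | b <- iota 0 n].
have inB b : (b < n)%N -> tp (B b) \in Bt by move=> Hb; apply: map_f; rewrite mem_iota.
case: (ltnP 1 (size (undup Bt))) => Hs.
  have [c [Hc [Ha Ha']]] := H [tuple a i | i < p] Bt Hs.
  pose c' l := if insub l is Some l' then index (tnth c l') Bt else 0%N.
  have c'lt l : (c' l < n)%N.
    rewrite /c'; case: insubP => // l' _ _.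
    by move: (Hc l'); rewrite -index_mem size_map size_iota.
  have Ec : [tuple tp (bump ([ffun=> false] l) (B (c' l))) | l < k] = c.
    apply: eq_from_tnth => l; rewrite tnth_mktuple ffunE /c' valK.
    rewrite -[RHS](nth_index (tp (B 0%N)) (Hc l)) (nth_map 0%N) ?size_iota; last first.
      by move: (Hc l); rewrite -index_mem size_map size_iota.
    rewrite nth_iota; last by move: (Hc l); rewrite -index_mem size_map size_iota.
    by rewrite add0n; apply: eq_from_tnth => j; rewrite !tnth_mktuple /bump /= addr0.
  exists [ffun=> false], c'; rewrite /Psi Ec; split=> // a' Hpsi b Hb.
  exact: Ha' Hpsi _ (inB b Hb).
pose t0 := tp (B 0%N); pose t1 := tp (bump true (B 0%N)).
have ne : t0 != t1.
  apply/eqP => /(congr1 (fun t => tnth t ord0)); rewrite !tnth_mktuple /bump /=; lia.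
have [c [Hc [Ha Ha']]] := H [tuple a i | i < p] [:: t0; t1]
  ltac:(by rewrite /= inE (negbTE ne)).
pose beta := [ffun l => tnth c l != t0].
have Ec : [tuple tp (bump (beta l) (B 0%N)) | l < k] = c.
  apply: eq_from_tnth => l; rewrite tnth_mktuple ffunE.
  move: (Hc l); rewrite !inE => /orP [/eqP ->|/eqP ->].
    by rewrite eqxx; apply: eq_from_tnth => j; rewrite !tnth_mktuple /bump /= addr0.
  by rewrite eq_sym ne.
exists beta, (fun=> 0%N); rewrite /Psi Ec; split=> // a' Hpsi b Hb.
have -> : [tuple B b j | j < q.+1] = t0.
  have : tp (B b) \in undup Bt by rewrite mem_undup inB.
  have : t0 \in undup Bt by rewrite mem_undup inB.
  by case: (undup Bt) Hs => [|s [|]] //= _; rewrite !inE => /eqP -> /eqP.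
by apply: Ha' Hpsi _ _; rewrite mem_head.
Qed.

(** In the induction [x'] becomes part of a parameter, of which [psi] may inspect every entry.
    Truncation restores the dependence on [p] variables. *)
Definition trunc (p : nat) (x : env) : env := fun i => if (i < p)%N then x i else 0.

Definition depends (p : nat) (phi : env -> env -> Prop) :=
  forall x x' y, (forall i, (i < p)%N -> x i = x' i) -> phi x y <-> phi x' y.

(* Distality only has to be checked for formulas with one object variable: a strong honest
   definition in x_0 over the parameters (x', b), then one in x' for the implications
   "psi(x_0; x', c) -> phi(x_0, x'; b)" over the parameters (b, c) with c fixed. *)
Lemma honest_all_vars :
  (forall phi, Def2 phi -> depends 1 phi -> honest phi) ->
  forall p phi, Def2 phi -> depends p phi -> honest phi.
Proof.
move=> base; elim=> [|p IH] phi dphi Hdep.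
  by apply: (honest_iff (honest_const (phi (fun=> 0)))) => x y; apply: Hdep.
pose phi1 x y := phi (scons (x 0%N) (ev_part y)) (od_part y).
have dphi1 : Def2 phi1.
  apply: (Def2_sub (f := fun i e => scons (e 0%N) (ev_part (od_part e)) i)
    (g := fun i e => od_part (od_part e) i) dphi) => [[|i]|i]; exact: DefFun_var.
have [I [psi [dpsi H1]]] : honest phi1.
  by apply: base => // x x' y E; rewrite /phi1 E.
pose x1 z : env := scons z (fun=> 0).
(* The even part of the parameter [y] is [b], the odd part packs the whole tuple [c]. The Boolean
   selects the implication from [psi] to [phi] or to its negation. *)
pose th (i : I * bool) (x y : env) := forall z,
  psi i.1 (x1 z) (fun l => merge (trunc p x) (unpack (od_part y) l)) ->
  if i.2 then phi (scons z (trunc p x)) (ev_part y) else ~ phi (scons z (trunc p x)) (ev_part y).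
have dth i : Def2 (th i).
  have d0 j (h : env -> env) : (forall j, DefFun r (fun e => h e j)) -> DefFun r (fun e => trunc p (h e) j).
    by move=> dh; rewrite /trunc; case: (j < p)%N; [exact: dh|exact: DefFun_const].
  have dx : forall j, DefFun r (fun e => trunc p (ev_part (shift e)) j).
    by move=> j; apply: d0 => {}j; exact: DefFun_var.
  have dP : Def r (fun e => phi (scons (e 0%N) (trunc p (ev_part (shift e)))) (ev_part (od_part (shift e)))).
    apply: (Def2_sub (f := fun j e => scons (e 0%N) (trunc p (ev_part (shift e))) j)
     (g := fun j e => ev_part (od_part (shift e)) j) dphi) => [[|j]|j].
    - exact: DefFun_var.
    - exact: dx.
    - exact: DefFun_var.
  have dQ : Def r (fun e => psi i.1 (x1 (e 0%N))
      (fun l => merge (trunc p (ev_part (shift e))) (unpack (od_part (od_part (shift e))) l))).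
    apply: (DefPsi_sub (f := fun j e => x1 (e 0%N) j) (g := fun l j e =>
      merge (trunc p (ev_part (shift e))) (unpack (od_part (od_part (shift e))) l) j) (dpsi i.1)).
      by case=> [|j]; [exact: DefFun_var|exact: DefFun_const].
    by move=> l j; rewrite /merge; case: (odd j); [exact: DefFun_var|exact: dx].
  rewrite /th; case: i.2; first exact: (Def_all (Def_imp dQ dP)).
  exact: (Def_all (Def_imp dQ (Def_not dP))).
have hth i : honest (th i).
  apply: IH (dth i) _ => x x' y E; suff -> : th i x y = th i x' y by [].
  rewrite /th; have -> // : trunc p x = trunc p x'.
  by apply: functional_extensionality => j; rewrite /trunc; case: ltnP => // /E.
have [J [psi' [dpsi' H2]]] :=
  honest_rel_fin (S := fun i a a' b => th i a b <-> th i a' b) hth.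
exists (I * J)%type, (fun ij x Y =>
  psi ij.1 (x1 (x 0%N)) (fun l => merge (trunc p (shift x)) (Y l.*2)) /\
  psi' ij.2 (shift x) (fun l => merge (Y l.*2.+1) (pack (fun l' => Y l'.*2)))).
split=> [[i j]|a n B n0].
  apply: Def_and.
    apply: (DefPsi_sub (f := fun k e => x1 (e 0%N) k) (g := fun l k e =>
      merge (trunc p (shift (ev_part e))) (unpack (od_part e) l.*2) k) (dpsi i)) => [[|k]|l k].
    - exact: DefFun_var.
    - exact: DefFun_const.
    rewrite /merge /trunc; case: (odd k); first exact: DefFun_var.
    by case: (k./2 < p)%N; [exact: DefFun_var|exact: DefFun_const].
  apply: (DefPsi_sub (f := fun k e => shift (ev_part e) k) (g := fun l k e =>
    merge (unpack (od_part e) l.*2.+1) (pack (fun l' => unpack (od_part e) l'.*2)) k) (dpsi' j)) => [k|l k].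
    exact: DefFun_var.
  rewrite /merge /pack; case: (odd k); last exact: DefFun_var.
  by case: unpickle => [lj|]; [exact: DefFun_var|exact: DefFun_const].
have [i [c [Hc Ha Ha']]] := H1 (x1 (a 0%N)) n (fun b => merge (trunc p (shift a)) (B b)) n0.
have [j [c' [Hc' Hb Hb']]] := H2 (shift a) n (fun b => merge (B b) (pack (fun l => B (c l)))) n0.
pose c2 m := if odd m then c' m./2 else c m./2.
have E1 : (fun l => B (c2 l.*2)) = (fun l => B (c l)).
  by apply: functional_extensionality => l; rewrite /c2 odd_double doubleK.
have E1' l : B (c2 l.*2) = B (c l) by rewrite /c2 odd_double doubleK.
have E2 l : B (c2 l.*2.+1) = B (c' l) by rewrite /c2 /= odd_double uphalf_double.
have F1 x : (fun l => merge (trunc p (shift x)) (B (c2 l.*2))) = (fun l => merge (trunc p (shift x)) (B (c l))).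
  by apply: functional_extensionality => l; rewrite E1'.
have F2 : (fun l => merge (B (c2 l.*2.+1)) (pack (fun l' => B (c2 l'.*2)))) =
          (fun l => merge (B (c' l)) (pack (fun l' => B (c l')))).
  by apply: functional_extensionality => l; rewrite E2 E1.
exists (i, j), c2; rewrite /= F2 F1; split=> [l||a' [h1 h2] b Hbn].
- by rewrite /c2; case: ifP.
- by split.
rewrite F1 in h1.
have phiE (x : env) y : phi x y <-> phi (scons (x 0%N) (trunc p (shift x))) y.
  by apply: Hdep => -[|k] //= Hk; rewrite /trunc -ltnS Hk.
(* [psi'] transports the implication from the tail of [a] to that of [a'], where it is applied to
   the first coordinate of [a']. *)
have tr s : th (i, s) (shift a) (merge (B b) (pack (fun l => B (c l)))) ->
   if s then phi a' (B b) else ~ phi a' (B b).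
  move=> /(Hb' _ h2 b Hbn (i, s)).1 /(_ (a' 0%N)) /=; rewrite od_merge packK ev_merge => /(_ h1).
  by case: s => //; rewrite -phiE.
(* By honesty of [psi], one of the two implications holds at the tail of [a], according to the truth
   value of [phi a (B b)]. *)
have key z : psi i (x1 z) (fun l => merge (trunc p (shift a)) (B (c l))) ->
    phi a (B b) <-> phi (scons z (trunc p (shift a))) (B b).
  by move=> /Ha' /(_ b Hbn); rewrite /phi1 ev_merge od_merge -phiE.
split=> [pa|pa']; first apply: (tr true).
  by move=> z; rewrite /= od_merge packK ev_merge => /key <-.
apply: NNPP => npa; apply: (tr false) pa'.
by move=> z; rewrite /= od_merge packK ev_merge => /key <-.
Qed.

Lemma DefPsi_supp psi : DefPsi psi -> exists K, forall x Y Y',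
  (forall l, (l < K)%N -> Y l = Y' l) -> psi x Y <-> psi x Y'.
Proof.
move=> dpsi; have [M HM] := Def_supp dpsi.
pose bd n := if @unpickle (nat * nat)%type n is Some lj then lj.1.+1 else 0%N.
exists (\max_(n < M) bd n) => x Y Y' E.
have := HM (merge x (pack Y)) (merge x (pack Y')); rewrite !ev_merge !od_merge !packK; apply.
move=> i Hi; rewrite /merge /pack; case: ifP => // _; case Eu: unpickle => [lj|] //.
rewrite E //; have lt : (i./2 < M)%N by rewrite (leq_ltn_trans _ Hi) // leq_half_double; lia.
by apply: leq_trans (leq_bigmax (Ordinal lt)); rewrite /bd /= Eu.
Qed.

(** The finitely many candidates are merged into one formula by coding the choice in the parameters.
    Two distinct elements [b0], [b1] of [B] fill [M] pairs of extra places, and only the pair of the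
    chosen candidate has distinct entries. By [DefPsi_supp] only [K] further places matter. *)
Lemma distal_of_honest :
  (forall phi, Def2 phi -> depends 1 phi -> honest phi) -> distal r.
Proof.
move=> base p q phi [f Hf].
pose phi' (x y : env) := phi [tuple x i | i < p] [tuple y j | j < q].
have dphi : Def2 phi'.
  pose F n : env -> int := if (n < p)%N then fun e => e n.*2 else fun e => e (n - p)%N.*2.+1.
  have dF n : DefFun r (F n) by rewrite /F; case: ifP => _; exact: DefFun_var.
  have dh : Def r (holds r ^~ f) by exists f.
  apply: (Def_iff (Def_subst dh dF)) => e; rewrite Hf /phi'.
  have -> : [tuple F i e | i < p] = [tuple ev_part e i | i < p].
    by apply: eq_from_tnth => i; rewrite !tnth_mktuple /F ltn_ord.
  suff -> : [tuple F (p + j)%N e | j < q] = [tuple od_part e j | j < q] by [].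
  by apply: eq_from_tnth => i; rewrite !tnth_mktuple /F ltnNge leq_addr /= addKn.
have [I [psi [dpsi H]]] : honest phi'.
  apply: (honest_all_vars base (p := p)) dphi _ => x x' y E; rewrite /phi'.
  have -> // : [tuple x i | i < p] = [tuple x' i | i < p].
  by apply: eq_from_tnth => i; rewrite !tnth_mktuple E.
have [K HK] : exists K, forall i x Y Y', (forall l, (l < K)%N -> Y l = Y' l) -> psi i x Y <-> psi i x Y'.
  have [i|K HK] := @fin_bound I (fun i K => forall x Y Y',
    (forall l, (l < K)%N -> Y l = Y' l) -> psi i x Y <-> psi i x Y').
    have [K HK] := DefPsi_supp (dpsi i); exists K => n Hn x Y Y' E; apply: HK => l Hl.
    by apply: E; exact: leq_trans Hn.
  by exists K => i; apply: HK (leqnn _) i.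
pose M := #|I|; pose k := (M.*2 + K)%N.
pose d0 : q.-tuple int := nseq_tuple q 0.
pose tenv n (t : n.-tuple int) : env := fun j => nth 0 t j.
pose rk (i : I) : nat := enum_rank i.
have rkM i : (rk i < M)%N by rewrite /rk /M ltn_ord.
pose Psi (a : p.-tuple int) (c : k.-tuple (q.-tuple int)) := exists i : I,
  nth d0 c (rk i).*2 <> nth d0 c (rk i).*2.+1 /\ psi i (tenv _ a) (fun l => tenv _ (nth d0 c (M.*2 + l))).
exists k, Psi; split.
  suff [g Hg] : Def r (fun e => Psi [tuple e i | i < p] [tuple [tuple e (p + l * q + j)%N | j < q] | l < k]).
    by exists g.
  apply: Def_fin => i; apply: Def_and.
    have d j : Def r (fun e => e (p + (rk i).*2 * q + j)%N = e (p + (rk i).*2.+1 * q + j)%N).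
      by apply: Def_eq; exact: DefFun_var.
    apply: (Def_iff (Def_fin (fun j : 'I_q => Def_not (d j)))) => e.
    have nE m : (m < k)%N -> nth d0 [tuple [tuple e (p + l * q + j)%N | j < q] | l < k] m =
       [tuple e (p + m * q + j)%N | j < q].
      by move=> Hm; rewrite -[m]/(nat_of_ord (Ordinal Hm)) -tnth_nth tnth_mktuple.
    rewrite !nE; try by have := rkM i; rewrite /k; lia.
    split=> [[j Hj] /(congr1 (fun t => tnth t j))|Hne]; first by rewrite !tnth_mktuple.
    apply: NNPP => no; apply: Hne; apply: eq_from_tnth => j; rewrite !tnth_mktuple.
    by apply: NNPP => Hj; apply: no; exists j.
  pose F i : env -> int := if (i < p)%N then fun e => e i else fun=> 0.
  pose G l j : env -> int := if (l < K)%N && (j < q)%N then fun e => e (p + (M.*2 + l) * q + j)%N else fun=> 0.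
  have dF j : DefFun r (F j) by rewrite /F; case: ifP => _; [exact: DefFun_var|exact: DefFun_const].
  have dG l j : DefFun r (G l j) by rewrite /G; case: ifP => _; [exact: DefFun_var|exact: DefFun_const].
  apply: (Def_iff (DefPsi_sub (dpsi i) dF dG)) => e.
  have -> : tenv _ [tuple e i | i < p] = fun i => F i e.
    apply: functional_extensionality => j; rewrite /tenv /F; case: ltnP => Hj.
      by rewrite -[j]/(nat_of_ord (Ordinal Hj)) -tnth_nth tnth_mktuple.
    by rewrite nth_default // size_tuple.
  apply: HK => l Hl; apply: functional_extensionality => j.
  have Hm : (M.*2 + l < k)%N by rewrite ltn_add2l.
  rewrite /tenv -[(M.*2 + l)%N]/(nat_of_ord (Ordinal Hm)) -tnth_nth tnth_mktuple /G Hl andTb.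
  case: ltnP => Hj; first by rewrite -[j]/(nat_of_ord (Ordinal Hj)) -tnth_nth tnth_mktuple.
  by rewrite nth_default // size_tuple.
move=> a B HB.
have [b0 [b1 [Hb0 Hb1 ne]]] : exists b0 b1, [/\ b0 \in B, b1 \in B & b0 <> b1].
  have := undup_uniq B; have memB b : b \in undup B -> b \in B by rewrite mem_undup.
  case: (undup B) HB memB => [|b0 [|b1 s]] //= _ memB /andP [Hn _].
  exists b0, b1; split; [by apply: memB; rewrite mem_head|by apply: memB; rewrite !inE eqxx orbT|].
  by move=> E; move: Hn; rewrite E mem_head.
have n0 : (0 < size B)%N by case: (B) Hb0.
have [i [c [Hc Ha Ha']]] := H (tenv _ a) (size B) (fun n => tenv _ (nth b0 B n)) n0.
pose cc : k.-tuple (q.-tuple int) := [tuple (if (m < M.*2)%N then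
   (if m == (rk i).*2.+1 :> nat then b1 else b0) else nth b0 B (c (m - M.*2)%N)) | m < k].
have nE m : (m < k)%N -> nth d0 cc m = if (m < M.*2)%N then
   (if m == (rk i).*2.+1 :> nat then b1 else b0) else nth b0 B (c (m - M.*2)%N).
  by move=> Hm; rewrite -[m]/(nat_of_ord (Ordinal Hm)) -tnth_nth tnth_mktuple.
have psiE i' a' : psi i' (tenv p a') (fun l => tenv _ (nth d0 cc (M.*2 + l))) <->
    psi i' (tenv p a') (fun l => tenv _ (nth b0 B (c l))).
  apply: HK => l Hl; congr tenv; rewrite nE ?ltn_add2l //.
  by rewrite ltnNge leq_addr /= addKn.
have phiE (x : p.-tuple int) (y : q.-tuple int) : phi' (tenv _ x) (tenv _ y) = phi x y.
  rewrite /phi' /tenv; congr phi; apply: eq_from_tnth => j; by rewrite tnth_mktuple -tnth_nth.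
have r1 i' : ((rk i').*2 < k)%N /\ ((rk i').*2.+1 < k)%N by have := rkM i'; rewrite /k; lia.
have r2 i' : ((rk i').*2 < M.*2)%N /\ ((rk i').*2.+1 < M.*2)%N by have := rkM i'; lia.
exists cc; split; [|split].
- move=> l; rewrite tnth_mktuple; case: ifP => _; first by case: ifP.
  by rewrite mem_nth.
- exists i; split; last by apply/psiE.
  rewrite !nE; try by case: (r1 i).
  rewrite (r2 i).1 (r2 i).2 eqxx; have -> // : (rk i).*2 == (rk i).*2.+1 = false by lia.
move=> a' [i' [Hi' /psiE Hpsi]] b Hb.
have Ei : i' = i.
  apply: NNPP => nei; apply: Hi'; have ner : rk i' <> rk i by move=> /ord_inj/enum_rank_inj.
  rewrite !nE; try by case: (r1 i').
  rewrite (r2 i').1 (r2 i').2; have -> : (rk i').*2 == (rk i).*2.+1 = false by lia.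
  by have -> : (rk i').*2.+1 == (rk i).*2.+1 = false by lia.
rewrite Ei in Hpsi; have := Ha' _ Hpsi (index b B).
by rewrite index_mem => /(_ Hb); rewrite nth_index // !phiE.
Qed.

End SHD.


(** * Expansions and P_Delta *)

Definition wchain (D n : nat) (w : nat -> nat) :=
  (forall i, (i < n)%N -> (w i.+1 + D <= w i)%N) /\ (D <= w n)%N.

Lemma wchain_lt D n w i j : wchain D n w -> (i < j)%N -> (j <= n)%N -> (w j + D <= w i)%N.
Proof.
move=> [H _] lt le; have -> : j = (i + (j - i).-1.+1)%N by lia.
have : (i + (j - i).-1.+1 <= n)%N by lia.
elim: (j - i).-1 => [|k IH] Hk; first by rewrite addn1; apply: H; lia.
have := IH ltac:(lia); have := H (i + k.+1)%N ltac:(lia); rewrite -addnS; lia.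
Qed.

Lemma wchain_ge D n w i : wchain D n w -> (i <= n)%N -> (D <= w i)%N.
Proof.
move=> H; rewrite leq_eqVlt => /orP [/eqP ->|lt]; first exact: (proj2 H).
have := wchain_lt H lt (leqnn _); lia.
Qed.

Lemma wchain_mono D D' n w : (D' <= D)%N -> wchain D n w -> wchain D' n w.
Proof. by move=> le [H1 H2]; split=> [i /H1|]; lia. Qed.

Lemma ler_norm_sum_const n (F : 'I_n -> int) (X : int) :
  (forall i, `|F i| <= X) -> `|\sum_(i < n) F i| <= n%:Z * X.
Proof.
move=> H; apply: le_trans (ler_norm_sum _ _ _) _.
apply: le_trans (ler_sum _ (fun i _ => H i)) _.
by rewrite sumr_const card_ord -mulr_natl natz.
Qed.

Section Lex.
Variable r : nat -> nat.
Hypothesis r_inc : forall m, (r m < r m.+1)%N.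
Hypothesis r_sparse : sparse r.

Local Notation evop := (evop r).

(** The operator at the first difference changes by at least a bounded shift of [r (w i)], while all
    later coordinates of both chains lie below [w i - D]. For large [D] the first difference
    decides, with a surplus that later absorbs the width of the interval in [core]. *)
Lemma lex_gap n (A : nat -> nat -> int) L :
  (forall i, (i <= n)%N -> evop (A i) /\ ~ evzero (A i)) ->
  exists D0, forall D, (D0 <= D)%N -> forall w w' i, wchain D n w -> wchain D n w' ->
  (i <= n)%N -> (forall j, (j < i)%N -> w j = w' j) -> (w' i < w i)%N ->
  exists s : bool, L%:Z * (r (w i - D + L)%N)%:Z <
    (-1) ^+ s * (\sum_(j < n.+1) A j (w j) - \sum_(j < n.+1) A j (w' j)).
Proof.
move=> HA; have [K0 HK] : exists K0, forall K, (K0 <= K)%N -> forall i : 'I_n.+1, exists s : bool,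
    (forall m, (K <= m)%N -> `|A i m| <= (r (m + K)%N)%:Z) /\
    (forall m m', (K <= m)%N -> (m < m')%N -> (r (m' - K)%N)%:Z <= (-1) ^+ s * (A i m' - A i m)).
  apply: (@fin_bound 'I_n.+1 (fun i K => exists s : bool, _ /\ _)) => i.
  have [e nz] := HA i (ltn_ord i); have [s [K0 H]] := evop_main r_inc r_sparse e nz.
  exists K0 => K /H [H1 H2]; exists s; split=> // m /H1 []//.
have {HK} HK := HK K0 (leqnn _).
(* In multiples of [X]: [n.+1 * 2] for the other coordinates of the two chains, [L] for the claimed
   surplus, and one for strictness. *)
pose C := (n.+1 * 2 + L.+1)%N; have [G HG] := mul_boundP r_inc r_sparse C.
exists (2 * K0 + L + G + 1)%N => D HD w w' i cw cw' le eqw lt.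
have [s [_ Hs]] := HK (Ordinal (n := n.+1) (m := i) le); exists s.
have gw j : (j <= n)%N -> (D <= w j)%N := wchain_ge cw.
have gw' j : (j <= n)%N -> (D <= w' j)%N := wchain_ge cw'.
pose X := (r (w i - D + (K0 + L))%N)%:Z; have X0 : 0 <= X by [].
rewrite -sumrB; set S := \sum_(j < n.+1) _.
have main := Hs (w' i) (w i) ltac:(have := gw' i le; lia) lt.
have rest : `|S - (A i (w i) - A i (w' i))| <= n.+1%:Z * (2 * X).
  have -> : S - (A i (w i) - A i (w' i)) = \sum_(j < n.+1) (if j == i :> nat then 0 else A j (w j) - A j (w' j)).
    rewrite /S (bigD1 (Ordinal (n := n.+1) (m := i) le)) //= addrAC subrr add0r.
    rewrite [RHS](bigD1 (Ordinal (n := n.+1) (m := i) le)) //= eqxx add0r.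
    by apply: eq_bigr => j /negbTE; rewrite -val_eqE /= => ->.
  apply: ler_norm_sum_const => j; case: eqP => [_|/eqP ne]; first by rewrite normr0; lia.
  case: (ltngtP j i) ne => // [ltj|gtj] _; first by rewrite eqw // subrr normr0; lia.
  have jn : (j <= n)%N by rewrite -ltnS.
  have a := wchain_lt cw gtj jn; have a' := wchain_lt cw' gtj jn.
  have [_ [Hb _]] := HK j.
  have b := Hb (w j) ltac:(have := gw j jn; lia); have b' := Hb (w' j) ltac:(have := gw' j jn; lia).
  have : (r (w j + K0)%N)%:Z <= X by rewrite ler_r //; lia.
  have : (r (w' j + K0)%N)%:Z <= X by rewrite ler_r //; lia.
  lia.
have big : C%:Z * X <= (r (w i - K0)%N)%:Z by apply: HG; have := gw i le; lia.
have X1 : (r (w i - D + L)%N)%:Z <= X by rewrite ler_r //; lia.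
have Xpos : 0 < X.
  have := r_ge r_inc (w i - D + (K0 + L)); rewrite /X.
  case: (posnP (w i - D + (K0 + L))) => [E|]; last lia.
  have := gw' i le; lia.
have big' : n.+1%:Z * (2 * X) + L%:Z * X + X <= (r (w i - K0)%N)%:Z.
  apply: le_trans big; rewrite /C PoszD PoszM -addn1 -[L.+1]addn1 !PoszD !mulrDl; lia.
have L1 : L%:Z * (r (w i - D + L)%N)%:Z <= L%:Z * X by apply: ler_wpM2l.
move: main rest; case: s {Hs} => /=; rewrite ?expr0 ?expr1; lia.
Qed.

Definition in_class (N d n : nat) (w : nat -> nat) := forall i, (i <= n)%N -> in_tilde N d (w i).

(* An expansion [scoef x = sbase y + sum_(i < sdim) sops_i(w_i) + rho], where the [w_i] are the
   indices of its coordinates, and [rho] lies between [smult * r (w_sdim + soff)] and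
   [smult * r (w_sdim + soff + 1)]. *)
Record state := State {
  sdim : nat; scoef : int; sbase : env -> int; sops : nat -> nat -> int; soff : nat; smult : nat }.

Implicit Type St : state.

Definition wf St := [/\ scoef St != 0, Tm r (sbase St),
  forall i, (i < sdim St)%N -> evop (sops St i) /\ ~ evzero (sops St i) & (0 < smult St)%N].

Definition rho St (x : int) (y : env) (w : nat -> nat) : int :=
  scoef St * x - sbase St y - \sum_(i < sdim St) sops St i (w i).

Definition core St (x : int) (y : env) (w : nat -> nat) : Prop :=
  (smult St)%:Z * (r (w (sdim St) + soff St)%N)%:Z < rho St x y w /\
  rho St x y w <= (smult St)%:Z * (r (w (sdim St) + soff St).+1)%:Z.

(** The lower bound of the remainder is itself an operator in the last coordinate. Appending it
    makes the target exceed a sum of [n + 1] operators, as in the definition of P_Delta; [top_ops]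
    does the same for the upper bound. *)
Definition all_ops St (i m : nat) : int :=
  if (i < sdim St)%N then sops St i m else (smult St)%:Z * (r (m + soff St)%N)%:Z.

Definition top_ops St (i m : nat) : int :=
  if (i < sdim St)%N then sops St i m else (smult St)%:Z * (r (m + soff St).+1)%:Z.

Lemma sum_all_ops St (w : nat -> nat) : \sum_(i < (sdim St).+1) all_ops St i (w i) =
  \sum_(i < sdim St) sops St i (w i) + (smult St)%:Z * (r (w (sdim St) + soff St)%N)%:Z.
Proof.
rewrite big_ord_recr /= {2}/all_ops ltnn; congr (_ + _).
by apply: eq_bigr => i _; rewrite /all_ops /= ltn_ord.
Qed.

Lemma sum_top_ops St (w : nat -> nat) : \sum_(i < (sdim St).+1) top_ops St i (w i) =
  \sum_(i < sdim St) sops St i (w i) + (smult St)%:Z * (r (w (sdim St) + soff St).+1)%:Z.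
Proof.
rewrite big_ord_recr /= {2}/top_ops ltnn; congr (_ + _).
by apply: eq_bigr => i _; rewrite /top_ops /= ltn_ord.
Qed.

Lemma coreE St x y w : core St x y w <->
  \sum_(i < (sdim St).+1) all_ops St i (w i) < scoef St * x - sbase St y /\
  scoef St * x - sbase St y <= \sum_(i < (sdim St).+1) top_ops St i (w i).
Proof. rewrite sum_all_ops sum_top_ops /core /rho; lia. Qed.

Lemma all_ops_ev St i : wf St -> evop (all_ops St i) /\ ~ evzero (all_ops St i).
Proof.
case=> _ _ H k0; rewrite /all_ops; case: ltnP => Hi; first exact: H.
split; first by apply: evopZ; apply: (evop_shift (g := fun m => (r m)%:Z)); exact: evopr.
move=> [K /(_ K.+1 (leqnSn _))]; have := r_ge r_inc (K.+1 + soff St) => H1 /eqP.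
by rewrite mulf_eq0; lia.
Qed.

Lemma top_ops_ev St i : wf St -> evop (top_ops St i).
Proof.
case=> _ _ H k0; rewrite /top_ops; case: ltnP => Hi; first by case: (H i Hi).
apply: evopZ; exact: (evop_shift (g := fun m => (r m.+1)%:Z) _ (evopr1 r)).
Qed.

Lemma first_diff n (w w' : nat -> nat) : (forall i, (i <= n)%N -> w i = w' i) \/
  exists i, [/\ (i <= n)%N, forall j, (j < i)%N -> w j = w' j & w i <> w' i].
Proof.
elim: n => [|n [H|[i [le H ne]]]]; last by right; exists i; split=> //; exact: leqW.
  case: (classic (w 0%N = w' 0%N)) => E; [left=> -[]//|right; exists 0%N]; by split.
case: (classic (w n.+1 = w' n.+1)) => E; [left|right].
  by move=> i; rewrite leq_eqVlt => /orP [/eqP ->//|]; rewrite ltnS; exact: H.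
by exists n.+1; split=> // j Hj; apply: H.
Qed.

(* The core condition makes [w] the lexicographically last chain below the target. *)
Lemma core_max St : wf St -> exists D0, forall D, (D0 <= D)%N -> forall x y w w',
  wchain D (sdim St) w -> wchain D (sdim St) w' -> core St x y w ->
  \sum_(i < (sdim St).+1) all_ops St i (w' i) < scoef St * x - sbase St y ->
  (\sum_(i < (sdim St).+1) all_ops St i (w' i) < \sum_(i < (sdim St).+1) all_ops St i (w i)) \/
  forall i, (i <= sdim St)%N -> w i = w' i.
Proof.
move=> wfS; pose L := ((smult St) + (soff St).+1)%N.
have [D0 HD] := @lex_gap (sdim St) (all_ops St) L (fun i _ => all_ops_ev i wfS).
exists D0 => D le x y w w' cw cw' /coreE [Hlo Hhi] Hw'.
case: (first_diff (sdim St) w w') => [|[i [lei eqw ne]]]; [by right|left].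
have k0 : (0 < smult St)%N by case: wfS.
have gap : \sum_(i < (sdim St).+1) top_ops St i (w i) - \sum_(i < (sdim St).+1) all_ops St i (w i)
   <= (smult St)%:Z * (r (w (sdim St) + soff St).+1)%:Z.
  rewrite sum_all_ops sum_top_ops.
  have : 0 <= (smult St)%:Z * (r (w (sdim St) + soff St)%N)%:Z by apply: mulr_ge0.
  lia.
case: (ltnP i (sdim St)) => lti; last first.
  have Ei : i = sdim St by lia.
  have E : \sum_(i < sdim St) sops St i (w i) = \sum_(i < sdim St) sops St i (w' i).
    by apply: eq_bigr => j _; rewrite eqw // Ei.
  rewrite !sum_all_ops sum_top_ops E in Hhi Hw' Hlo *; rewrite Ei in ne.
  have mono a b : (a <= b)%N -> (smult St)%:Z * (r a)%:Z <= (smult St)%:Z * (r b)%:Z.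
    by move=> Hab; rewrite ler_wpM2l // ler_r.
  case: (ltngtP (w (sdim St)) (w' (sdim St))) ne => // lt _.
    have := mono (w (sdim St) + soff St).+1 (w' (sdim St) + soff St)%N ltac:(lia); lia.
  rewrite ltrD2l ltr_pM2l; last lia.
  by rewrite ltr_r // ltn_add2r.
have last_le m : (w (sdim St) + D <= m)%N -> (smult St)%:Z * (r (w (sdim St) + soff St).+1)%:Z <= L%:Z * (r (m - D + L)%N)%:Z.
  move=> Hm; apply: ler_pM => //; first by rewrite /L; lia.
  by rewrite ler_r // /L; lia.
have wi := wchain_lt cw lti (leqnn _).
have pos : 0 <= (smult St)%:Z * (r (w (sdim St) + soff St).+1)%:Z by apply: mulr_ge0.
move: gap Hhi Hw' Hlo; set Sw := \sum_(j < _) all_ops St j (w j).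
set Sw' := \sum_(j < _) all_ops St j (w' j); set Stop := \sum_(j < _) _.
set X := _ - sbase St y => gap Hhi Hw' Hlo.
case: (ltngtP (w i) (w' i)) ne => // lt _.
  have [s] := HD D le w' w i cw' cw lei (fun j Hj => esym (eqw j Hj)) lt.
  have := last_le (w' i) ltac:(lia); rewrite -/Sw -/Sw'.
  by case: s; rewrite ?expr0 ?expr1; lia.
have [s] := HD D le w w' i cw cw' lei eqw lt.
have := last_le (w i) ltac:(lia); rewrite -/Sw -/Sw'.
by case: s; rewrite ?expr0 ?expr1; lia.
Qed.

End Lex.


Lemma nat_least (P : nat -> Prop) : (exists n, P n) ->
  exists2 n, P n & forall m, P m -> (n <= m)%N.
Proof.
move=> [n Hn]; elim/ltn_ind: n Hn => n IH Hn.
case: (classic (exists2 m, P m & (m < n)%N)) => [[m Hm lt]|no]; first exact: IH lt Hm.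
by exists n => // m Hm; rewrite leqNgt; apply/negP => lt; apply: no; exists m.
Qed.

Lemma fin_choice (I : finType) (T : Type) (R : I -> T -> Prop) :
  (forall i, exists t, R i t) -> exists f : I -> T, forall i, R i (f i).
Proof.
move=> H; exists (fun i => proj1_sig (constructive_indefinite_description _ (H i))) => i.
by case: constructive_indefinite_description.
Qed.

(** * Expansions as values of P_Delta *)

Section Frame.
Variable r : nat -> nat.
Hypothesis r_inc : forall m, (r m < r m.+1)%N.
Hypothesis r_sparse : sparse r.
Variables N d : nat.
Hypothesis d_gt0 : (0 < d)%N.

Local Notation evop := (evop r).
Local Notation Tm := (Tm r).
Local Notation idx := (idx r).
Local Notation wf := (wf r).
Local Notation honest := (honest r).

(** The bound [N + 2 * D] leaves room: after an offset of at most [D] is subtracted, the last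
    coordinate is still [D] steps above the minimum of [~R], as P_Delta requires. *)
Definition chain (D n : nat) (w : nat -> nat) :=
  [/\ in_class N d n w, wchain D n w & (N + 2 * D <= w n)%N].

Definition stands St (D : nat) (x : int) (y : env) (w : nat -> nat) : Prop :=
  chain D (sdim St) w /\ core r St x y w.

Lemma stands_uniq St : wf St -> exists D0, forall D, (D0 <= D)%N -> forall x y w w',
  stands St D x y w -> stands St D x y w' -> forall i, (i <= sdim St)%N -> w i = w' i.
Proof.
move=> wfS; have [D0 H] := core_max r_inc r_sparse wfS; exists D0 => D le x y w w'.
move=> [[_ cw _] kw] [[_ cw' _] kw'].
have [lw _] := (coreE r St x y w).1 kw; have [lw' _] := (coreE r St x y w').1 kw'.
case: (H D le x y w w' cw cw' kw lw') => // lt.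
case: (H D le x y w' w cw' cw kw' lw) => [lt' | E i /E //].
by have := lt_trans lt lt'; rewrite ltxx.
Qed.

(** The extremum exists because the values are integers, bounded above by [x] in the first case and
    below by [x] in the second. *)
Lemma P_spec_ex n D (A : n.-tuple (seq int)) x : exists u, P_spec r N d D A x u.
Proof.
have [u0 Hu0] : exists u : n.-tuple nat, RtD r N d D u.
  exists [tuple (N + d * (D * (n - i)))%N | i < n]; split=> i; rewrite tnth_mktuple; first by eexists.
  rewrite leq_r //; case: (ltnP i.+1 n) => Hi.
    rewrite -[i.+1]/(nat_of_ord (Ordinal Hi)) -tnth_nth tnth_mktuple /=.
    have -> : (n - i = (n - i.+1).+1)%N by lia.
    by rewrite mulnS mulnDr; have := leq_pmull D d_gt0; lia.
  rewrite nth_default ?size_tuple // leq_add2l -{1}[D]mul1n; apply: leq_mul => //.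
  by apply: leq_pmulr; have := ltn_ord i; lia.
case: (classic (exists u', RtD r N d D u' /\ dotop r A u' < x)) => [Hex|Hno].
  have /nat_least [k [u [Hu Hlt Ek]] Hmin] : exists k : nat, exists u,
      [/\ RtD r N d D u, dotop r A u < x & x - dotop r A u = k%:Z].
    by have [u [Hu Hlt]] := Hex; exists `|(x - dotop r A u)%R|%N, u; split=> //; lia.
  exists u; split=> //; split=> // _; split=> // u' Hu' Hlt'.
  have lek : (k <= `|(x - dotop r A u')%R|)%N by apply: Hmin; exists u'; split=> //; lia.
  lia.
have Hge u : RtD r N d D u -> x <= dotop r A u.
  by move=> Hu; rewrite leNgt; apply/negP => lt; apply: Hno; exists u.
have /nat_least [k [u [Hu Ek]] Hmin] :
    exists k : nat, exists u, RtD r N d D u /\ dotop r A u - x = k%:Z.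
  by exists `|(dotop r A u0 - x)%R|%N, u0; split=> //; have := Hge _ Hu0; lia.
exists u; split=> //; split=> [/Hno//|_ u' Hu'].
have lek : (k <= `|(dotop r A u' - x)%R|)%N.
  by apply: Hmin; exists u'; split=> //; have := Hge _ Hu'; lia.
have := Hge _ Hu'; lia.
Qed.

Lemma P_DeltaP n D (A : n.-tuple (seq int)) x : P_spec r N d D A x (P_Delta r N d D A x).
Proof. by apply: epsilon_spec; exact: P_spec_ex. Qed.

Lemma RtD_chain n D e (u : n.+1.-tuple nat) : (d %| e)%N -> RtD r N d D u ->
  in_class N d n (fun i => nth 0%N u i + e)%N /\ wchain D n (fun i => nth 0%N u i + e)%N.
Proof.
move=> /dvdnP [q ->] [H1 H2]; split.
  move=> i Hi; have [t] := H1 (Ordinal (n := n.+1) (m := i) Hi).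
  by rewrite (tnth_nth 0%N) /= => ->; exists (t + q)%N; lia.
split=> [i Hi|].
  have := H2 (Ordinal (n := n.+1) (m := i) (leqW Hi)).
  rewrite leq_r // (tnth_nth 0%N) /= (set_nth_default 0%N) ?size_tuple //; lia.
have := H2 ord_max; rewrite leq_r // (tnth_nth 0%N) /= nth_default ?size_tuple //; lia.
Qed.

(** One offset turns finitely many families into genuine operators; being a multiple of [d], it
    keeps the coordinates in their class. *)
Lemma common_shift (J : finType) n (B : J -> nat -> nat -> int) :
  (forall j i, (i <= n)%N -> evop (B j i)) ->
  exists (e : nat) (Bh : J -> n.+1.-tuple (seq int)), (d %| e)%N /\
    forall j (i : 'I_n.+1) m, B j i (m + e)%N = opv r (tnth (Bh j) i) m.
Proof.
move=> HB; have [K HK] : exists K, forall D, (K <= D)%N -> forall ji : J * 'I_n.+1,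
    exists A, forall m, B ji.1 ji.2 (m + D)%N = opv r A m.
  apply: (@fin_bound (J * 'I_n.+1)%type (fun ji D => exists A, _)) => ji.
  by apply: evop_ev; apply: HB; rewrite -ltnS.
have le : (K <= d * K)%N by apply: leq_pmull.
have [A HA] := fin_choice (HK _ le).
exists (d * K)%N, (fun j => [tuple A (j, i) | i < n.+1]); split; first exact: dvdn_mulr.
by move=> j i m; rewrite tnth_mktuple (HA (j, i)).
Qed.

Lemma dotop_shift n e (B : nat -> nat -> int) (Bh : n.+1.-tuple (seq int)) (u : n.+1.-tuple nat) :
  (forall (i : 'I_n.+1) m, B i (m + e)%N = opv r (tnth Bh i) m) ->
  dotop r Bh u = \sum_(i < n.+1) B i (nth 0%N u i + e)%N.
Proof. by move=> H; rewrite /dotop; apply: eq_bigr => i _; rewrite H (tnth_nth 0%N). Qed.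

(** The shifted tuple [w - e] competes in the definition of P_Delta, so the sum at P_Delta is at
    least the sum at [w] and still below the target. By [core_max] the two chains coincide. *)
Lemma stands_P St e (Ah : (sdim St).+1.-tuple (seq int)) : wf St -> (d %| e)%N ->
  (forall (i : 'I_(sdim St).+1) m, all_ops r St i (m + e)%N = opv r (tnth Ah i) m) ->
  exists D0, forall D, (D0 <= D)%N -> (d %| D)%N -> forall x y w, stands St D x y w ->
  forall i, (i <= sdim St)%N -> w i = (nth 0 (P_Delta r N d D Ah (scoef St * x - sbase St y)) i + e)%N.
Proof.
move=> wfS de HA; have [D0 H] := core_max r_inc r_sparse wfS.
exists (D0 + e)%N => D HD dD x y w [[Cw cw bw] kw].
set X := _ - _; set p := P_Delta _ _ _ _ _ _.
have [Rp [Hp _]] : P_spec r N d D Ah X p := P_DeltaP _ _ _.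
have wge i : (i <= sdim St)%N -> (w (sdim St) <= w i)%N.
  rewrite leq_eqVlt => /orP [/eqP ->//|lt]; have := wchain_lt cw lt (leqnn _); lia.
pose u : (sdim St).+1.-tuple nat := [tuple (w i - e)%N | i < (sdim St).+1].
have nu i : (i <= sdim St)%N -> nth 0%N u i = (w i - e)%N.
  by move=> Hi; rewrite -[i in LHS]/(nat_of_ord (Ordinal (n := (sdim St).+1) (m := i) Hi)) -tnth_nth tnth_mktuple.
have Ru : RtD r N d D u.
  have [q Eq] := dvdnP de; split=> i; rewrite tnth_mktuple.
    have Hi := ltn_ord i; have [t Et] := Cw i Hi; exists (t - q)%N.
    have := wge i Hi; rewrite Et mulnBr [(d * q)%N]mulnC -Eq.
    by have : (e <= d * t)%N; have := wge i Hi; lia.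
  rewrite leq_r //; case: (ltnP i (sdim St)) => Hi.
    rewrite (set_nth_default 0%N) ?size_tuple // nu //; have := cw.1 i Hi; have := wge i.+1 Hi; lia.
  rewrite nth_default ?size_tuple //; have -> : nat_of_ord i = sdim St by have := ltn_ord i; lia.
  lia.
have Su : dotop r Ah u = \sum_(i < (sdim St).+1) all_ops r St i (w i).
  rewrite (dotop_shift _ HA); apply: eq_bigr => i _; rewrite nu; last by rewrite -ltnS.
  by rewrite subnK //; have := wge i (ltn_ord i); lia.
have [lw _] := (coreE r St x y w).1 kw.
have lu : dotop r Ah u < X by rewrite Su.
have [Hlt Hmax] := Hp (ex_intro _ u (conj Ru lu)).
have := Hmax u Ru; rewrite Su => /(_ lw) Hle.
have [_ cp] := RtD_chain de Rp.
case: (H D ltac:(lia) x y w _ cw cp kw) => [|lt|E]; first by rewrite -(dotop_shift _ HA).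
  by move: lt; rewrite -(dotop_shift _ HA) ltNge Hle.
by move=> i Hi; rewrite E.
Qed.

Definition honest1 (phi : int -> env -> Prop) := honest (fun x y => phi (x 0%N) y).

Hypothesis HF : forall n, (0 < n)%N -> F_prop r n.

Lemma phiF_honest n (A B : n.+1.-tuple (seq int)) lt E :
  (forall i, ~ op_zero r (tnth A i)) -> (E = false -> is_F r B) ->
  exists D0, forall D, (D0 <= D)%N -> (d %| D)%N -> forall k g f, Tm g -> Tm f ->
  honest1 (fun x y => let lhs := (if E then k * x else 0) - f y in
                 let rhs := dotop r B (P_Delta r N d D A (k * x - g y)) in
                 if lt then lhs < rhs else rhs < lhs).
Proof.
move=> nzA FB; have [D0 H] := @HF n.+1 isT d N A B lt E d_gt0 nzA FB.
exists D0 => D le dD k g f dg df; have := honest_of_SHD (H D le dD).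
pose F (i : nat) (e : env) := k * e 0%N; pose G (i : nat) := if i is 0%N then g else f.
have dF i : DefFun r (F i).
  by apply: DefFun_Tm => //; apply: Tm_scale; exact: Tm_var.
have dG i : DefFun r (G i) by apply: DefFun_Tm => //; case: i.
move/honest_sub => /(_ F G dF dG) => H'; apply: (honest_iff H') => x y.
by rewrite /phiF !tnth_mktuple.
Qed.

Lemma dotop_F n (i : 'I_n) u : dotop r (F_op i) u = (r (tnth u i))%:Z.
Proof.
rewrite /dotop (bigD1 i) //= tnth_mktuple eqxx big1 ?addr0.
  by rewrite /opv big_ord1 mul1r addn0.
by move=> j /negbTE ne; rewrite tnth_mktuple ne /opv big_ord0.
Qed.

Lemma honest1_iff phi psi : honest1 phi -> (forall x y, phi x y <-> psi x y) -> honest1 psi.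
Proof. by move=> H E; apply: (honest_iff H). Qed.

Lemma honest1_and phi psi : honest1 phi -> honest1 psi -> honest1 (fun x y => phi x y /\ psi x y).
Proof. exact: honest_and. Qed.

Lemma honest1_or phi psi : honest1 phi -> honest1 psi -> honest1 (fun x y => phi x y \/ psi x y).
Proof. exact: honest_or. Qed.

Lemma honest1_not phi : honest1 phi -> honest1 (fun x y => ~ phi x y).
Proof. exact: honest_not. Qed.

Lemma honest1_const (Q : env -> Prop) : honest1 (fun _ y => Q y).
Proof. exact: honest_const. Qed.

Lemma honest1_fin (I : finType) (phi : I -> int -> env -> Prop) :
  (forall i, honest1 (phi i)) -> honest1 (fun x y => exists i, phi i x y).
Proof. by move=> H; apply: (honest_fin (phi := fun i x y => phi i (x 0%N) y)). Qed.

(** (F_n) with [B = F^i] compares with an unshifted coordinate [r m]; the offset [e] has to be moved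
    to the parameter side. *)
Lemma lt_r_shift (f : int) m e : f < (r (m + e)%N)%:Z <->
  f < (r e)%:Z \/ (r (idx f + 0 - e)%N)%:Z < (r m)%:Z.
Proof.
rewrite addn0 ltr_r //; case: (ltrP f (r e)%:Z) => He.
  by split=> [_|_]; [left|apply: lt_le_trans He _; rewrite ler_r // leq_addl].
have e_le := idx_ge r_inc He.
have r0 : (r 0%N)%:Z <= f by apply: le_trans He; rewrite ler_r.
split=> [H|[//|H]].
  right; have := le_lt_trans (idx_le r0) H; rewrite ltr_r //; lia.
by apply: lt_le_trans (idx_lt r_inc f) _; rewrite ler_r //; lia.
Qed.

(* [W x y] is P_Delta, shifted by an offset which turns all functions involved into operators. *)
Lemma frame St (B : nat -> nat -> int) : wf St -> (forall i, (i <= sdim St)%N -> evop (B i)) ->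
  exists D0, forall D, (D0 <= D)%N -> (d %| D)%N -> exists W : int -> env -> nat -> nat,
  [/\ forall x y w, stands St D x y w -> forall i, (i <= sdim St)%N -> w i = W x y i,
      honest1 (fun x y => stands St D x y (W x y)),
      forall i f, (i <= sdim St)%N -> Tm f -> honest1 (fun x y => f y < (r (W x y i))%:Z) &
      forall (s : bool) f, Tm f ->
        honest1 (fun x y => 0 < (-1) ^+ s * scoef St * x + f y + \sum_(i < (sdim St).+1) B i (W x y i))].
Proof.
move=> wfS dB.
(* P_Delta is formed from the first family; the other three occur as [B] in (F_n). The negative of
   [B] is there because [0 < c x + f + B.P] reads [- B.P < c x + f]. *)
pose fam (j : 'I_4) : nat -> nat -> int := match val j with
  | 0 => all_ops r St | 1 => top_ops r St | 2 => B | _ => fun i m => - B i m end.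
have dfam j i : (i <= sdim St)%N -> evop (fam j i).
  move=> Hi; rewrite /fam; case: (val j) => [|[|[|_]]].
  - by have [] := all_ops_ev r_inc i wfS.
  - exact: top_ops_ev wfS.
  - exact: dB.
  - by apply: evopN; exact: dB.
have [e [Bh [de HBh]]] := common_shift dfam.
have HA : forall (i : 'I_(sdim St).+1) m, all_ops r St i (m + e)%N = opv r (tnth (Bh (inord 0)) i) m.
  by move=> i m; rewrite -HBh /fam [val _]inordK.
have HT : forall (i : 'I_(sdim St).+1) m, top_ops r St i (m + e)%N = opv r (tnth (Bh (inord 1)) i) m.
  by move=> i m; rewrite -HBh /fam [val _]inordK.
have HB : forall (i : 'I_(sdim St).+1) m, B i (m + e)%N = opv r (tnth (Bh (inord 2)) i) m.
  by move=> i m; rewrite -HBh /fam [val _]inordK.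
have HBN : forall (i : 'I_(sdim St).+1) m, - B i (m + e)%N = opv r (tnth (Bh (inord 3)) i) m.
  by move=> i m; rewrite -HBh /fam [val _]inordK.
set Ah := Bh (inord 0) in HA; set Th := Bh (inord 1) in HT.
set Ph := Bh (inord 2) in HB; set Mh := Bh (inord 3) in HBN.
have nzA i : ~ op_zero r (tnth Ah i).
  move=> Hz; have [_ []] := all_ops_ev r_inc i wfS; exists e => m Hm.
  by rewrite -(subnK Hm) HA Hz.
have [D1 H1] := stands_P wfS de HA.
have [D2 H2] := phiF_honest (B := Ah) false (E := true) nzA ltac:(done).
have [D3 H3] := phiF_honest (B := Th) false (E := true) nzA ltac:(done).
have [D4 H4] := phiF_honest (B := Ph) true (E := true) nzA ltac:(done).
have [D5 H5] := phiF_honest (B := Mh) false (E := true) nzA ltac:(done).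
have [D6 H6] : exists D0, forall D, (D0 <= D)%N -> forall i : 'I_(sdim St).+1, (d %| D)%N ->
    forall k g f, Tm g -> Tm f ->
    honest1 (fun x y => 0 - f y < dotop r (F_op i) (P_Delta r N d D Ah (k * x - g y))).
  apply: (@fin_bound 'I_(sdim St).+1 (fun i D => (d %| D)%N -> _)) => i.
  have [|D6 H6] := @phiF_honest _ Ah (F_op i) true false nzA; first by move=> _; exists i.
  by exists D6 => D le dD k g f dg df; exact: (H6 D le dD k g f dg df).
exists (D1 + D2 + D3 + D4 + D5 + D6)%N => D HD dD.
have [_ dg _ _] := wfS.
pose P x y := P_Delta r N d D Ah (scoef St * x - sbase St y).
pose W x y i := (nth 0%N (P x y) i + e)%N.
have sumW (F : nat -> nat -> int) Fh x y : (forall (i : 'I_(sdim St).+1) m, F i (m + e)%N = opv r (tnth Fh i) m) ->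
    \sum_(i < (sdim St).+1) F i (W x y i) = dotop r Fh (P x y).
  by move=> E; rewrite (dotop_shift _ E).
have beta i f : (i <= sdim St)%N -> Tm f -> honest1 (fun x y => f y < (r (W x y i))%:Z).
  move=> Hi df; have dl : Tm (fun y => - (r (idx (f y) + 0 - e)%N)%:Z) := Tm_opp (Tm_L 0 e df).
  have h := H6 D ltac:(lia) (Ordinal (n := (sdim St).+1) (m := i) Hi) dD (scoef St) (sbase St) _ dg dl.
  apply: (honest_iff (honest_or (honest_const r (fun y => f y < (r e)%:Z)) h)) => x y.
  by rewrite /W lt_r_shift dotop_F (tnth_nth 0%N) sub0r opprK.
have h2 := H2 D ltac:(lia) dD (scoef St) (sbase St) (sbase St) dg dg.
have h3 := H3 D ltac:(lia) dD (scoef St) (sbase St) (sbase St) dg dg.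
exists W; split=> //.
- by apply: H1 => //; lia.
(* Class and gaps of [W x y] come with P_Delta. Only the lower bound on its last entry and the two
   inequalities of [core] are tested, the weak ones as strict inequalities or their negations. *)
- have hb := beta (sdim St) (fun=> (r (N + 2 * D)%N)%:Z - 1) (leqnn _) (Tm_cst _ _).
  apply: (honest_iff (honest_and hb (honest_and h2 (honest_not h3)))) => x0 y /=.
  move: (x0 0%N) => x.
  have Rp : RtD r N d D (P x y) by have [] := P_DeltaP D Ah (scoef St * x - sbase St y).
  have [Cp cp] := RtD_chain de Rp.
  rewrite /stands coreE (sumW _ _ _ _ HA) (sumW _ _ _ _ HT) -/(P x y) /chain.
  have -> : ((r (N + 2 * D)%N)%:Z - 1 < (r (W x y (sdim St)))%:Z) = (N + 2 * D <= W x y (sdim St))%N.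
    by rewrite -(ler_r r_inc); lia.
  rewrite ltNge; split=> [[hb' [lo /negP hi]]|[[_ _ hb'] [lo hi]]].
    by split; [split|split=> //; rewrite -[_ <= _]negbK -ltNge].
  by split=> //; split=> //; rewrite ltNge hi.
- case=> f df.
    have h4 := H4 D ltac:(lia) dD (scoef St) (sbase St) f dg df.
    apply: (honest_iff h4) => x y /=; rewrite (sumW _ _ _ _ HB) -/(P (x 0%N) y) expr1; lia.
  have h5 := H5 D ltac:(lia) dD (scoef St) (sbase St) _ dg (Tm_opp df).
  apply: (honest_iff h5) => x y /=; rewrite expr0 mul1r -/(P (x 0%N) y).
  have := sumW (fun i m => - B i m) _ (x 0%N) y HBN; rewrite sumrN => <-; set S := \sum_(i < _) _; lia.
Qed.

End Frame.


(** * Leading terms of sums along a chain *)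

Section Lead.
Variable r : nat -> nat.
Hypothesis r_inc : forall m, (r m < r m.+1)%N.
Hypothesis r_sparse : sparse r.
Local Notation evop := (evop r).
Local Notation mag := (mag r).

(** Coordinates after [i] lie [D] steps below [w i]. The remainder has the size of the last
    coordinate, so it belongs to the tail only if [i < n]. *)
Lemma tail_mag n (B : nat -> nat -> int) (a : int) (k s : nat) :
  (forall j, (j <= n)%N -> evop (B j)) ->
  exists L, forall D, (L <= D)%N -> forall w (rh : int) i, wchain D n w -> (i <= n)%N ->
  (i < n)%N \/ a = 0 -> `|rh| <= k%:Z * (r (w n + s).+1)%:Z ->
  (mag (a * rh + \sum_(j < n.+1) (if (i < j)%N then B j (w j) else 0)) + D <= w i + L)%N.
Proof.
move=> dB; have [K HK] : exists K0, forall K, (K0 <= K)%N -> forall j : 'I_n.+1, forall m, (K <= m)%N ->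
    `|B j m| <= (r (m + K)%N)%:Z.
  apply: (@fin_bound 'I_n.+1 (fun j K => forall m, (K <= m)%N -> _)) => j.
  have [K HK] := evop_ub r_inc r_sparse (dB j ltac:(by rewrite -ltnS)); exists K => K' le m Hm.
  by apply: le_trans (HK m ltac:(lia)) _; rewrite ler_r //; lia.
have {}HK := HK K (leqnn _).
pose C := (n.+1 + `|a|%N * k)%N; have [G HG] := mul_bound r_inc r_sparse C.
pose E := (K + s + 1)%N; exists (E + G)%N => D le w rh i cw Hi Ha Hrh.
have wi := wchain_ge cw Hi.
pose X := (r (w i - D + E)%N)%:Z; have X0 : 0 <= X by [].
have sumle : `|\sum_(j < n.+1) (if (i < j)%N then B j (w j) else 0)| <= n.+1%:Z * X.
  apply: ler_norm_sum_const => j; case: ltnP => Hj; last by rewrite normr0.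
  have wj := wchain_lt cw Hj (ltn_ord j); have wj' := wchain_ge cw (ltn_ord j).
  by apply: le_trans (HK j (w j) ltac:(lia)) _; rewrite ler_r // /E; lia.
have rhle : `|a * rh| <= (`|a|%N * k)%N%:Z * X.
  case: Ha => [lt|->]; last by rewrite mul0r normr0 mulr_ge0.
  rewrite normrM PoszM -mulrA abszE; apply: ler_wpM2l => //; apply: le_trans Hrh _.
  apply: ler_wpM2l => //; have := wchain_lt cw lt (leqnn _); rewrite ler_r // /E; lia.
have tot : `|a * rh + \sum_(j < n.+1) (if (i < j)%N then B j (w j) else 0)| <= C%:Z * X.
  by apply: le_trans (ler_normD _ _) _; rewrite /C PoszD mulrDl; lia.
have := @mag_leP r r_inc (a * rh + \sum_(j < n.+1) (if (i < j)%N then B j (w j) else 0)) (w i - D + E + G)%N.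
move=> H; have : (mag (a * rh + \sum_(j < n.+1) (if (i < j)%N then B j (w j) else 0)) <= w i - D + E + G)%N.
  apply: H; apply: le_lt_trans (le_trans tot (HG _)) _; rewrite ltr_r //.
lia.
Qed.

(** [near_sum] is used twice: [b m] dominates [R], and then whichever of [b m] and [f] is larger
    dominates the other, since they are not comparable. *)
Lemma lead b L : evop b -> ~ evzero b -> exists (s : bool) K, forall m R f D,
  (K <= D)%N -> (D <= m)%N -> (mag R + D <= m + L)%N -> ~ near K m (mag f) ->
  if (mag f < m)%N then (0 < f + (b m + R)) = ~~ s /\ near K (mag (f + (b m + R))) m
  else (0 < f + (b m + R)) = (0 < f) /\ near K (mag (f + (b m + R))) (mag f).
Proof.
move=> eb nz; have [G HG] := near_sum r_inc r_sparse; have [K1 H1] := near_evop r_inc r_sparse eb nz.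
have [s [K2 H2]] := evop_main r_inc r_sparse eb nz; have [{}H2 _] := H2 K2 (leqnn _).
exists s, (K1 + K2 + L + G + G + G)%N => m R f D HD Hm HR nn.
have n1 := H1 m ltac:(lia); have [sb _ _] := H2 m ltac:(lia).
have sbE : (0 < b m) = ~~ s by case: (s) sb; rewrite ?expr0 ?expr1; lia.
have [n2 s2] := HG (b m) R ltac:(move: n1; rewrite /near; lia).
case: ltnP => lt.
  have [n3 s3] := HG (b m + R) f ltac:(move: n1 n2 nn; rewrite /near; lia).
  rewrite [f + _]addrC s3 s2 sbE; split=> //.
  by apply: nearW (near_trans n3 (near_trans n2 n1)); lia.
have [n3 s3] := HG f (b m + R) ltac:(move: n1 n2 nn; rewrite /near; lia).
by rewrite s3; split=> //; apply: nearW n3; lia.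
Qed.

End Lead.

Section Solve.
Variable r : nat -> nat.
Hypothesis r_inc : forall m, (r m < r m.+1)%N.
Hypothesis r_sparse : sparse r.
Hypothesis HF : forall n, (0 < n)%N -> F_prop r n.
Variables N d M : nat.
Hypothesis d_gt0 : (0 < d)%N.
Hypothesis M_gt0 : (0 < M)%N.
Hypothesis r_per : forall k, (N <= k)%N -> (r (k + d) = r k %[mod M])%N.

Local Notation evop := (evop r).
Local Notation Tm := (Tm r).
Local Notation idx := (idx r).
Local Notation mag := (mag r).
Local Notation wf := (wf r).
Local Notation honest1 := (honest1 r).
Local Notation core := (core r).
Local Notation stands := (stands r N d).

(** * One object variable *)

Definition pred3 := int -> env -> (nat -> nat) -> Prop.

Definition local (n : nat) (Q : pred3) := forall x y w w',
  (forall i, (i <= n)%N -> w i = w' i) -> Q x y w <-> Q x y w'.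

Lemma local_imp n Q x y w w' : local n Q -> (forall i, (i <= n)%N -> w i = w' i) ->
  Q x y w -> Q x y w'.
Proof. by move=> lQ E /(lQ _ _ _ _ E). Qed.

(* The gap [D] may be chosen large depending on [Q]. *)
Definition Solve St (Q : pred3) := exists D0, forall D, (D0 <= D)%N -> (d %| D)%N ->
  honest1 (fun x y => exists w, stands St D x y w /\ Q x y w).

Lemma rho_local St x y w w' : (forall i, (i <= sdim St)%N -> w i = w' i) ->
  rho St x y w = rho St x y w'.
Proof.
by move=> E; rewrite /rho; congr (_ - _); apply: eq_bigr => i _; rewrite E // ltnW.
Qed.

Lemma core_local St : local (sdim St) (core St).
Proof. by move=> x y w w' E; rewrite /core (rho_local x y E) E. Qed.

Lemma stands_local St D : local (sdim St) (stands St D).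
Proof.
have H x y w w' : (forall i, (i <= sdim St)%N -> w i = w' i) -> stands St D x y w -> stands St D x y w'.
  move=> E [[C [c1 c2] b] k]; split; last by rewrite -(core_local x y E).
  split; [|split|]; rewrite -?E //.
    by move=> i Hi; rewrite -E //; exact: C.
  by move=> i Hi; rewrite -!E //; [exact: c1|exact: ltnW].
by move=> x y w w' E; split; apply: H => // i Hi; rewrite E.
Qed.

Lemma stands_ge St D x y w i : stands St D x y w -> (i <= sdim St)%N -> (N + 2 * D <= w i)%N.
Proof.
move=> [[_ c b] _]; rewrite leq_eqVlt => /orP [/eqP ->//|lt].
have := wchain_lt c lt (leqnn _); lia.
Qed.

Lemma stands_mono St D D' x y w : (D' <= D)%N -> stands St D x y w -> stands St D' x y w.
Proof. by move=> le [[C c b] k]; split=> //; split=> //; [exact: wchain_mono c|lia]. Qed.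

Lemma solve_W St (Q : pred3) D (W : int -> env -> nat -> nat) : local (sdim St) Q ->
  (forall x y w, stands St D x y w -> forall i, (i <= sdim St)%N -> w i = W x y i) ->
  honest1 (fun x y => stands St D x y (W x y)) -> honest1 (fun x y => Q x y (W x y)) ->
  honest1 (fun x y => exists w, stands St D x y w /\ Q x y w).
Proof.
move=> lQ HW hS hQ; apply: (honest1_iff (honest1_and hS hQ)) => x y.
split=> [H|[w [Hs Hq]]]; first by exists (W x y).
have E := HW x y w Hs.
by split; [exact: (local_imp (@stands_local St D) E Hs)|exact: (local_imp lQ E Hq)].
Qed.

Lemma solve_true St : wf St -> Solve St (fun _ _ _ => True).
Proof.
move=> wfS; have [D0 H] := frame r_inc r_sparse N d_gt0 HF wfS (fun i _ => evop0 r).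
exists D0 => D le dD; have [W [HW hS _ _]] := H D le dD.
by apply: solve_W HW hS _ => //; exact: honest1_const.
Qed.

Lemma solve_iff St (Q Q' : pred3) : Solve St Q ->
  (exists D1, forall D, (D1 <= D)%N -> (d %| D)%N -> forall x y,
     (exists w, stands St D x y w /\ Q x y w) <-> (exists w, stands St D x y w /\ Q' x y w)) ->
  Solve St Q'.
Proof.
move=> [D0 H] [D1 E]; exists (D0 + D1)%N => D le dD.
by apply: (honest1_iff (H D ltac:(lia) dD)) => x y; apply: E => //; lia.
Qed.

Lemma solve_ext St (Q Q' : pred3) : Solve St Q ->
  (exists D1, forall D, (D1 <= D)%N -> (d %| D)%N -> forall x y w, stands St D x y w -> Q x y w <-> Q' x y w) ->
  Solve St Q'.
Proof.
move=> H [D1 E]; apply: (solve_iff H); exists D1 => D le dD x y.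
by split=> -[w [Hs Hq]]; exists w; split=> //; apply/(E D le dD x y w Hs).
Qed.

Lemma solve_eqv St (Q Q' : pred3) : Solve St Q -> (forall x y w, Q x y w <-> Q' x y w) -> Solve St Q'.
Proof. by move=> H E; apply: (solve_ext H); exists 0%N. Qed.

(** For large gaps the coordinates are unique, so [Q] fails at them exactly if no admissible
    coordinates satisfy [Q]. The existence of coordinates remains as a separate conjunct. *)
Lemma solve_not St Q : wf St -> local (sdim St) Q -> Solve St Q ->
  Solve St (fun x y w => ~ Q x y w).
Proof.
move=> wfS lQ [D0 H]; have [D1 H1] := solve_true wfS.
have [D2 U] := stands_uniq r_inc r_sparse N d wfS.
exists (D0 + D1 + D2)%N => D le dD.
apply: (honest1_iff (honest1_and (H1 D ltac:(lia) dD) (honest1_not (H D ltac:(lia) dD)))) => x y.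
split=> [[[w [Hs _]] no]|[w [Hs nQ]]].
  by exists w; split=> // Hq; apply: no; exists w.
split; first by exists w.
move=> [w' [Hs' Hq]]; apply: nQ; apply: (local_imp lQ _ Hq).
by apply: (U D ltac:(lia) x y w' w).
Qed.

Lemma solve_and St (Q Q' : pred3) : wf St -> local (sdim St) Q -> Solve St Q -> Solve St Q' ->
  Solve St (fun x y w => Q x y w /\ Q' x y w).
Proof.
move=> wfS lQ [D0 H] [D1 H1].
have [D2 U] := stands_uniq r_inc r_sparse N d wfS.
exists (D0 + D1 + D2)%N => D le dD.
apply: (honest1_iff (honest1_and (H D ltac:(lia) dD) (H1 D ltac:(lia) dD))) => x y.
split=> [[[w [Hs Hq]] [w' [Hs' Hq']]]|[w [Hs [Hq Hq']]]]; last by split; exists w.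
exists w'; split=> //; split=> //; apply: (local_imp lQ _ Hq).
by apply: (U D ltac:(lia) x y w w').
Qed.

Lemma solve_fin St (I : finType) (Q : I -> pred3) : (forall i, Solve St (Q i)) ->
  Solve St (fun x y w => exists i, Q i x y w).
Proof.
move=> HQ; have [D0 H] := @fin_bound I (fun i D => (d %| D)%N ->
  honest1 (fun x y => exists w, stands St D x y w /\ Q i x y w)) HQ.
exists D0 => D le dD; have := honest1_fin (fun i => H D le i dD).
move/honest1_iff; apply=> x y; split=> [[i [w [Hs Hq]]]|[w [Hs [i Hq]]]].
  by exists w; split=> //; exists i.
by exists i, w.
Qed.

Lemma solve_or St (Q Q' : pred3) : Solve St Q -> Solve St Q' ->
  Solve St (fun x y w => Q x y w \/ Q' x y w).
Proof.
move=> H H'; apply: (solve_eqv (@solve_fin St bool (fun b => if b then Q else Q') _)).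
  by case.
by move=> x y w; split=> [[[]]|[]]; [left|right|exists true|exists false].
Qed.

Lemma solve_xy St (Q : int -> env -> Prop) : wf St -> honest1 Q -> Solve St (fun x y _ => Q x y).
Proof.
move=> wfS hQ; have [D0 H] := solve_true wfS; exists D0 => D le dD.
apply: (honest1_iff (honest1_and (H D le dD) hQ)) => x y.
by split=> [[[w [Hs _]] Hq]|[w [Hs Hq]]]; [exists w|split=> //; exists w].
Qed.

Lemma solve_const St (Q : env -> Prop) : wf St -> Solve St (fun _ y _ => Q y).
Proof. by move=> wfS; apply: (solve_xy (Q := fun _ y => Q y)) => //; exact: honest1_const. Qed.

Lemma sum_local n (B : nat -> nat -> int) w w' : (forall i, (i <= n)%N -> w i = w' i) ->
  \sum_(i < n.+1) B i (w i) = \sum_(i < n.+1) B i (w' i).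
Proof. by move=> E; apply: eq_bigr => i _; rewrite E // -ltnS. Qed.

Lemma solve_gt St i f : wf St -> (i <= sdim St)%N -> Tm f ->
  Solve St (fun _ y w => f y < (r (w i))%:Z).
Proof.
move=> wfS Hi df; have [D0 H] := frame r_inc r_sparse N d_gt0 HF wfS (fun i _ => evop0 r).
exists D0 => D le dD; have [W [HW hS hb _]] := H D le dD.
apply: solve_W HW hS _ => [x y w w' E|]; first by rewrite E.
exact: hb.
Qed.

Lemma solve_coef St (s : bool) f B : wf St -> Tm f -> (forall i, (i <= sdim St)%N -> evop (B i)) ->
  Solve St (fun x y w => 0 < (-1) ^+ s * scoef St * x + f y + \sum_(i < (sdim St).+1) B i (w i)).
Proof.
move=> wfS df dB; have [D0 H] := frame r_inc r_sparse N d_gt0 HF wfS dB.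
exists D0 => D le dD; have [W [HW hS _ ha]] := H D le dD.
apply: solve_W HW hS _ => [x y w w' E|]; first by rewrite (sum_local B E).
exact: ha.
Qed.

(* In (F_n) the variable has the same coefficient outside and inside P_Delta; scaling the
   expansion achieves this. *)
Definition scale_state (a : nat) St := State (sdim St) (a%:Z * scoef St)
  (fun y => a%:Z * sbase St y) (fun i m => a%:Z * sops St i m) (soff St) (a * smult St).

Lemma scale_wf a St : (0 < a)%N -> wf St -> wf (scale_state a St).
Proof.
move=> a0 [c0 dg dA k0]; split=> /=.
- by rewrite mulf_neq0 //; lia.
- exact: Tm_scale.
- move=> i Hi; have [e nz] := dA i Hi; split; first exact: evopZ.
  move=> [K HK]; apply: nz; exists K => n /HK /eqP; rewrite mulf_eq0 => /orP [|/eqP //]; lia.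
- by rewrite muln_gt0 a0.
Qed.

Lemma scale_stands a St D x y w : (0 < a)%N ->
  stands (scale_state a St) D x y w <-> stands St D x y w.
Proof.
move=> a0; rewrite /stands /core.
have -> : rho (scale_state a St) x y w = a%:Z * rho St x y w.
  rewrite /rho /= -mulr_sumr; ring.
by rewrite /= PoszM -!mulrA ltr_pM2l ?ler_pM2l //; lia.
Qed.

Lemma solve_scale a St Q : (0 < a)%N -> Solve (scale_state a St) Q -> Solve St Q.
Proof.
move=> a0 [D0 H]; exists D0 => D le dD; apply: (honest1_iff (H D le dD)) => x y.
by split=> -[w [Hs Hq]]; exists w; split=> //; move: Hs; rewrite scale_stands.
Qed.

Lemma solve_alpha St a f B : wf St -> a != 0 -> Tm f -> (forall i, (i <= sdim St)%N -> evop (B i)) ->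
  Solve St (fun x y w => 0 < a * x + f y + \sum_(i < (sdim St).+1) B i (w i)).
Proof.
move=> wfS a0 df dB; have [c0 _ _ _] := wfS; have pa : (0 < `|a|)%N by lia.
apply: (solve_scale pa).
have dB' i : (i <= sdim (scale_state `|a| St))%N -> evop (fun m => `|scoef St|%:Z * B i m).
  by move=> Hi; apply: evopZ; exact: dB.
(* The expansion is scaled by [|a|] and the condition by [|c|]. The two coefficients of [x] then
   differ only in sign, which [solve_coef] allows. *)
have := solve_coef ((a < 0) (+) (scoef St < 0)) (scale_wf pa wfS) (Tm_scale `|scoef St| df) dB'.
move/solve_eqv; apply=> x y w /=; rewrite -mulr_sumr.
have -> : (-1) ^+ ((a < 0)%R (+) (scoef St < 0)%R) * (`|a|%N%:Z * scoef St) = `|scoef St|%N%:Z * a.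
  rewrite !abszE; case: (ltrP a 0) => Ha; case: (ltrP (scoef St) 0) => Hc;
    rewrite ?(ltr0_norm Ha) ?(ger0_norm Ha) ?(ltr0_norm Hc) ?(ger0_norm Hc) /= ?expr0 ?expr1; ring.
by rewrite -mulrA -!mulrDr pmulr_rgt0 //; lia.
Qed.

Lemma near_cover K m f : near K m (mag f) -> exists (s : bool) (k k' : 'I_K.+1),
  m = (idx ((-1) ^+ s * f) + k - k')%N.
Proof.
move=> /nearP [k [k' E]]; case: (mag_idx r f) => Em.
  by exists false, k, k'; rewrite expr0 mul1r -Em.
by exists true, k, k'; rewrite expr1 mulN1r -Em.
Qed.

Lemma Tm_sg (s : bool) f : Tm f -> Tm (fun y => (-1) ^+ s * f y).
Proof. exact: Tm_scale. Qed.

(* The bound coordinate i is eliminated when it is comparable with f: then w i is a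
   definable function of the parameters. *)
Lemma elim_coord b f K : evop b -> Tm f -> exists D0 (t : bool * 'I_K.+1 * 'I_K.+1 -> env -> int),
  (forall c, Tm (t c)) /\ forall (c : bool * 'I_K.+1 * 'I_K.+1) y m, (D0 <= m)%N ->
   m = (idx ((-1) ^+ c.1.1 * f y) + c.1.2 - c.2)%N -> t c y = f y + b m.
Proof.
move=> db df; have [D0 H] := Tm_idx_evop r_inc db.
have H' (c : bool * 'I_K.+1 * 'I_K.+1) := H c.1.2 c.2 _ (Tm_sg c.1.1 df).
have [t Ht] := fin_choice H'; exists D0, (fun c y => f y + t c y).
split=> [c|c y m Hm E]; first by apply: Tm_add => //; case: (Ht c).
by have [_ Et] := Ht c; rewrite Et -?E.
Qed.

Lemma solve_near St i f k k' : wf St -> (i <= sdim St)%N -> Tm f ->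
  Solve St (fun _ y w => w i = (idx (f y) + k - k')%N).
Proof.
move=> wfS Hi df.
have dl : Tm (fun y => (r (idx (f y) + k - k')%N)%:Z) := Tm_L k k' df.
have g1 := solve_gt wfS Hi dl.
have g2 := solve_gt wfS Hi (Tm_add dl (Tm_cst r (-1))).
have lc (f' : env -> int) : local (sdim St) (fun _ y w => f' y < (r (w i))%:Z).
  by move=> x y w w' E; rewrite E.
have := solve_and wfS (lc _) g2 (solve_not wfS (lc _) g1).
move/solve_eqv; apply=> x y w; rewrite ltr_r //.
have -> : ((r (idx (f y) + k - k')%N)%:Z + -1 < (r (w i))%:Z) = (idx (f y) + k - k' <= w i)%N.
  by rewrite -(ler_r r_inc); lia.
split=> [[A /negP B]|->]; [lia|split=> //; apply/negP; lia].
Qed.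

Definition zero_at (i : nat) (B : nat -> nat -> int) : nat -> nat -> int :=
  fun j m => if j == i then 0 else B j m.

Lemma zero_at_ev n i B : (forall j, (j <= n)%N -> evop (B j)) ->
  forall j, (j <= n)%N -> evop (zero_at i B j).
Proof.
by move=> H j Hj; rewrite /zero_at; case: (j == i); [exact: evop0|exact: H].
Qed.

Lemma sum_zero_at n i (B : nat -> nat -> int) (w : nat -> nat) : (i <= n)%N ->
  \sum_(j < n.+1) B j (w j) = B i (w i) + \sum_(j < n.+1) zero_at i B j (w j).
Proof.
move=> Hi; rewrite (bigD1 (Ordinal (n := n.+1) (m := i) Hi)) //=; congr (_ + _).
rewrite [RHS](bigD1 (Ordinal (n := n.+1) (m := i) Hi)) //= {1}/zero_at eqxx add0r.
by apply: eq_bigr => j /negbTE; rewrite -val_eqE /zero_at /= => ->.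
Qed.

Lemma sum_tail n i (B : nat -> nat -> int) (w : nat -> nat) : (i <= n)%N ->
  (forall j m, (j < i)%N -> B j m = 0) ->
  \sum_(j < n.+1) zero_at i B j (w j) = \sum_(j < n.+1) (if (i < j)%N then B j (w j) else 0).
Proof.
move=> Hi H; apply: eq_bigr => j _; rewrite /zero_at; case: ltngtP => // Hj; exact: H.
Qed.

Lemma stands_wchain St D x y w : stands St D x y w -> wchain D (sdim St) w.
Proof. by case=> -[]. Qed.

(** Without [x], (F_n) only gives comparisons with single coordinates. Hence the induction on the
    number of coordinates left: if the leading [w i] is comparable with [f], it is a term in the
    parameters and is absorbed into [f]; otherwise the sign is that of [B i] or that of [f],
    according to how [w i] compares with [idx f] and [idx (- f)]. *)
Lemma solve_alpha0 St m (f : env -> int) (B : nat -> nat -> int) : wf St -> (m <= (sdim St).+1)%N -> Tm f ->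
  (forall i, (i <= sdim St)%N -> evop (B i)) ->
  (forall j m', (j < (sdim St).+1 - m)%N -> B j m' = 0) ->
  Solve St (fun x y w => 0 < f y + \sum_(i < (sdim St).+1) B i (w i)).
Proof.
move=> wfS; elim: m f B => [|m IH] f B Hm df dB B0.
  apply: (solve_eqv (solve_const (fun y => 0 < f y) wfS)) => x y w.
  by rewrite big1 ?addr0 // => i _; rewrite B0 // subn0.
pose i := (sdim St - m)%N; have Hi : (i <= sdim St)%N by rewrite /i; lia.
pose B' := zero_at i B; have dB' := zero_at_ev i dB.
have B0' j m' : (j < (sdim St).+1 - m)%N -> B' j m' = 0.
  by rewrite /B' /zero_at; case: eqP => // ne Hj; apply: B0; rewrite /i in ne; lia.
have IH' g (dg : Tm g) : Solve St (fun x y w => 0 < g y + \sum_(j < (sdim St).+1) B' j (w j)).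
  by apply: IH => //; exact: ltnW.
case: (classic (evzero (B i))) => [[K HK]|nz].
  apply: (solve_ext (IH' f df)); exists K => D le dD x y w Hs.
  rewrite (sum_zero_at B w Hi) HK ?add0r //; have := stands_ge Hs Hi; lia.
have [L HL] := tail_mag r_inc r_sparse 0 0 0 dB.
have [s [K HK]] := lead r_inc r_sparse L (dB i Hi) nz.
have [D0 [t [dt Ht]]] := elim_coord K (dB i Hi) df.
pose I : finType := (bool * 'I_K.+1 * 'I_K.+1)%type.
pose near_i (c : I) (x : int) (y : env) (w : nat -> nat) := w i = (idx ((-1) ^+ c.1.1 * f y) + c.1.2 - c.2)%N.
have dn c : Solve St (near_i c) by apply: solve_near => //; exact: Tm_sg.
have ln c : local (sdim St) (near_i c) by move=> x y w w' E; rewrite /near_i E.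
have dbig : Solve St (fun _ y w => (r (idx (f y)))%:Z < (r (w i))%:Z /\ (r (idx (- f y)))%:Z < (r (w i))%:Z).
  apply: solve_and => //.
  - by move=> x y w w' E; rewrite E.
  - apply: solve_gt => //; apply: (Tm_ext (Tm_L 0 0 df)) => e; by rewrite addn0 subn0.
  - apply: solve_gt => //; apply: (Tm_ext (Tm_L 0 0 (Tm_opp df))) => e; by rewrite addn0 subn0.
have dN : Solve St (fun x y w => ~ exists c, near_i c x y w).
  apply: solve_not => //; last exact: solve_fin.
  by move=> x y w w' E; split=> -[c Hc]; exists c; apply/(ln c x y w w' E).
have lN : local (sdim St) (fun x y w => ~ exists c, near_i c x y w).
  by move=> x y w w' E; split=> no [c Hc]; apply: no; exists c; apply/(ln c x y w w' E).
have lbig : local (sdim St) (fun _ y w => (r (idx (f y)))%:Z < (r (w i))%:Z /\ (r (idx (- f y)))%:Z < (r (w i))%:Z).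
  by move=> x y w w' E; rewrite E.
have d1 : Solve St (fun x y w => exists c, near_i c x y w /\ 0 < t c y + \sum_(j < (sdim St).+1) B' j (w j)).
  apply: (solve_fin (Q := fun c x y w => near_i c x y w /\ 0 < t c y + \sum_(j < (sdim St).+1) B' j (w j))) => c.
  by apply: solve_and => //; exact: IH'.
have d2 := solve_and wfS lN dN (solve_and wfS lbig dbig
   (solve_const (fun=> ~~ s) wfS)).
have d3 := solve_and wfS lN dN (solve_and wfS _ 
   (solve_not wfS lbig dbig)
   (solve_const (fun y => 0 < f y) wfS)).
have {d3} d3 := d3 ltac:(by move=> x y w w' E; rewrite E).
apply: (solve_ext (solve_or d1 (solve_or d2 d3))).
exists (D0 + K + L)%N => D le dD x y w Hs; have cw := stands_wchain Hs.
have wi := stands_ge Hs Hi.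
have key c : near_i c x y w -> (0 < t c y + \sum_(j < (sdim St).+1) B' j (w j)) =
    (0 < f y + \sum_(j < (sdim St).+1) B j (w j)).
  by move=> Hc; rewrite (sum_zero_at B w Hi) addrA (Ht c y (w i)) //; lia.
rewrite !ltr_r //; case: (classic (exists c, near_i c x y w)) => [[c Hc]|no].
  rewrite -(key c Hc); split; last by move=> H; left; exists c.
  by move=> [[c' [Hc' H]]|[[no]|[no]]]; [rewrite (key c Hc) -(key c' Hc')|case: no; exists c|case: no; exists c].
have nn : ~ near K (w i) (mag (f y)).
  by move=> /near_cover [s' [k [k' E]]]; apply: no; exists (s', k, k').
have rh0 : `|0 : int| <= 0%N%:Z * (r (w (sdim St) + 0).+1)%:Z by rewrite normr0 mul0r.
have B0i j m' : (j < i)%N -> B j m' = 0 by move=> Hj; apply: B0; rewrite /i in Hj; lia.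
have tl := HL D ltac:(lia) w 0 i cw Hi (or_intror erefl) rh0.
rewrite mul0r add0r in tl.
have := HK (w i) _ (f y) D ltac:(lia) ltac:(lia) tl nn.
rewrite -(sum_tail w Hi B0i) -(sum_zero_at B w Hi) => lead.
have E : (mag (f y) < w i)%N <-> (idx (f y) < w i)%N /\ (idx (- f y) < w i)%N.
  rewrite /mag; case: (ger0P (f y)) => Hf.
    have -> : idx (- f y) = 0%N by apply: idx_eq0 => //; have := r_inc 0; lia.
    by split=> [H|[]//]; split=> //; lia.
  have -> : idx (f y) = 0%N by apply: idx_eq0 => //; have := r_inc 0; lia.
  by split=> [H|[]//]; split=> //; lia.
case: ifP lead => Hlt [-> _].
  split; last by move=> H; right; left; split=> //; split=> //; apply/E.
  move=> [[c [Hc _]]|[[_ [_ //]]|[_ [nb _]]]]; first by case: no; exists c.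
  by case: nb; apply/E.
split=> [|H]; last by right; right; split=> //; split=> // /E; rewrite Hlt.
move=> [[c [Hc _]]|[[_ [/E]]|[_ [_ //]]]]; first by case: no; exists c.
by rewrite Hlt.
Qed.

Lemma solve_pos St a f B : wf St -> Tm f -> (forall i, (i <= sdim St)%N -> evop (B i)) ->
  Solve St (fun x y w => 0 < a * x + f y + \sum_(i < (sdim St).+1) B i (w i)).
Proof.
move=> wfS df dB; case: (eqVneq a 0) => [->|a0]; last exact: solve_alpha.
apply: (solve_eqv (solve_alpha0 (m := (sdim St).+1) wfS (leqnn _) df dB _)).
  by move=> j m'; rewrite subnn.
by move=> x y w; rewrite mul0r add0r.
Qed.

(** The constant is the value at one reference index of the class, taken beyond the point from which
    [b] is periodic modulo [m]. *)
Lemma evop_const_mod m b : (m %| M)%N -> evop b -> exists K c, forall n, (K <= n)%N ->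
  in_tilde N d n -> (m %| (b n - c)%R)%Z.
Proof.
move=> mM db; have H k : (N <= k)%N -> (r (k + d) = r k %[mod m])%N.
  by move=> Hk; rewrite -(modn_dvdm _ mM) r_per // modn_dvdm.
have [K HK] := evop_mod_period H db; exists (N + d * K)%N, (b (N + d * K)%N) => n Hn [t Et].
have le : (K <= d * K)%N by apply: leq_pmull.
by apply: HK; rewrite ?Et ?modnMDl; [lia|lia|rewrite ![(N + _)%N]addnC ![(d * _)%N]mulnC !modnMDl].
Qed.

Lemma honest1_dvd m a f : (0 < m)%N -> honest1 (fun x y => (m %| (a * x + f y)%R)%Z).
Proof.
move=> m0; have dd (j : 'I_m) : honest1 (fun x y => (m %| x - j%:Z)%Z).
  have : Def r (fun e => exists z, e 0%N = m%:Z * z + j%:Z).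
    have d1 : Def r (fun e => e 1%N = m%:Z * e 0%N + j%:Z).
      apply: Def_eq; first exact: DefFun_var.
      by apply: DefFun_Tm => //; apply: Tm_add (Tm_cst _ _); apply: Tm_scale; exact: Tm_var.
    exact: (Def_ex d1).
  move/honest_param_free => H; apply: (honest_iff H) => x y.
  split=> [[z ->]|/dvdzP [z Ez]]; first by rewrite addrK dvdz_mulr.
  by exists z; rewrite mulrC -Ez subrK.
have := honest1_fin (fun j => honest1_and (dd j) (honest1_const r (fun y => (m %| (a * j%:Z + f y)%R)%Z))).
move/honest1_iff; apply=> x y.
have E (j : int) : (m %| x - j)%Z -> (m %| (a * x + f y)%R)%Z = (m %| (a * j + f y)%R)%Z.
  move=> Hj; have -> : a * x + f y = a * j + f y + a * (x - j) by ring.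
  by rewrite rpredDr // dvdz_mull.
split=> [[j [Hj]]|H]; first by rewrite -(E _ Hj).
have z0 : 0 <= (x %% m)%Z by apply: modz_ge0; lia.
have zl : (x %% m)%Z < m%:Z by apply: ltz_pmod; lia.
have lt : (`|(x %% m)%Z| < m)%N by lia.
have Hj : (m %| x - (Ordinal lt)%:Z)%Z.
  rewrite /= gez0_abs // {1}(divz_eq x m) addrK; exact: dvdz_mull.
by exists (Ordinal lt); rewrite -E.
Qed.

Lemma solve_dvd St m a f B : wf St -> (m %| M)%N -> (forall i, (i <= sdim St)%N -> evop (B i)) ->
  Solve St (fun x y w => (m %| (a * x + f y + \sum_(i < (sdim St).+1) B i (w i))%R)%Z).
Proof.
move=> wfS mM dB; have m0 : (0 < m)%N by rewrite (dvdn_gt0 M_gt0).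
have H (i : 'I_(sdim St).+1) : exists c K0, forall K, (K0 <= K)%N -> forall n, (K <= n)%N ->
    in_tilde N d n -> (m %| (B i n - c)%R)%Z.
  have [K [c Hc]] := evop_const_mod mM (dB i (ltn_ord i)); exists c, K => K' le n Hn; apply: Hc; lia.
have [c Hc] := fin_choice H; have [K HK] := fin_bound Hc.
have := solve_xy wfS (honest1_dvd a (fun y => f y + \sum_i c i) m0).
move/solve_ext; apply; exists K => D le dD x y w Hs.
have dS : (m %| \sum_(i < (sdim St).+1) (B i (w i) - c i)%R)%Z.
  apply: rpred_sum => i _; apply: (HK K) => //.
    by have := stands_ge Hs (ltn_ord i); lia.
  by case: Hs => -[C _ _] _; apply: C; exact: (ltn_ord i).
have -> : a * x + f y + \sum_(i < (sdim St).+1) B i (w i) = a * x + (f y + \sum_i c i) +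
    \sum_(i < (sdim St).+1) (B i (w i) - c i) by rewrite sumrB; ring.
by rewrite [X in _ <-> is_true X]rpredDr.
Qed.

(* Conditions that are solvable in every state of dimension [n]; see [Cond_solve]. *)
Inductive Cond (n : nat) : pred3 -> Prop :=
| Cond_pos a f (B : nat -> nat -> int) : Tm f -> (forall i, (i <= n)%N -> evop (B i)) ->
    Cond n (fun x y w => 0 < a * x + f y + \sum_(i < n.+1) B i (w i))
| Cond_dvd m a f (B : nat -> nat -> int) : (m %| M)%N -> Tm f -> (forall i, (i <= n)%N -> evop (B i)) ->
    Cond n (fun x y w => (m %| (a * x + f y + \sum_(i < n.+1) B i (w i))%R)%Z)
| Cond_gt i f : (i <= n)%N -> Tm f -> Cond n (fun _ y w => f y < (r (w i))%:Z)
| Cond_const (Q : Prop) : Cond n (fun _ _ _ => Q)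
| Cond_not Q : Cond n Q -> Cond n (fun x y w => ~ Q x y w)
| Cond_and Q Q' : Cond n Q -> Cond n Q' -> Cond n (fun x y w => Q x y w /\ Q' x y w)
| Cond_iff Q Q' : Cond n Q -> (forall x y w, Q x y w <-> Q' x y w) -> Cond n Q'.

Lemma Cond_local n Q : Cond n Q -> local n Q.
Proof.
elim=> {Q} [a f B _ _|m a f B _ _ _|i f Hi _|Q|Q _ IH|Q Q' _ IH _ IH'|Q Q' _ IH HQ] x y w w' E //.
- by rewrite (sum_local B E).
- by rewrite (sum_local B E).
- by rewrite E.
- by rewrite (IH x y w w' E).
- by rewrite (IH x y w w' E) (IH' x y w w' E).
- by rewrite -!HQ; exact: IH.
Qed.

Lemma Cond_solve St Q : wf St -> Cond (sdim St) Q -> Solve St Q.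
Proof.
move=> wfS; elim=> {Q} [a f B df dB|m a f B mM _ dB|i f Hi df|Q|Q dQ IH|Q Q' dQ IH _ IH'|Q Q' _ IH HQ].
- exact: solve_pos.
- exact: solve_dvd.
- exact: solve_gt.
- exact: (solve_const (fun=> Q) wfS).
- exact: (solve_not wfS (Cond_local dQ) IH).
- exact: (solve_and wfS (Cond_local dQ) IH IH').
- exact: (solve_eqv IH HQ).
Qed.

Definition pad (n : nat) (B : nat -> nat -> int) : nat -> nat -> int :=
  fun i m => if (i <= n)%N then B i m else 0.

Lemma pad_ev n B : (forall i, (i <= n)%N -> evop (B i)) -> forall i, evop (pad n B i).
Proof. by move=> H i; rewrite /pad; case: leqP => Hi; [exact: H|exact: evop0]. Qed.

Lemma sum_pad n n' B (w : nat -> nat) : (n <= n')%N ->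
  \sum_(i < n'.+1) pad n B i (w i) = \sum_(i < n.+1) B i (w i).
Proof.
move=> le; rewrite (big_ord_widen n'.+1 (fun i => B i (w i))) // [RHS]big_mkcond /=.
by apply: eq_bigr => i _; rewrite /pad ltnS.
Qed.

Lemma Cond_mono n n' Q : (n <= n')%N -> Cond n Q -> Cond n' Q.
Proof.
move=> le; elim=> {Q} [a f B df dB|m a f B mM df dB|i f Hi df|Q|Q _ IH|Q Q' _ IH _ IH'|Q Q' _ IH HQ].
- apply: (Cond_iff (Cond_pos a df (fun i (_ : (i <= n')%N) => pad_ev dB i))) => x y w.
  by rewrite sum_pad.
- apply: (Cond_iff (Cond_dvd a mM df (fun i (_ : (i <= n')%N) => pad_ev dB i))) => x y w.
  by rewrite sum_pad.
- by apply: Cond_gt => //; apply: leq_trans le.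
- exact: Cond_const.
- exact: Cond_not.
- exact: Cond_and.
- exact: (Cond_iff IH).
Qed.

Lemma Cond_or n Q Q' : Cond n Q -> Cond n Q' -> Cond n (fun x y w => Q x y w \/ Q' x y w).
Proof.
move=> dQ dQ'; apply: (Cond_iff (Cond_not (Cond_and (Cond_not dQ) (Cond_not dQ')))) => x y w.
by split=> H; [apply: NNPP | ]; tauto.
Qed.

Lemma Cond_fin n (I : finType) (Q : I -> pred3) : (forall i, Cond n (Q i)) ->
  Cond n (fun x y w => exists i, Q i x y w).
Proof.
move=> dQ; suff H (s : seq I) : Cond n (fun x y w => exists2 i, i \in s & Q i x y w).
  apply: (Cond_iff (H (enum I))) => x y w; split=> [[i _ Hi]|[i Hi]]; exists i => //.
  by rewrite mem_enum.
elim: s => [|i s IH]; first by apply: (Cond_iff (Cond_const n False)) => x y w; split=> // -[].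
apply: (Cond_iff (Cond_or (dQ i) IH)) => x y w; split.
  by move=> [Hi|[j Hj Pj]]; [exists i; rewrite ?mem_head|exists j; rewrite // inE Hj orbT].
by move=> [j]; rewrite inE => /orP [/eqP->|Hj] Pj; [left|right; exists j].
Qed.

Definition Std (n : nat) (h : int -> env -> (nat -> nat) -> int) : Prop :=
  exists a f B, [/\ Tm f, forall i, (i <= n)%N -> evop (B i) &
    forall x y w, h x y w = a * x + f y + \sum_(i < n.+1) B i (w i)].

Lemma Std_lin n a f : Tm f -> Std n (fun x y _ => a * x + f y).
Proof.
move=> df; exists a, f, (fun _ _ => 0); split=> // [i _|x y w]; first exact: evop0.
by rewrite big1 ?addr0.
Qed.

Lemma Std_y n f : Tm f -> Std n (fun _ y _ => f y).
Proof.
move=> df; have [a [g [B [dg dB E]]]] := Std_lin n 0 df.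
by exists a, g, B; split=> // x y w; rewrite -E mul0r add0r.
Qed.

Lemma Std_w n i b : (i <= n)%N -> evop b -> Std n (fun _ _ w => b (w i)).
Proof.
move=> Hi db; exists 0, (fun=> 0), (fun j m => if j == i then b m else 0).
split=> [|j _|x y w]; [exact: Tm_cst|by case: (j == i); [|exact: evop0]|].
rewrite mul0r !add0r (bigD1 (Ordinal (n := n.+1) (m := i) Hi)) //= eqxx big1 ?addr0 //.
by move=> j /negbTE; rewrite -val_eqE /= => ->.
Qed.

Lemma Std_add n h h' : Std n h -> Std n h' -> Std n (fun x y w => h x y w + h' x y w).
Proof.
move=> [a [f [B [df dB E]]]] [a' [f' [B' [df' dB' E']]]].
exists (a + a'), (fun y => f y + f' y), (fun i m => B i m + B' i m); split.
- exact: Tm_add.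
- by move=> i Hi; apply: evopD; [exact: dB|exact: dB'].
- by move=> x y w; rewrite E E' big_split /=; ring.
Qed.

Lemma Std_scale n c h : Std n h -> Std n (fun x y w => c * h x y w).
Proof.
move=> [a [f [B [df dB E]]]]; exists (c * a), (fun y => c * f y), (fun i m => c * B i m); split.
- exact: Tm_scale.
- by move=> i Hi; apply: evopZ; exact: dB.
- by move=> x y w; rewrite E -mulr_sumr; ring.
Qed.

Lemma Std_mono n n' h : (n <= n')%N -> Std n h -> Std n' h.
Proof.
move=> le [a [f [B [df dB E]]]]; exists a, f, (pad n B); split=> // [i _|x y w].
  exact: pad_ev.
by rewrite sum_pad.
Qed.

Lemma Std_local n h x y w w' : Std n h -> (forall i, (i <= n)%N -> w i = w' i) -> h x y w = h x y w'.
Proof. by move=> [a [f [B [_ _ E]]]] Ew; rewrite !E (sum_local B Ew). Qed.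

Lemma Cond_lt n h h' : Std n h -> Std n h' -> Cond n (fun x y w => h x y w < h' x y w).
Proof.
move=> dh dh'; have [a [f [B [df dB E]]]] := Std_add dh' (Std_scale (-1) dh).
apply: (Cond_iff (Cond_pos a df dB)) => x y w; rewrite -E mulN1r subr_gt0 //.
Qed.

Lemma Cond_le n h h' : Std n h -> Std n h' -> Cond n (fun x y w => h x y w <= h' x y w).
Proof.
move=> dh dh'; apply: (Cond_iff (Cond_not (Cond_lt dh' dh))) => x y w.
by rewrite leNgt; split=> /negP.
Qed.

Lemma Cond_idx n h (q : env -> (nat -> nat) -> nat) : Std n h -> Std n (fun _ y w => (r (q y w))%:Z) ->
  Std n (fun _ y w => (r (q y w).+1)%:Z) -> Cond n (fun x y w => idx (h x y w) = q y w).
Proof.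
move=> dh dq dq1; have d0 : Std n (fun _ _ _ => (r 0%N)%:Z) := Std_y n (Tm_cst r (r 0%N)%:Z).
apply: (Cond_iff (Cond_and (Cond_lt dh dq1) (Cond_or (Cond_le dq dh) (Cond_le dq d0)))) => x y w.
by rewrite idxP.
Qed.

Lemma Cond_idx_w n h i k k' : Std n h -> (i <= n)%N ->
  Cond n (fun x y w => idx (h x y w) = (w i + k - k')%N).
Proof.
move=> dh Hi; apply: (Cond_idx (q := fun _ w => (w i + k - k')%N)) => //.
  exact: (Std_w (b := fun m => (r (m + k - k')%N)%:Z) Hi (evop_comp k k' (evopr r))).
exact: (Std_w (b := fun m => (r (m + k - k').+1)%:Z) Hi (evop_comp k k' (evopr1 r))).
Qed.

Lemma Cond_idx_y n h f k k' : Std n h -> Tm f ->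
  Cond n (fun x y w => idx (h x y w) = (idx (f y) + k - k')%N).
Proof.
move=> dh df; apply: (Cond_idx (q := fun y _ => (idx (f y) + k - k')%N)) => //.
  exact: (Std_y n (Tm_L k k' df)).
apply: Std_y; apply: Tm_ext (Tm_L 1 0 (Tm_L k k' df)) _ => e.
by rewrite idx_r // addn1 subn0.
Qed.

Lemma Cond_near n i f k k' : (i <= n)%N -> Tm f ->
  Cond n (fun _ y w => w i = (idx (f y) + k - k')%N).
Proof.
move=> Hi df; apply: (Cond_iff (Cond_idx_y k k' (Std_w Hi (evopr r)) df)) => x y w.
by rewrite idx_r.
Qed.

Lemma Cond_core St : wf St -> Cond (sdim St) (core St).
Proof.
move=> [c0 dg dA k0].
have dr : Std (sdim St) (rho St).
  exists (scoef St), (fun y => - sbase St y), (fun i m => if (i < sdim St)%N then - sops St i m else 0).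
  split; first exact: Tm_opp.
    move=> i _; case: ltnP => Hi; last exact: evop0.
    by apply: evopN; case: (dA i Hi).
  move=> x y w; rewrite /rho big_ord_recr /= ltnn addr0 -sumrN; congr (_ + _).
  by apply: eq_bigr => i _; rewrite ltn_ord.
have dt b : evop b -> Std (sdim St) (fun _ _ w => (smult St)%:Z * b (w (sdim St) + soff St)%N).
  move=> db; apply: (Std_w (b := fun m => (smult St)%:Z * b (m + soff St)%N)) => //.
  by apply: evopZ; exact: evop_shift.
exact: (Cond_and (Cond_lt (dt _ (evopr r)) dr) (Cond_le dr (dt _ (evopr1 r)))).
Qed.

(** The longer expansions keep the fixed gap [D1], while the gap [D] of [St] stays free. Dropping
    the new coordinate gives an expansion of [St] with gap [D1], and uniqueness at that gap
    identifies it with the one of gap [D]. *)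
Lemma solve_refine St (I : finType) (S' : I -> state) (Q' : I -> pred3) D1 : wf St ->
  (forall i, honest1 (fun x y => exists w, stands (S' i) D1 x y w /\ Q' i x y w)) ->
  (forall i, sdim (S' i) = (sdim St).+1) -> (forall i x y w, Q' i x y w -> core St x y w) ->
  (forall x y w w', stands St D1 x y w -> stands St D1 x y w' -> forall i, (i <= sdim St)%N -> w i = w' i) ->
  Solve St (fun x y w => exists i, stands (S' i) D1 x y w /\ Q' i x y w).
Proof.
move=> wfS HC Hdim Hcore U; have [D0 H0] := solve_true wfS.
exists (D0 + D1)%N => D le dD.
apply: (honest1_iff (honest1_and (H0 D ltac:(lia) dD) (honest1_fin HC))) => x y.
split=> [[[w [Hs _]] [i [w' [Hs' HQ]]]]|[w [Hs [i [Hs' HQ]]]]]; last first.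
  by split; [exists w|exists i, w].
exists w'; split; last by exists i.
have Hs1 : stands St D1 x y w'.
  split; last exact: Hcore HQ.
  have [[C [c1 c2] b] _] := Hs'; rewrite Hdim in C c1 c2 b.
  have c3 := c1 (sdim St) (leqnn _).
  split=> [i0 Hi0||]; [by apply: C; exact: leqW|split=> [i0 Hi0|]; [by apply: c1; exact: leqW|lia]|lia].
apply: (local_imp (@stands_local St D) _ Hs).
by apply: (U x y) => //; apply: stands_mono Hs; lia.
Qed.

Lemma mag_add_bound : exists G, forall u v m, (mag u <= m)%N -> (mag v <= m)%N -> (mag (u + v) <= m + G)%N.
Proof.
have [G HG] := doubling r_inc r_sparse; exists G => u v m Hu Hv; apply: mag_leP => //.
have a := mag_lt r_inc u; have b := mag_lt r_inc v; have c := HG m.+1.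
have : (r (mag u).+1)%:Z <= (r m.+1)%:Z by rewrite ler_r.
have : (r (mag v).+1)%:Z <= (r m.+1)%:Z by rewrite ler_r.
rewrite addSn in c; lia.
Qed.

Lemma mag0 : mag 0 = 0%N.
Proof. by rewrite /mag normr0; apply: idx_eq0 => //; have := r_inc 0; lia. Qed.

(** * Locating the index of a standard function *)

Section Step.
Variables (St : state) (E0 : pred3) (P : int -> env -> Prop) (h : int -> env -> (nat -> nat) -> int).
Hypothesis wfS : wf St.
Local Notation n := (sdim St).
Local Notation c := (scoef St).
Hypothesis dh : Std n h.
Local Notation sub E := (forall x y w, E x y w -> E0 x y w).
Local Notation goal S E := (Solve S (fun x y w => E x y w /\ P x y)).
Hypothesis H1 : forall E j k k', Cond n E -> sub E -> (j <= n)%N ->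
  (forall x y w, E x y w -> idx (h x y w) = (w j + k - k')%N) -> goal St E.
Hypothesis H2 : forall E f k k', Cond n E -> sub E -> Tm f ->
  (forall x y w, E x y w -> idx (h x y w) = (idx (f y) + k - k')%N) -> goal St E.
Hypothesis H3 : forall St' E k k', wf St' -> sdim St' = n.+1 -> Cond n.+1 E -> sub E ->
  (forall x y w, E x y w -> idx (h x y w) = (w n.+1 + k - k')%N) -> goal St' E.

(** The first two alternatives split into finitely many equations for [idx h]; each is added to [E]
    and passed to the continuation [H1] or [H2]. The third alternative, a longer expansion, has been
    solved beforehand as [Qx]. *)
Lemma cover_idx E (J : finType) (F : J -> env -> int) K (Qx : pred3) : Cond n E -> sub E ->
  (forall i, Tm (F i)) -> Solve St Qx -> (forall x y w, Qx x y w -> E x y w /\ P x y) ->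
  (exists D1, forall D, (D1 <= D)%N -> (d %| D)%N -> forall x y w, stands St D x y w -> E x y w -> P x y ->
     [\/ exists2 j, (j <= n)%N & near K (idx (h x y w)) (w j),
         exists i, near K (idx (h x y w)) (mag (F i y)) |
         exists w', stands St D x y w' /\ Qx x y w']) ->
  goal St E.
Proof.
move=> dE sE dF dQx HQx [D1 cov].
have a1 (i : 'I_n.+1 * 'I_K.+1 * 'I_K.+1) :
    goal St (fun x y w => E x y w /\ idx (h x y w) = (w i.1.1 + i.1.2 - i.2)%N).
  have Hj : (i.1.1 <= n)%N by rewrite -ltnS.
  apply: (H1 (j := i.1.1) (k := i.1.2) (k' := i.2)) => // [|x y w []//|x y w []//].
    by apply: Cond_and => //; exact: Cond_idx_w.
  by move=> /sE.
have a2 (i : J * bool * 'I_K.+1 * 'I_K.+1) :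
    goal St (fun x y w => E x y w /\ idx (h x y w) = (idx ((-1) ^+ i.1.1.2 * F i.1.1.1 y) + i.1.2 - i.2)%N).
  have dS := Tm_sg i.1.1.2 (dF i.1.1.1).
  apply: (H2 (f := fun y => (-1) ^+ i.1.1.2 * F i.1.1.1 y) (k := i.1.2) (k' := i.2)) => // [|x y w []//|x y w []//].
    by apply: Cond_and => //; exact: Cond_idx_y.
  by move=> /sE.
apply: (solve_iff (solve_or (solve_fin a1) (solve_or (solve_fin a2) dQx))).
exists D1 => D le dD x y; split=> -[w [Hs]].
  move=> [[i [[? _] ?]]|[[i [[? _] ?]]|Hq]]; [by exists w|by exists w|].
  by exists w; split=> //; exact: HQx.
move=> [HE HP]; case: (cov D le dD x y w Hs HE HP) => [[j Hj /nearP [k [k' Ek]]]|[i]|[w' [Hs' Hq]]].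
- by exists w; split=> //; left; exists (Ordinal (n := n.+1) (m := j) Hj, k, k').
- move=> Hn; exists w; split=> //; right; left.
  by have [s [k [k' Ek]]] := near_cover Hn; exists (i, s, k, k').
- by exists w'; split=> //; right; right.
Qed.

Lemma rho_abs D x y w : stands St D x y w ->
  `|rho St x y w| <= (smult St)%:Z * (r (w n + soff St).+1)%:Z.
Proof.
move=> [_ [lo hi]]; rewrite ger0_norm //; apply: le_trans (ltW lo); exact: mulr_ge0.
Qed.

(** Multiplying [h] by the coefficient [c] of [x] lets [x] be replaced by the remainder without
    division. *)
Definition relation E (a : int) (f : env -> int) (B : nat -> nat -> int) :=
  exists D1, forall D, (D1 <= D)%N -> (d %| D)%N -> forall x y w, stands St D x y w -> E x y w ->
    c * h x y w = a * rho St x y w + f y + \sum_(j < n.+1) B j (w j).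

Lemma solve_False S : wf S -> Solve S (fun _ _ _ => False).
Proof. by move=> w; exact: (solve_const (fun=> False) w). Qed.

Lemma coef_near : exists K, forall u, near K (mag u) (mag (c * u)).
Proof.
have [c0 _ _ _] := wfS; have [K HK] := near_mul r_inc r_sparse c0.
by exists K => u; apply: near_sym.
Qed.

Lemma idx_near K u m : near K (mag u) m -> idx u = 0%N \/ near K (idx u) m.
Proof. by case: (idx_mag r_inc u) => [|[_ ->]]; [left|right]. Qed.

(** The expansion whose remainder is [c h = a rho + f + b (w n)], see [rho_next]. The sign [i.1]
    makes the remainder positive; the offset [i.2] is the residue of its size modulo [d]. *)
Definition next_state (a : int) (f : env -> int) (b : nat -> int) (i : bool * 'I_d) : state :=
  State n.+1 ((-1) ^+ i.1 * (a * c)) (fun y => (-1) ^+ i.1 * (a * sbase St y - f y))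
    (fun j m => if (j < n)%N then (-1) ^+ i.1 * (a * sops St j m) else (-1) ^+ i.1 * - b m)
    i.2 1.

Lemma rho_next a f b i x y w :
  rho (next_state a f b i) x y w = (-1) ^+ i.1 * (a * rho St x y w + f y + b (w n)).
Proof.
rewrite /rho /= big_ord_recr /= ltnn.
have -> : \sum_(j < n) (if (j < n)%N then (-1) ^+ i.1 * (a * sops St j (w j)) else (-1) ^+ i.1 * - b (w j))
   = (-1) ^+ i.1 * (a * \sum_(j < n) sops St j (w j)).
  by rewrite !mulr_sumr; apply: eq_bigr => j _; rewrite ltn_ord.
ring.
Qed.

Lemma evop_scale_nz k b : k != 0 -> evop b /\ ~ evzero b ->
  evop (fun m => k * b m) /\ ~ evzero (fun m => k * b m).
Proof.
move=> k0 [db nz]; split; first exact: evopZ.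
move=> [K HK]; apply: nz; exists K => m /HK /eqP; rewrite mulf_eq0 (negbTE k0) => /eqP //.
Qed.

Lemma next_wf a f b i : a != 0 -> Tm f -> evop b -> ~ evzero b -> wf (next_state a f b i).
Proof.
have s0 : (-1) ^+ i.1 != 0 :> int by rewrite expf_neq0.
move=> a0 df db nz; have [c0 dg dA k0] := wfS; split=> //=.
- by rewrite !mulf_neq0.
- by apply: Tm_scale; apply: Tm_add; [exact: Tm_scale|exact: Tm_opp].
move=> j _; case: (ltnP j n) => Hj.
  have := evop_scale_nz (k := (-1) ^+ i.1 * a) _ (dA j Hj); rewrite mulf_neq0 // => /(_ isT) [e z].
  split; first by apply: (evop_eq (K := 0)) e => m _; rewrite mulrA.
  by move=> [K HK]; apply: z; exists K => m /HK <-; rewrite mulrA.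
have := evop_scale_nz (k := - (-1) ^+ i.1) _ (conj db nz); rewrite oppr_eq0 => /(_ s0) [e z].
split; first by apply: (evop_eq (K := 0)) e => m _; rewrite mulNr mulrN.
by move=> [K HK]; apply: z; exists K => m /HK <-; rewrite mulNr mulrN.
Qed.

(* Unless c h is comparable with f or with w n, it is the remainder of a longer expansion,
   whose new coordinate w n.+1 is comparable with h. *)
Lemma step_extend E a f b : a != 0 -> Cond n E -> sub E -> Tm f -> evop b -> ~ evzero b ->
  (exists D1, forall D, (D1 <= D)%N -> (d %| D)%N -> forall x y w, stands St D x y w -> E x y w ->
    c * h x y w = a * rho St x y w + f y + b (w n)) ->
  goal St E.
Proof.
move=> a0 dE sE df db nz [D1 rel].
have [Kc HKc] := coef_near; have [G HG] := mag_add_bound; have [G1 HG1] := near_sum r_inc r_sparse.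
have [Kb Hb] := near_evop r_inc r_sparse db nz.
have [Ka Ha] := near_mul r_inc r_sparse a0.
have [Kk HKk] := mul_bound r_inc r_sparse (smult St).
(* [K2] bounds the distance from [idx h] to the new coordinate: [Kc] for the factor [c], [d] for
   rounding to the class, 1 for the passage to [|v| - 1] below. *)
pose S' := next_state a f b; pose K2 := (Kc + d + 1)%N.
pose E' (i : bool * 'I_d * 'I_K2.+1 * 'I_K2.+1) (x : int) (y : env) (w : nat -> nat) :=
  (E x y w /\ core St x y w) /\ idx (h x y w) = (w n.+1 + i.1.2 - i.2)%N.
have wfS' i : wf (S' i) by exact: next_wf.
have solved i : goal (S' i.1.1) (E' i).
  apply: (H3 (k := i.1.2) (k' := i.2)) => // [|x y w [[/sE]]//|x y w []//].
  apply: Cond_and; last by apply: Cond_idx_w => //; exact: Std_mono dh.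
  by apply: Cond_mono (leqnSn _) _; apply: Cond_and => //; exact: Cond_core.
have [D2 HD2] := fin_bound solved.
have [D3 U] := stands_uniq r_inc r_sparse N d wfS.
(* The gap of the longer expansions is fixed here, after their continuations have been solved and
   before the gap of [St] is chosen. *)
pose D' := (d * (D1 + D2 + D3 + Kb + 1))%N.
have D'ge : (D1 + D2 + D3 + Kb + 1 <= D')%N by apply: leq_pmull.
have dD' : (d %| D')%N by apply: dvdn_mulr.
pose Q' i (x : int) (y : env) (w : nat -> nat) := E' i x y w /\ P x y.
have dQx := solve_refine (S' := fun i => S' i.1.1) (Q' := Q') wfS
  (fun i => HD2 D' ltac:(lia) i dD') (fun i => erefl) (fun i x y w H => H.1.1.2) (U D' ltac:(lia)).
set Qx := (fun x y w => exists i, _) in dQx.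
pose K4 := (Kk + soff St + Ka + Kb + G + G + G1 + D' + Kc + d + N + D' + 2)%N.
apply: (cover_idx (J := bool) (F := fun i y => if i then f y else 0) (K := (K4 + K4 + Kc)%N) dE sE _ dQx).
- by case=> //; exact: Tm_cst.
- by move=> x y w [i [_ [[[]]]]].
exists (D1 + D' + Kb)%N => D le dD x y w Hs HE HP.
have {rel} rel := rel D ltac:(lia) dD x y w Hs HE.
set v := c * h x y w in rel; have nv := HKc (h x y w); rewrite -/v in nv.
have wn := stands_ge Hs (leqnn _).
have nb := Hb (w n) ltac:(lia).
have nr : (mag (rho St x y w) <= w n + soff St + Kk + 1)%N.
  apply: mag_leP => //; apply: le_lt_trans (rho_abs Hs) _; apply: le_lt_trans (HKk _) _.
  by rewrite ltr_r //; lia.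
have na := Ha (rho St x y w).
have nab : (mag (a * rho St x y w + b (w n)) <= w n + (soff St + Kk + 1 + Ka + Kb) + G)%N.
  by apply: HG; move: na nb nr; rewrite /near; lia.
case: (idx_mag r_inc (h x y w)) => [i0|[hpos ih]].
  by apply: Or32; exists false; rewrite i0 mag0 /near; lia.
have {rel} rel : v = f y + (a * rho St x y w + b (w n)) by rewrite rel; ring.
case: (leqP (mag (a * rho St x y w + b (w n)) + G1) (mag (f y))) => [/HG1 [nf _]|lt].
  apply: Or32; exists true; rewrite ih; rewrite -rel in nf.
  by apply: nearW (near_trans nv nf); lia.
have vub : (mag v <= w n + (soff St + Kk + 1 + Ka + Kb + G + G1) + G)%N by rewrite rel; apply: HG; lia.
(* If [v] is neither close below [w n] or larger, nor bounded, then a new coordinate fits with gap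
   [D'] below [w n] and above [N + 2 * D']. *)
case: (leqP (w n) (mag v + D' + d + 1)) => [ge|far].
  by apply: Or31; exists n => //; rewrite ih; move: nv; rewrite /near; lia.
case: (leqP (mag v) (N + 2 * D' + d + 1)) => [small|big].
  by apply: Or32; exists false; rewrite ih mag0; move: nv; rewrite /near; lia.
(* The lower bound in [core] is strict and the upper one weak, so the relevant index is that of
   [|v| - 1]. It is rounded down to the class of [N] modulo [d]; what is lost becomes the offset. *)
apply: Or33; pose t := (v < 0); pose q := idx (`|v| - 1).
have vabs : (-1) ^+ t * v = `|v| by rewrite /t; case: (ltrP v 0) => Hv; rewrite ?expr0 ?expr1; lia.
have vge := mag_le r_inc (u := v) ltac:(lia).
have vlt := mag_lt r_inc v.
have qhi : (q <= mag v)%N by rewrite -ltnS -(ltr_r r_inc); apply: le_lt_trans (idx_le _) _; have := ltr_r r_inc 0 (mag v); lia.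
have qlo : ((mag v).-1 <= q)%N.
  by apply: idx_ge => //; have := ltr_r r_inc (mag v).-1 (mag v); lia.
have qle : (r q)%:Z < `|v|.
  have := @idx_le r (`|v| - 1); have := ltr_r r_inc 0 (mag v); rewrite -/q; lia.
have qlt : `|v| <= (r q.+1)%:Z by have := idx_lt r_inc (`|v| - 1); rewrite -/q; lia.
have qN : (N + 2 * D' <= q)%N by clear - qlo big; lia.
have [s0 [u [slt qE]]] : exists s0 u, (s0 < d)%N /\ (q = N + d * u + s0)%N.
  exists ((q - N) %% d)%N, ((q - N) %/ d)%N; split; first by rewrite ltn_mod.
  rewrite mulnC -addnA -divn_eq subnKC //; exact: leq_trans (leq_addr _ _) qN.
pose w1 i := if i == n.+1 then (N + d * u)%N else w i.
have w1E i : (i <= n)%N -> w1 i = w i by move=> Hi; rewrite /w1 ltn_eqF.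
have w1n : w1 n.+1 = (N + d * u)%N by rewrite /w1 eqxx.
have hE : h x y w1 = h x y w by apply: Std_local dh _.
have [k [k' Ek]] : exists k k' : 'I_K2.+1, idx (h x y w1) = (w1 n.+1 + k - k')%N.
  apply: nearP; rewrite hE ih w1n; move: nv; rewrite /near /K2.
  clear - qE slt qhi qlo; lia.
exists w1; split.
  by apply: (local_imp (@stands_local St D) _ Hs) => i Hi; rewrite w1E.
exists (t, Ordinal slt, k, k'); split; last first.
  split=> //; split=> //; split.
    by apply: (local_imp (Cond_local dE) _ HE) => i Hi; rewrite w1E.
  by apply: (local_imp (@core_local St) _ (proj2 Hs)) => i Hi; rewrite w1E.
have [[C [c1 c2] cb] _] := Hs.
split; last first.
  have rw : rho St x y w1 = rho St x y w by apply: rho_local => i Hi; rewrite w1E.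
  rewrite /core rho_next /= (w1E n (leqnn _)) rw.
  have -> : a * rho St x y w + f y + b (w n) = v by rewrite rel; ring.
  by rewrite vabs w1n !mul1r -qE.
have low : (N + 2 * D' <= N + d * u)%N by clear - qlo big qE slt; lia.
split=> /=.
- move=> i; rewrite leq_eqVlt => /orP [/eqP ->|Hi]; first by rewrite w1n; eexists.
  by rewrite w1E //; exact: C.
- split; last by rewrite w1n; clear - low; lia.
  move=> i; rewrite ltnS leq_eqVlt => /orP [/eqP ->|Hi].
    by rewrite w1n w1E //; clear - qE qhi far; lia.
  by rewrite !w1E; [have := c1 i Hi; clear - le; lia|exact: ltnW|].
by rewrite w1n.
Qed.

(** Induction on the coordinates not yet removed. A leading coordinate comparable with [f] becomes a
    parameter term and is absorbed into [f]; otherwise [c h] is comparable with that coordinate,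
    with [f], or is bounded. At the last coordinate with [a != 0] the remainder has the size of
    [w n] and may cancel against [B n], so the expansion may have to be extended. *)
Lemma step_rec m E a f B : Cond n E -> sub E -> (m <= n.+1)%N -> (a != 0 -> (0 < m)%N) ->
  Tm f -> (forall i, (i <= n)%N -> evop (B i)) ->
  (forall j m', (j < n.+1 - m)%N -> B j m' = 0) -> relation E a f B -> goal St E.
Proof.
elim: m E f B => [|m IH] E f B dE sE Hm Ha df dB B0 [D1 rel].
  have a0 : a = 0 by case: (eqVneq a 0) => // /Ha.
  have [K HK] := coef_near.
  apply: (cover_idx (J := bool) (F := fun i y => if i then f y else 0) (K := K) dE sE _ (solve_False wfS)) => //.
    by case=> //; exact: Tm_cst.
  exists D1 => D le dD x y w Hs HE HP; apply: Or32.
  have := rel D le dD x y w Hs HE; rewrite a0 mul0r add0r big1 ?addr0; last first.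
    by move=> i _; rewrite B0 // subn0.
  move=> Ef; have := HK (h x y w); rewrite Ef => /idx_near [->|Hn]; last by exists true.
  by exists false; rewrite mag0.
pose i := (n - m)%N; have Hi : (i <= n)%N by rewrite /i; lia.
pose B' := zero_at i B; have dB' := zero_at_ev i dB.
have B0i j m' : (j < i)%N -> B j m' = 0 by move=> Hj; apply: B0; rewrite /i in Hj; lia.
have B0' j m' : (j < n.+1 - m)%N -> B' j m' = 0.
  by rewrite /B' /zero_at; case: eqP => // ne Hj; apply: B0i; rewrite /i in ne *; lia.
pose near_i K (t : bool * 'I_K.+1 * 'I_K.+1) (x : int) (y : env) (w : nat -> nat) :=
  w i = (idx ((-1) ^+ t.1.1 * f y) + t.1.2 - t.2)%N.
have dnear K (t : bool * 'I_K.+1 * 'I_K.+1) : Cond n (near_i K t).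
  by apply: Cond_near => //; exact: Tm_sg.
have dN K : Cond n (fun x y w => exists t, near_i K t x y w) := Cond_fin (dnear K).
have split_near K : (forall t, goal St (fun x y w => E x y w /\ near_i K t x y w)) ->
    goal St (fun x y w => E x y w /\ ~ exists t, near_i K t x y w) -> goal St E.
  move=> Ht Hno; apply: (solve_eqv (solve_or (solve_fin Ht) Hno)) => x y w.
  split=> [[[t [[? _] ?]]|[[? _] ?]]//|[HE HP]].
  by case: (classic (exists t, near_i K t x y w)) => [[t Hn]|no]; [left; exists t|right].
have nnear K x y w : (~ exists t, near_i K t x y w) -> ~ near K (w i) (mag (f y)).
  by move=> no /near_cover [s [k [k' Ek]]]; apply: no; exists (s, k, k').
have sE' (E2 : pred3) : sub (fun x y w => E x y w /\ E2 x y w) by move=> x y w [/sE].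
have [Kc HKc] := coef_near.
case: (classic ((i < n)%N \/ a = 0)) => [lead_case|last_case].
  have Ha' : a != 0 -> (0 < m)%N.
    by case: lead_case => [|->]; rewrite ?eqxx //; rewrite /i; lia.
  case: (classic (evzero (B i))) => [[K HK]|nz].
    apply: (IH E f B' dE sE (ltnW Hm) Ha' df dB' B0'); exists (D1 + K)%N => D le dD x y w Hs HE.
    rewrite (rel D ltac:(lia) dD x y w Hs HE) (sum_zero_at B w Hi) HK ?add0r //.
    by have := stands_ge Hs Hi; lia.
  have [L HL] := tail_mag r_inc r_sparse a (smult St) (soff St) dB.
  have [s [K HK]] := lead r_inc r_sparse L (dB i Hi) nz.
  apply: (split_near K) => [t0|].
    have [D0 [t [dt Ht]]] := elim_coord K (dB i Hi) df.
    apply: (IH _ (t t0) B' (Cond_and dE (dnear K t0)) (sE' _) (ltnW Hm) Ha' (dt t0) dB' B0').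
    exists (D0 + D1)%N => D le dD x y w Hs [HE Hn].
    rewrite (rel D ltac:(lia) dD x y w Hs HE) (sum_zero_at B w Hi) (Ht t0 y (w i)) //; first ring.
    by have := stands_ge Hs Hi; lia.
  apply: (cover_idx (J := bool) (F := fun i y => if i then f y else 0) (K := (Kc + K)%N)
    (Cond_and dE (Cond_not (dN K))) (sE' _) _ (solve_False wfS)) => //.
    by case=> //; exact: Tm_cst.
  exists (D1 + K + L)%N => D le dD x y w Hs [HE no] HP.
  have wi := stands_ge Hs Hi.
  have tl := HL D ltac:(lia) w _ i (stands_wchain Hs) Hi lead_case (rho_abs Hs).
  have := HK (w i) _ (f y) D ltac:(lia) ltac:(lia) tl (nnear K x y w no).
  have -> : f y + (B i (w i) + (a * rho St x y w + \sum_(j < n.+1) (if (i < j)%N then B j (w j) else 0))) =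
      c * h x y w.
    by rewrite (rel D ltac:(lia) dD x y w Hs HE) (sum_zero_at B w Hi) (sum_tail w Hi B0i); ring.
  move=> ld; have nv := HKc (h x y w).
  case: ifP ld => _ [_ nn].
    case: (idx_near (near_trans nv nn)) => [->|Hn]; last by apply: Or31; exists i.
    by apply: Or32; exists false; rewrite mag0.
  apply: Or32; case: (idx_near (near_trans nv nn)) => [->|Hn]; last by exists true.
  by exists false; rewrite mag0.
have a0 : a != 0 by apply/eqP => a0; apply: last_case; right.
have Ei : i = n by apply/eqP; rewrite eqn_leq Hi leqNgt; apply/negP => lt; apply: last_case; left.
have sumB (w : nat -> nat) : \sum_(j < n.+1) B j (w j) = B n (w n).
  rewrite (sum_zero_at B w (leqnn _)) big1 ?addr0 // => j _.
  rewrite /zero_at; case: eqP => // ne; apply: B0i; rewrite Ei; have := ltn_ord j; lia.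
case: (classic (evzero (B n))) => [[K HK]|nz]; last first.
  apply: (step_extend a0 dE sE df (dB n (leqnn _)) nz); exists D1 => D le dD x y w Hs HE.
  by rewrite (rel D le dD x y w Hs HE) sumB.
have rel0 : exists D1, forall D, (D1 <= D)%N -> (d %| D)%N -> forall x y w, stands St D x y w ->
    E x y w -> c * h x y w = a * rho St x y w + f y.
  exists (D1 + K)%N => D le dD x y w Hs HE.
  rewrite (rel D ltac:(lia) dD x y w Hs HE) sumB HK ?addr0 //.
  by have := stands_ge Hs (leqnn _); lia.
have [D2 {}rel] := rel0.
have [Ka HKa] := near_mul r_inc r_sparse a0; have [G HG] := near_sum r_inc r_sparse.
have [Kk HKk] := mul_bound r_inc r_sparse (smult St).
pose K3 := (Ka + soff St + Kk + 2)%N; pose K5 := (K3 + G)%N.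
apply: (split_near K5) => [t0|].
  have dl := Tm_L t0.1.2 t0.2 (Tm_sg t0.1.1 df).
  (* Here [w n] is tied to [f] and equals a parameter index. Subtracting that element of R from [f]
     and adding it back as [r (w n)] supplies the nonzero operator which a new coordinate
     requires. *)
  apply: (step_extend (f := fun y => f y - (r (idx ((-1) ^+ t0.1.1 * f y) + t0.1.2 - t0.2)%N)%:Z)
    (b := fun m => (r m)%:Z) a0 (Cond_and dE (dnear K5 t0)) (sE' _)).
  - exact: Tm_add df (Tm_opp dl).
  - exact: evopr.
  - move=> [K' /(_ K'.+1 (leqnSn _))]; have := r_ge r_inc K'.+1; lia.
  exists D2 => D le dD x y w Hs [HE Hn]; rewrite (rel D le dD x y w Hs HE).
  by move: Hn; rewrite /near_i Ei => ->; ring.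
apply: (cover_idx (J := bool) (F := fun i y => if i then f y else 0) (K := (Kc + G + K3)%N)
    (Cond_and dE (Cond_not (dN K5))) (sE' _) _ (solve_False wfS)) => //.
  by case=> //; exact: Tm_cst.
exists D2 => D le dD x y w Hs [HE no] HP.
have nn := nnear K5 x y w no; rewrite Ei in nn.
have nr : near K3 (mag (a * rho St x y w)) (w n).
  have na := HKa (rho St x y w).
  have up : (mag (rho St x y w) <= w n + soff St + Kk + 1)%N.
    apply: mag_leP => //; apply: le_lt_trans (rho_abs Hs) _; apply: le_lt_trans (HKk _) _.
    by rewrite ltr_r //; lia.
  have lo : (w n <= mag (rho St x y w))%N.
    apply: mag_ge => //; have [_ [lo _]] := Hs; have [_ _ _ k0] := wfS.
    apply: le_trans (ler_norm _); apply: le_trans (ltW lo).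
    apply: (@le_trans _ _ (r (w n + soff St)%N)%:Z); first by rewrite ler_r // leq_addr.
    by apply: ler_peMl => //; lia.
  by move: na; rewrite /near /K3; lia.
have nv := HKc (h x y w); rewrite (rel D le dD x y w Hs HE) in nv.
case: (leqP (mag (a * rho St x y w)) (mag (f y))) => cmp.
  have [n1 _] := HG (f y) (a * rho St x y w) ltac:(move: nr nn; rewrite /near /K5; lia).
  rewrite [a * _ + _]addrC in nv.
  case: (idx_near (near_trans nv n1)) => [->|Hn]; apply: Or32.
    by exists false; rewrite mag0.
  by exists true; apply: nearW Hn; lia.
have [n1 _] := HG (a * rho St x y w) (f y) ltac:(move: nr nn; rewrite /near /K5; lia).
case: (idx_near (near_trans nv (near_trans n1 nr))) => [->|Hn].
  by apply: Or32; exists false; rewrite mag0.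
by apply: Or31; exists n => //; apply: nearW Hn; lia.
Qed.

Lemma step : Cond n E0 -> goal St E0.
Proof.
move=> dE0; have [a [f [B [df dB Eh]]]] := dh.
have [c0 dg dA k0] := wfS.
(* These are the coefficients of [c h] after [c x] is written as base, operators and remainder. *)
pose B1 j (m : nat) := if (j < n)%N then c * B j m + a * sops St j m else c * B j m.
apply: (@step_rec n.+1 E0 a (fun y => c * f y + a * sbase St y) B1) => //.
- by apply: Tm_add; apply: Tm_scale.
- move=> j Hj; rewrite /B1; case: ltnP => Hjn; last by apply: evopZ; exact: dB.
  by apply: evopD; apply: evopZ; [exact: dB|case: (dA j Hjn)].
- by move=> j m; rewrite subnn.
exists 0%N => D _ _ x y w _ _; rewrite Eh /rho big_ord_recr [in RHS]big_ord_recr /= {2}/B1 ltnn.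
have -> : \sum_(j < n) B1 j (w j) = c * (\sum_(j < n) B j (w j)) + a * \sum_(j < n) sops St j (w j).
  by rewrite !mulr_sumr -big_split /=; apply: eq_bigr => j _; rewrite /B1 ltn_ord.
ring.
Qed.

End Step.

(* Every term in x and the parameters becomes a standard function after refining the state. *)
Definition tame (F : int -> env -> int) := forall St E P, wf St -> Cond (sdim St) E ->
  (forall St' E' h, wf St' -> (sdim St <= sdim St')%N -> Cond (sdim St') E' ->
    (forall x y w, E' x y w -> E x y w) -> Std (sdim St') h ->
    (forall x y w, E' x y w -> F x y = h x y w) ->
    Solve St' (fun x y w => E' x y w /\ P x y)) ->
  Solve St (fun x y w => E x y w /\ P x y).

Lemma tame_std F : (forall n, Std n (fun x y _ => F x y)) -> tame F.
Proof. by move=> dF St E P wfS dE; apply. Qed.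

Lemma tame_Tm t : Tm t -> tame (fun x y => t (scons x y)).
Proof.
elim=> {t} [[|i]|c|t u _ IHt _ IHu|t _ IH|i j t _ IH].
- apply: tame_std => n; have [a [f [B [df dB E]]]] := Std_lin n 1 (Tm_cst r 0).
  by exists a, f, B; split=> // x y w; rewrite -E mul1r addr0.
- by apply: tame_std => n; exact: (Std_y n (Tm_var r i)).
- by apply: tame_std => n; exact: (Std_y n (Tm_cst r c)).
- move=> St E P wfS dE H; apply: (IHt St E P wfS dE) => S1 E1 h1 wf1 le1 dE1 s1 dh1 Eh1.
  apply: (IHu S1 E1 P wf1 dE1) => S2 E2 h2 wf2 le2 dE2 s2 dh2 Eh2.
  apply: (H S2 E2 (fun x y w => h1 x y w + h2 x y w)) => //.
  + exact: leq_trans le2.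
  + by move=> x y w /s2 /s1.
  + exact: Std_add (Std_mono le2 dh1) dh2.
  + by move=> x y w HE; rewrite (Eh2 _ _ _ HE) (Eh1 _ _ _ (s2 _ _ _ HE)).
- move=> St E P wfS dE H; apply: (IH St E P wfS dE) => S1 E1 h1 wf1 le1 dE1 s1 dh1 Eh1.
  apply: (H S1 E1 (fun x y w => -1 * h1 x y w)) => //; first exact: Std_scale.
  by move=> x y w /Eh1 ->; rewrite mulN1r.
move=> St E P wfS dE H; apply: (IH St E P wfS dE) => S1 E1 h1 wf1 le1 dE1 s1 dh1 Eh1.
apply: (step wf1 dh1) => //.
- move=> E2 l k k' dE2 s2 Hl Ei.
  apply: (H S1 E2 (fun _ _ w => (r (w l + k - k' + i - j)%N)%:Z)) => //.
  + by move=> x y w /s2 /s1.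
  + exact: (Std_w (b := fun m => (r (m + k - k' + i - j)%N)%:Z) Hl (evop_comp k k' (evop_comp i j (evopr r)))).
  + by move=> x y w HE; rewrite (Eh1 _ _ _ (s2 _ _ _ HE)) (Ei _ _ _ HE).
- move=> E2 f k k' dE2 s2 df Ei.
  apply: (H S1 E2 (fun _ y _ => (r (idx (r (idx (f y) + k - k')%N)%:Z + i - j)%N)%:Z)) => //.
  + by move=> x y w /s2 /s1.
  + by apply: Std_y; apply: Tm_L; apply: Tm_L.
  + by move=> x y w HE; rewrite (Eh1 _ _ _ (s2 _ _ _ HE)) (Ei _ _ _ HE) idx_r.
move=> S2 E2 k k' wf2 dim2 dE2 s2 Ei.
apply: (H S2 E2 (fun _ _ w => (r (w (sdim S1).+1 + k - k' + i - j)%N)%:Z)) => //.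
- by rewrite dim2 ltnW // ltnS.
- by rewrite dim2.
- by move=> x y w /s2 /s1.
- rewrite dim2; exact: (Std_w (b := fun m => (r (m + k - k' + i - j)%N)%:Z) (leqnn _)
    (evop_comp k k' (evop_comp i j (evopr r)))).
- by move=> x y w HE; rewrite (Eh1 _ _ _ (s2 _ _ _ HE)) (Ei _ _ _ HE).
Qed.

Inductive atomM : (env -> Prop) -> Prop :=
| aM_pos t : Tm t -> atomM (fun e => 0 < t e)
| aM_dvd m t : (m %| M)%N -> Tm t -> atomM (fun e => (m %| t e)%Z).

Lemma tame_prop p : BoolCl atomM p -> forall St E P, wf St -> Cond (sdim St) E ->
  (forall St' E' E2, wf St' -> (sdim St <= sdim St')%N -> Cond (sdim St') E' ->
    (forall x y w, E' x y w -> E x y w) -> Cond (sdim St') E2 ->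
    (forall x y w, E' x y w -> p (scons x y) <-> E2 x y w) ->
    Solve St' (fun x y w => E' x y w /\ P x y)) ->
  Solve St (fun x y w => E x y w /\ P x y).
Proof.
elim=> {p} [p [t dt|m t mM dt]|Q|p _ IH|p q _ IHp _ IHq|p q _ IH Epq] St E P wfS dE H.
- apply: (tame_Tm dt wfS dE) => S1 E1 h1 wf1 le1 dE1 s1 dh1 Eh1.
  apply: (H S1 E1 (fun x y w => 0 < h1 x y w)) => //; last by move=> x y w /Eh1 ->.
  exact: Cond_lt (Std_y _ (Tm_cst r 0)) dh1.
- apply: (tame_Tm dt wfS dE) => S1 E1 h1 wf1 le1 dE1 s1 dh1 Eh1.
  apply: (H S1 E1 (fun x y w => (m %| h1 x y w)%Z)) => //; last by move=> x y w /Eh1 ->.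
  have [a [f [B [df dB Eh]]]] := dh1.
  by apply: (Cond_iff (Cond_dvd a mM df dB)) => x y w; rewrite Eh.
- by apply: (H St E (fun _ _ _ => Q)) => //; exact: Cond_const.
- apply: (IH St E P wfS dE) => S1 E1 E2 wf1 le1 dE1 s1 dE2 Eh1.
  apply: (H S1 E1 (fun x y w => ~ E2 x y w)) => //; first exact: Cond_not.
  by move=> x y w /Eh1 ->.
- apply: (IHp St E P wfS dE) => S1 E1 Ep wf1 le1 dE1 s1 dEp Eh1.
  apply: (IHq S1 E1 P wf1 dE1) => S2 E2 Eq wf2 le2 dE2 s2 dEq Eh2.
  apply: (H S2 E2 (fun x y w => Ep x y w /\ Eq x y w)) => //.
  + exact: leq_trans le2.
  + by move=> x y w /s2 /s1.
  + by apply: Cond_and => //; exact: Cond_mono dEp.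
  + by move=> x y w HE; rewrite (Eh1 _ _ _ (s2 _ _ _ HE)) (Eh2 _ _ _ HE).
- apply: (IH St E P wfS dE) => S1 E1 E2 wf1 le1 dE1 s1 dE2 Eh1.
  by apply: (H S1 E1 E2) => // x y w /Eh1 <-; rewrite Epq.
Qed.

(** The trivial expansion: [x], up to sign, is its own remainder, and the only coordinate is the
    size of [|x|] rounded to the class. *)
Definition first_state (i : bool * 'I_d) : state :=
  State 0 ((-1) ^+ i.1) (fun=> 0) (fun _ _ => 0) i.2 1.

Lemma honest1_eq (j : int) : honest1 (fun x _ => x = j).
Proof.
apply: (honest_param_free (phi := fun e => e 0%N = j)); apply: Def_eq.
  exact: DefFun_var.
exact: DefFun_const.
Qed.

Lemma honest1_atomM p : BoolCl atomM p -> honest1 (fun x y => p (scons x y)).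
Proof.
move=> dp; have wf0 i : wf (first_state i).
  by split=> //=; [rewrite expf_neq0|exact: Tm_cst].
have solved i : Solve (first_state i) (fun x y _ => True /\ p (scons x y)).
  apply: (tame_prop (E := fun _ _ _ => True) (P := fun x y => p (scons x y)) dp (wf0 i)).
    exact: Cond_const.
  move=> S1 E1 E2 wf1 _ dE1 _ dE2 Eh.
  apply: (solve_eqv (Cond_solve wf1 (Cond_and dE1 dE2))) => x y w.
  by split=> -[HE]; rewrite (Eh x y w HE).
have [D0 HD] := fin_bound solved.
pose D := (d * D0)%N; have le : (D0 <= D)%N by apply: leq_pmull.
have dD : (d %| D)%N by apply: dvdn_mulr.
(* Beyond [X] the size of [|x|] stays at least [N + 2 * D] after rounding down by less than [d]. The
   finitely many remaining values of [x] are treated as constants. *)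
pose X := r (N + 2 * D + d).
have small (j : 'I_(X + X).+1) : honest1 (fun x y => x = j%:Z - X%:Z /\ p (scons (j%:Z - X%:Z) y)).
  by apply: honest1_and (honest1_eq _) _; exact: honest1_const.
apply: (honest1_iff (honest1_or (honest1_fin (fun i => HD D le i dD)) (honest1_fin small))) => x y.
split=> [[[i [w [_ []]]]//|[j [-> ]]]//|px].
case: (lerP `|x| X%:Z) => [sx|bx].
  right; have lt : (`|(x + X%:Z)%R| < (X + X).+1)%N by lia.
  exists (Ordinal lt); have -> : (Ordinal lt)%:Z - X%:Z = x by rewrite /=; lia.
  by split.
left; pose q := idx (`|x| - 1).
have qN : (N + 2 * D + d <= q)%N by apply: idx_ge => //; rewrite -/X; lia.
have qle : (r q)%:Z < `|x|.
  have := @idx_le r (`|x| - 1); have := ler_r r_inc 0 (N + 2 * D + d); rewrite -/q -/X; lia.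
have qlt : `|x| <= (r q.+1)%:Z by have := idx_lt r_inc (`|x| - 1); rewrite -/q; lia.
have [s0 [u [slt qE]]] : exists s0 u, (s0 < d)%N /\ (q = N + d * u + s0)%N.
  exists ((q - N) %% d)%N, ((q - N) %/ d)%N; split; first by rewrite ltn_mod.
  rewrite mulnC -addnA -divn_eq subnKC //; lia.
exists (x < 0, Ordinal slt), (fun=> N + d * u)%N; split=> //; split=> /=.
  split=> [i _||]; [by eexists|split=> //|]; clear - qN qE slt; lia.
rewrite /core /rho /= big_ord0 !subr0 !mul1r -qE.
by case: (ltrP x 0) => Hx; rewrite ?expr0 ?expr1; lia.
Qed.

End Solve.


(** * A common modulus, and the conclusion *)

Lemma atomM_mono r M M' p : (M %| M')%N -> BoolCl (atomM r M) p -> BoolCl (atomM r M') p.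
Proof.
move=> MM'; apply: (BC_map (f := id)) => {}p [t dt|m t mM dt]; apply: BC_base.
  exact: aM_pos.
by apply: aM_dvd dt; exact: dvdn_trans MM'.
Qed.

Lemma QF_modulus r p : QF r p -> exists2 M, (0 < M)%N & BoolCl (atomM r M) p.
Proof.
elim=> {p} [p [t dt|m t m0 dt]|Q|p _ [M M0 IH]|p q _ [M M0 IH] _ [M' M0' IH']|p q _ [M M0 IH] E].
- by exists 1%N => //; apply: BC_base; exact: aM_pos.
- by exists m => //; apply: BC_base; exact: aM_dvd.
- by exists 1%N => //; exact: BC_const.
- by exists M => //; exact: BC_not.
- exists (M * M')%N; first by rewrite muln_gt0 M0.
  by apply: BC_and; [apply: atomM_mono IH; exact: dvdn_mulr|apply: atomM_mono IH'; exact: dvdn_mull].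
- by exists M => //; exact: BC_iff IH E.
Qed.

Theorem mainTheorem14 (r : nat -> nat) :
  (forall m, (r m < r m.+1)%N) ->
  sparse r ->
  congruence_periodic r ->
  (forall n : nat, (0 < n)%N -> F_prop r n) ->
  distal r.
Proof.
move=> r_inc r_sparse r_cong HF; apply: distal_of_honest => phi dphi dep.
(* Since [phi] depends on one object variable only, the others are set to 0 and the parameters take
   the positions from 1 on. *)
pose p (e : env) := phi (scons (e 0%N) (fun=> 0)) (shift e).
have [f Hf] : Def r p.
  apply: (Def2_sub (f := fun i e => scons (e 0%N) (fun=> 0) i) (g := fun i e => shift e i) dphi).
    by case=> [|i]; [exact: DefFun_var|exact: DefFun_const].
  by move=> i; exact: DefFun_var.
have dp : QF r p := BC_iff (quantifier_elimination r_inc r_sparse r_cong f) Hf.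
have [M M0 {}dp] := QF_modulus dp; have [N [d [d0 per]]] := r_cong M M0.
apply: (honest_iff (honest1_atomM r_inc r_sparse HF d0 M0 per dp)) => x y.
by rewrite /p sconsK; apply: dep => -[].
Qed.
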